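(* Let $C\subset\mathbb{P}^2(\overline{\mathbb{Q}})$ be the line $x_0+x_1+x_2=0$ and set $\eta=\frac{2\,\zeta(3)}{3\,\zeta(2)}$, where $\zeta$ is the Riemann zeta function. For each $\varepsilon>0$ we have that \[ \lim_{d\to+\infty}\frac{1}{d^2-1}\,\#\{\omega\in\mu_d^2\setminus\{(1,1)\}\mid|\mathrm{h}(C\cap\omega C)-\eta|<\varepsilon\}=1. \] Moreover, \[ \lim_{d\to+\infty}\frac{1}{d^2-1}\sum_{\omega\in\mu_d^2\setminus\{(1,1)\}}\mathrm{h}(C\cap\omega C)=\eta. \]
   Context: $\overline{\mathbb{Q}}$ is an algebraic closure of $\mathbb{Q}$ and $\mu_d\subset\overline{\mathbb{Q}}^\times$ is the group of $d$-th roots of unity. The torus $(\overline{\mathbb{Q}}^\times)^2$ acts on $\mathbb{P}^2(\overline{\mathbb{Q}})$ by $\omega\,[\xi_0:\xi_1:\xi_2]=[\xi_0:\omega_1\xi_1:\omega_2\xi_2]$, so that $\omega C$ is the line $x_0+\omega_1^{-1}x_1+\omega_2^{-1}x_2=0$. For $\omega\neq(1,1)$ a pair of roots of unity, $C\cap\omega C$ consists of the single point $[\omega_2^{-1}-\omega_1^{-1}:1-\omega_2^{-1}:\omega_1^{-1}-1]$, and $\mathrm{h}(C\cap\omega C)$ denotes the height of this point. The (canonical) height of $\xi=[\xi_0:\dots:\xi_n]\in\mathbb{P}^n(\overline{\mathbb{Q}})$ is \[ \mathrm{h}(\xi)=\sum_{v}\sum_{w\mid v}\frac{[K_w:\mathbb{Q}_v]}{[K:\mathbb{Q}]}\log\max(|\xi_0|_w,\dots,|\xi_n|_w),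 \] where $K$ is any number field containing all $\xi_i$, $v$ ranges over the places of $\mathbb{Q}$ (with the usual Archimedean absolute value and the usual $p$-adic absolute values), $w$ ranges over the places of $K$ above $v$, and $|\cdot|_w$ is the absolute value in the class of $w$ extending $|\cdot|_v$. It depends neither on $K$ nor on the choice of homogeneous coordinates. *)

(* Defs.v *)
From mathcomp Require Import all_boot all_order all_algebra all_field.
From mathcomp Require Import ring.
From mathcomp Require Import all_classical all_reals all_analysis.

Set Implicit Arguments.
Unset Strict Implicit.
Unset Printing Implicit Defensive.

Import Order.TTheory GRing.Theory Num.Theory.
Import numFieldNormedType.Exports.

Local Open Scope classical_set_scope.
Local Open Scope ring_scope.

Record absolute_value (R : realType) (K : fieldType) (w : K -> R) : Prop := {
  absv_ge0 : forall x, 0 <= w x;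
  absv_eq0 : forall x, w x = 0 <-> x = 0;
  absvM : forall x y, w (x * y) = w x * w y;
  absvD : forall x y, w (x + y) <= w x + w y }.

(* [(L, u)], with the embedding [j], is a completion of [(K, w)]. *)
Record is_completion (R : realType) (K : fieldType) (w : K -> R)
    (L : fieldType) (u : L -> R) (j : {rmorphism K -> L}) : Prop := {
  compl_absv : absolute_value u;
  compl_isometry : forall x, u (j x) = w x;
  compl_dense : forall (y : L) (e : R), 0 < e -> exists x, u (j x - y) < e;
  compl_complete : forall s : nat -> L,
    (forall e : R, 0 < e -> exists N, forall m n,
       (N <= m)%N -> (N <= n)%N -> u (s m - s n) < e) ->
    exists l : L, forall e : R, 0 < e -> exists N, forall n,
       (N <= n)%N -> u (s n - l) < e }.

(* [None] is the Archimedean place, [Some p] is the place of the prime [p]. *)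
Definition rat_place : Type := option {p : nat | prime p}.

Definition padic_abs (R : realType) (p : nat) (x : rat) : R :=
  if x == 0 then 0
  else p%:R ^+ logn p `|denq x|%N / p%:R ^+ logn p `|numq x|%N.

Definition rat_abs (R : realType) (v : rat_place) (x : rat) : R :=
  match v with
  | None => ratr `|x|
  | Some p => padic_abs R (val p) x
  end.

(* A place [w] of [K] above [v] is represented by the only absolute value of
   its class that extends the normalized absolute value of [v]. *)
Definition places_above (R : realType) (K : fieldExtType rat) (v : rat_place) :
    set (K -> R) :=
  [set w | absolute_value w /\ forall q : rat, w q%:A = rat_abs R v q].
Arguments places_above : clear implicits.

(* [K_w : Q_v] = n, for [Q_v] and [K_w] the completions, with [K_w] seen as an
   extension of [Q_v] through an isometric embedding.  That embedding
   automatically commutes with those of [rat] and [K], as [rat] admits at most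
   one morphism to a given field. *)
Definition has_local_degree (R : realType) (K : fieldExtType rat)
    (v : rat_place) (w : K -> R) (n : nat) : Prop :=
  exists (Qv : fieldType) (absQv : Qv -> R) (i : {rmorphism rat -> Qv})
         (Kw : fieldExtType Qv) (absKw : Kw -> R) (j : {rmorphism K -> Kw}),
    [/\ is_completion (rat_abs R v) absQv i,
        is_completion w absKw j,
        forall a : Qv, absKw a%:A = absQv a &
        \dim {: Kw}%VS = n].

Definition local_degree (R : realType) (K : fieldExtType rat) (v : rat_place)
    (w : K -> R) : nat :=
  xget 0%N [set n | has_local_degree v w n].

(* A point of the [n]-dimensional projective space is given by a nonzero row of
   homogeneous coordinates.  Both sums have finite support. *)
Definition height_in (R : realType) (K : fieldExtType rat) (n : nat)
    (x : 'rV[K]_n.+1) : R :=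
  \sum_(v \in [set: rat_place]) \sum_(w \in places_above R K v)
    (local_degree v w)%:R / (\dim {: K}%VS)%:R
    * ln (\big[Num.max/0]_(i < n.+1) w (x 0 i)).

(* The algebraic closure of the rationals is [algC].  The height of a point does
   not depend on the number field containing its coordinates in which it is
   computed: [num_field x] is the field that these coordinates generate. *)
Section NumberFieldOfPoint.
Variables (n : nat) (x : 'rV[algC]_n.+1).

Let coords := [seq x 0 i | i <- enum 'I_n.+1].
Let data := num_field_exists coords.

Definition num_field : fieldExtType rat := projT1 data.

Definition num_field_coords : 'rV[num_field]_n.+1 :=
  \row_i nth 0 (s2val (projT2 (projT2 data))) i.

Lemma num_field_coordsP :
  exists iota : {rmorphism num_field -> algC}, map_mx iota num_field_coords = x.
Proof.
exists (projT1 (projT2 data)); apply/rowP => i; rewrite !mxE.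
have Es := s2valP (projT2 (projT2 data)).
have szs : size (s2val (projT2 (projT2 data))) = n.+1.
  by rewrite -(size_map (projT1 (projT2 data))) Es size_map size_enum_ord.
rewrite -(nth_map 0 0) ?szs // Es (nth_map ord0) ?size_enum_ord //.
by rewrite nth_ord_enum.
Qed.

End NumberFieldOfPoint.

Definition height (R : realType) (n : nat) (x : 'rV[algC]_n.+1) : R :=
  height_in R (num_field_coords x).

(* Subsets of the plane are given by the homogeneous coordinates of their
   points. *)
Definition lineC : set 'rV[algC]_3 :=
  [set x : 'rV[algC]_3 | x != 0 /\ x 0 0 + x 0 1 + x 0 2%:R = 0].

Definition row3 (a b c : algC) : 'rV[algC]_3 :=
  \row_(i < 3) nth 0 [:: a; b; c] i.

Definition torus_act (w : algC * algC) (x : 'rV[algC]_3) : 'rV[algC]_3 :=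
  row3 (x 0 0) (w.1 * x 0 1) (w.2 * x 0 2%:R).

Definition cap_point (w : algC * algC) : 'rV[algC]_3 :=
  row3 (w.2^-1 - w.1^-1) (1 - w.2^-1) (w.1^-1 - 1).

(* The intersection of [C] with its translate by [w] is exactly the point with
   homogeneous coordinates [cap_point w]. *)
Lemma cap_pointP (w : algC * algC) : w.1 != 0 -> w.2 != 0 -> w != (1, 1) ->
  cap_point w != 0 /\
  lineC `&` (torus_act w @` lineC) = [set c *: cap_point w | c in [set~ 0]].
Proof.
move=> w1 w2 nw.
have nab : w.1^-1 != 1 \/ w.2^-1 != 1.
  have [e1|] := eqVneq w.1^-1 1; last by left.
  have [e2|] := eqVneq w.2^-1 1; last by right.
  move/negP: nw; case; apply/eqP; rewrite [w]surjective_pairing.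
  by rewrite -[w.1]invrK -[w.2]invrK e1 e2 invr1.
have row3P (a b c : algC) (x : 'rV[algC]_3) :
    x = row3 a b c <-> [/\ x 0 0 = a, x 0 1 = b & x 0 2%:R = c].
  split=> [->|[<- <- <-]]; first by rewrite !mxE.
  apply/rowP => -[[|[|[|//]]] i3]; rewrite mxE /=; congr (x _ _);
    exact: val_inj.
have row3_neq0 (x : 'rV[algC]_3) :
    x != 0 <-> ~ [/\ x 0 0 = 0, x 0 1 = 0 & x 0 2%:R = 0].
  have -> : (0 : 'rV[algC]_3) = row3 0 0 0.
    by apply/esym/esym/row3P; rewrite !mxE.
  by split=> [/eqP nx /row3P //|nx]; apply/eqP => /row3P.
have cp0 : cap_point w != 0.
  apply/row3_neq0; rewrite !mxE /= => -[_ /eqP + /eqP].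
  rewrite !subr_eq0 eq_sym => /eqP e2 /eqP e1.
  by case: nab; rewrite ?e1 ?e2 eqxx.
split=> //; apply/seteqP; split=> x /=.
- move=> [[x0 sx] [y [y0 sy] Ey]].
  have [Ex0 Ex1 Ex2] : [/\ x 0 0 = y 0 0, x 0 1 = w.1 * y 0 1
      & x 0 2%:R = w.2 * y 0 2%:R] by apply/row3P; rewrite -Ey.
  have sx' : x 0 0 + w.1^-1 * x 0 1 + w.2^-1 * x 0 2%:R = 0.
    by rewrite Ex0 Ex1 Ex2 !mulKf.
  have cr : x 0 1 * (w.1^-1 - 1) = x 0 2%:R * (1 - w.2^-1).
    apply/eqP; rewrite -subr_eq0 -[X in _ == X](subrr 0) -{1}sx' -sx.
    by apply/eqP; ring.
  have [c Ec1 Ec2] : exists2 c, x 0 1 = c * (1 - w.2^-1)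
      & x 0 2%:R = c * (w.1^-1 - 1).
    have [e1|n1] := eqVneq w.1^-1 1.
      have n2 : 1 - w.2^-1 != 0.
        by rewrite subr_eq0 eq_sym; case: nab => //; rewrite e1 eqxx.
      exists (x 0 1 / (1 - w.2^-1)); first by rewrite divfK.
      move: cr; rewrite e1 subrr !mulr0 => /esym/eqP.
      by rewrite mulf_eq0 (negbTE n2) orbF => /eqP.
    have n1' : w.1^-1 - 1 != 0 by rewrite subr_eq0.
    exists (x 0 2%:R / (w.1^-1 - 1)); last by rewrite divfK.
    by rewrite mulrAC -cr mulfK.
  have Ec : c *: cap_point w = x.
    transitivity (row3 (x 0 0) (x 0 1) (x 0 2%:R)); last exact/esym/row3P.
    apply/row3P; rewrite !mxE /= Ec1 Ec2; split=> //.
    have -> : x 0 0 = - (x 0 1 + x 0 2%:R).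
      by apply/eqP; rewrite -addr_eq0 addrA sx.
    by rewrite Ec1 Ec2; ring.
  by exists c => // c0; case/eqP: x0; rewrite -Ec c0 scale0r.
- move=> [c /eqP c0 <-].
  have ncp : c *: cap_point w != 0 by rewrite scaler_eq0 negb_or c0.
  split; first by split=> //; rewrite !mxE /=; ring.
  exists (row3 (c * (w.2^-1 - w.1^-1)) (w.1^-1 * (c * (1 - w.2^-1)))
               (w.2^-1 * (c * (w.1^-1 - 1)))).
    split; last by rewrite !mxE /=; ring.
    apply/row3_neq0; rewrite !mxE /= => -[/eqP + /eqP + /eqP].
    rewrite !mulf_eq0 !invr_eq0 (negbTE c0) (negbTE w1) (negbTE w2) /=.
    move=> /eqP p0 /eqP p1 /eqP p2; move/row3_neq0: cp0.
    by rewrite !mxE /=; apply.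
  by apply/esym/row3P; rewrite !mxE /= !mulVKf.
Qed.


(* For a pair [w] of roots of unity other than [(1, 1)]. *)
Definition heightCap (R : realType) (w : algC * algC) : R :=
  height R (cap_point w).

Definition torsion (d : nat) : set (algC * algC) :=
  [set w | [/\ d.-unity_root w.1, d.-unity_root w.2 & w != (1, 1)]].

(* The Riemann zeta function on the half-line [s > 1]. *)
Definition zeta (R : realType) (s : R) : R :=
  limn (series (fun n : nat => n.+1%:R `^ (- s))).

Definition eta (R : realType) : R := (2 * zeta 3) / (3 * zeta 2).

(* Main.v *)
(* Write [a = w.1^-1 = e^(i x)] and [b = w.2^-1 = e^(i y)], and let [N] be the
   order of [w], so that the point lives in the [N]-th cyclotomic field.  Its
   Archimedean places contribute to the height the average, over the Galois orbit
   of [(x, y)], of [f = ln (max |1 - a| |1 - b| |a - b|)]; the [p]-adic ones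
   contribute nothing unless [N] is a power of [p], and then at most
   [ln p / phi(N)].
   Averages of a trigonometric polynomial over Galois orbits are constant up to an
   error that is small in mean square, as [phi(d)] tends to infinity, and [f] is
   approximated in mean by trigonometric polynomials, its singularity being
   controlled by [\prod_(0 < r < d) |1 - zeta^r| = d].  So the heights concentrate
   around the mean of [f], which is computed on the [d]-torsion for [6 %| d]: there
   [f] only depends on the longest of the three arcs cut by [1, a, b], whose
   distribution is piecewise linear.  Summation by parts against
   [ln |1 - e^(i t)| = - \sum_k cos (k t) / k] yields
   [6 / (4 pi^2) * \sum_k (7/2 - 8 [2 | k] + 9/2 [3 | k]) / k^3 = 4 zeta(3) / pi^2],
   and [zeta(2) = pi^2 / 6]. *)
From HB Require Import structures.
Require Import Defs.
From mathcomp Require Import all_boot all_order all_algebra all_field.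
From mathcomp Require Import cyclic finmap ring lra zify complex.
From mathcomp Require Import all_classical all_reals all_analysis.

Set Implicit Arguments.
Unset Strict Implicit.
Unset Printing Implicit Defensive.

Import Order.TTheory GRing.Theory Num.Theory.
Import numFieldNormedType.Exports.

Local Open Scope classical_set_scope.
Local Open Scope ring_scope.

(** Places are arbitrary absolute values and local degrees come from arbitrary completions, so both
    have to be determined for cyclotomic fields. The tool is that a bound [w <= C * v] forces
    [w = v]. At infinity, [z + z^-1] is, for [w], a limit of rationals tending to some
    [2 * cos (2 pi k / N)], which bounds [w] by the modulus of a complex embedding. At [p], for [N]
    a power of [p], rational multiples of distinct powers of [1 - z] have distinct sizes, which
    bounds coordinates, hence a unique place and a bound on its degree. Orbits are indexed by the
    units modulo [d], not modulo the order of the point, so that one index set serves all the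
    [d]-torsion. The singularity of the logarithm is removed by moving off the unit circle to a
    radius [x > 1]: [|x - e^(i t)|^2 / x] is [|1 - e^(i t)|^2] plus a constant, and the total change
    over the roots of unity is explicit, as both products are. The same move damps the Fourier
    series by [x^-k]. The divisor 6 makes the corners [d / 3] and [d / 2] of the distribution of the
    longest arc integers. *)

Section Growth.
Variable R : realType.

(** If [a > b], Bernoulli's inequality makes [(a / b) ^+ (2 * n)] at least [(n * t) ^+ 2] with
    [t = a / b - 1], which outgrows any linear function. The factor [n.+1] leaves room for the
    number of terms of a binomial expansion. *)
Lemma le_of_exprn_le (a b C : R) : 0 <= a -> 0 <= b ->
  (forall n : nat, a ^+ n <= C * n.+1%:R * b ^+ n) -> a <= b.
Proof.
move=> a0 b0 h; rewrite leNgt; apply/negP => ltba.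
have [be|bn0] := eqVneq b 0.
  have := h 1%N; rewrite !expr1 be mulr0 => ale.
  by move: ltba; rewrite be ltNge ale.
have bp : 0 < b by rewrite lt_def bn0.
pose t := a / b - 1.
have tp : 0 < t by rewrite subr_gt0 ltr_pdivlMr // mul1r.
have bern n : 1 + n%:R * t <= (1 + t) ^+ n.
  elim: n => [|n IH]; first by rewrite mul0r addr0 expr0.
  rewrite exprS.
  have : (1 + t) * (1 + n%:R * t) <= (1 + t) * (1 + t) ^+ n.
    by rewrite ler_wpM2l // addr_ge0 // ltW.
  apply: le_trans.
  rewrite -natr1.
  have : 0 <= n%:R * (t * t) by rewrite mulr_ge0 // mulr_ge0 // ltW.
  lra.
have h2 n : (n%:R * t) ^+ 2 <= C * (n * 2).+1%:R.
  have := h (n * 2)%N.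
  rewrite -ler_pdivrMr ?exprn_gt0 // -exprVn -exprMn => /(le_trans _); apply.
  have -> : a * b^-1 = 1 + t by rewrite /t addrC subrK.
  rewrite exprM; apply: lerXn2r; rewrite ?nnegrE.
  - by rewrite mulr_ge0 // ltW.
  - by rewrite exprn_ge0 // addr_ge0 // ltW.
  - by apply: le_trans (bern n); rewrite lerDr.
have C0 : 0 < C.
  have := h 0%N; rewrite !expr0 !mulr1 => /(lt_le_trans _) -> //.
have [n hn] : exists n : nat, 3 * C / t ^+ 2 < n%:R.
  by exists (Num.bound (3 * C / t ^+ 2)); apply: archi_boundP;
     rewrite divr_ge0 ?mulr_ge0 ?exprn_ge0 // ltW.
have n1 : (1 <= n)%N.
  rewrite lt0n; apply/eqP => n0; move: hn; rewrite n0 ltNge => /negP; apply.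
  by rewrite divr_ge0 ?mulr_ge0 ?exprn_ge0 // ltW.
move: hn; rewrite ltr_pdivrMr ?exprn_gt0 // => hn.
have := h2 n; rewrite leNgt => /negP; apply.
have n1' : 1 <= n%:R :> R by rewrite ler1n.
have -> : (n * 2).+1%:R = n%:R * 2 + 1 :> R by rewrite -natr1 natrM.
rewrite exprMn.
apply: (@le_lt_trans _ _ (n%:R * (3 * C))).
  have : 0 <= C * (n%:R - 1) by rewrite mulr_ge0 ?subr_ge0 // ltW.
  lra.
by rewrite expr2 -mulrA ltr_pM2l // (lt_le_trans _ n1').
Qed.

End Growth.

(** * Absolute values on a field, and bounds on local degrees *)

Section AbsoluteValue.
Variables (R : realType) (K : fieldType).
Implicit Types w v : K -> R.

Lemma absv0 w : absolute_value w -> w 0 = 0.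
Proof. by move=> hw; apply/(absv_eq0 hw). Qed.

Lemma absv_gt0 w x : absolute_value w -> x != 0 -> 0 < w x.
Proof.
move=> hw x0; rewrite lt_def absv_ge0 // andbT.
by apply: contra x0 => /eqP /(absv_eq0 hw) ->.
Qed.

Lemma absv1 w : absolute_value w -> w 1 = 1.
Proof.
move=> hw; have h : w 1 != 0 by rewrite gt_eqF // absv_gt0 // oner_neq0.
by apply: (mulfI h); rewrite -(absvM hw) !mulr1.
Qed.

Lemma absvX w x n : absolute_value w -> w (x ^+ n) = w x ^+ n.
Proof.
move=> hw; elim: n => [|n IH]; first by rewrite !expr0 absv1.
by rewrite !exprS absvM // IH.
Qed.

Lemma absv_unity_root w x n : absolute_value w -> (0 < n)%N -> x ^+ n = 1 ->
  w x = 1.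
Proof.
move=> hw n0 xn; apply/eqP; rewrite -(@pexpr_eq1 _ _ n) ?absv_ge0 //.
by rewrite -absvX // xn absv1.
Qed.

Lemma absvN w x : absolute_value w -> w (- x) = w x.
Proof.
move=> hw; rewrite -mulN1r absvM // (@absv_unity_root w (-1) 2) ?mul1r //.
by rewrite sqrrN expr1n.
Qed.

Lemma absvB w x y : absolute_value w -> w (x - y) <= w x + w y.
Proof. by move=> hw; rewrite -(absvN y hw) absvD. Qed.

Lemma absvV w x : absolute_value w -> w x^-1 = (w x)^-1.
Proof.
move=> hw; have [->|x0] := eqVneq x 0; first by rewrite invr0 absv0 // invr0.
have h : w x != 0 by rewrite gt_eqF // absv_gt0.
by apply: (mulfI h); rewrite -absvM // !mulfV // absv1.
Qed.

Lemma absv_prod w (I : Type) (r : seq I) (P : pred I) (F : I -> K) :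
  absolute_value w -> w (\prod_(i <- r | P i) F i) = \prod_(i <- r | P i) w (F i).
Proof.
by move=> hw; apply: (big_morph w) => [x y|]; rewrite ?absvM ?absv1.
Qed.

Lemma absv_sum w (I : Type) (r : seq I) (P : pred I) (F : I -> K) :
  absolute_value w -> w (\sum_(i <- r | P i) F i) <= \sum_(i <- r | P i) w (F i).
Proof.
move=> hw; elim/big_ind2 : _ => // [|x y x' y' h1 h2]; first by rewrite absv0.
by apply: le_trans (absvD hw _ _) _; rewrite lerD.
Qed.

(* Applied to powers, a bound up to a constant becomes a bound without it; then
   inverses give the opposite inequality. *)
Lemma absv_eq_of_le w v (C : R) : absolute_value w -> absolute_value v ->
  (forall x, w x <= C * v x) -> w = v.
Proof.
move=> hw hv h.
have C0 : 0 <= C by have := h 1; rewrite !absv1 // mulr1; apply: le_trans.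
have le x : w x <= v x.
  apply: (@le_of_exprn_le _ _ _ C); rewrite ?absv_ge0 // => n.
  rewrite -!absvX //; apply: le_trans (h _) _.
  by rewrite ler_wpM2r ?absv_ge0 // ler_peMr // ler1n.
apply/funext => x; apply/eqP; rewrite eq_le le /=.
have [->|x0] := eqVneq x 0; first by rewrite !absv0.
by rewrite -[leRHS]invrK -[leLHS]invrK lef_pV2 ?posrE ?invr_gt0 ?absv_gt0 // -!absvV.
Qed.

(** The expansion of [(x + y) ^+ n] has [n.+1] terms of size at most [M ^+ n], binomial coefficients
    having size at most 1; the factor [n.+1] disappears by [le_of_exprn_le]. *)
Lemma absv_ultrametric w x y : absolute_value w ->
  (forall n : nat, w n%:R <= 1) -> w (x + y) <= Num.max (w x) (w y).
Proof.
move=> hw hn; set M := Num.max _ _.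
have M0 : 0 <= M by rewrite le_max absv_ge0.
apply: (@le_of_exprn_le _ _ _ 1) => // [|n]; first exact: absv_ge0.
rewrite -absvX // exprDn; apply: le_trans (absv_sum _ _ _ hw) _.
apply: (@le_trans _ _ (\sum_(i < n.+1) M ^+ n)); last first.
  by rewrite big_const_ord iter_addr_0 mul1r mulr_natl.
apply: ler_sum => i _; rewrite -mulr_natr !absvM // !absvX //.
rewrite -[leRHS]mulr1; apply: ler_pM; rewrite ?mulr_ge0 ?exprn_ge0 ?absv_ge0 //.
have -> : M ^+ n = M ^+ (n - i) * M ^+ i by rewrite -exprD subnK // -ltnS.
have hx : w x <= M by rewrite /M le_max lexx.
have hy : w y <= M by rewrite /M le_max lexx orbT.
apply: ler_pM; rewrite ?exprn_ge0 ?(absv_ge0 hw) //.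
  by apply: lerXn2r; rewrite ?nnegrE ?(absv_ge0 hw).
by apply: lerXn2r; rewrite ?nnegrE ?(absv_ge0 hw).
Qed.

End AbsoluteValue.
(** Rational combinations of the [e k] are dense in the completion, and the bound on coordinates
    makes the coordinates of a convergent sequence of combinations converge in [Qv]. So the images
    of the [e k] span the completion, whichever completions were chosen. *)
Lemma has_local_degree_le (R : realType) (K : fieldExtType rat) (v : rat_place)
    (w : K -> R) (m : nat) (e : 'I_m -> K) (C : R) (n : nat) :
  (forall x eps, 0 < eps ->
     exists q : 'I_m -> rat, w (x - \sum_k (q k)%:A * e k) < eps) ->
  (forall (q : 'I_m -> rat) k,
     rat_abs R v (q k) <= C * w (\sum_k (q k)%:A * e k)) ->
  has_local_degree v w n -> (n <= m)%N.
Proof.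
move=> dense coord [Qv [aQ [i [Kw [aK [j [cQ cK aKQ <-]]]]]]].
have hQ := compl_absv cQ; have hK := compl_absv cK.
have jiE (q : rat) : j q%:A = (i q)%:A.
  transitivity (ratr q : Kw); first exact: (fmorph_eq_rat (j \o GRing.in_alg K)).
  exact/esym/(fmorph_eq_rat (GRing.in_alg Kw \o i)).
pose S (q : 'I_m -> rat) := \sum_k (q k)%:A * e k.
have C0 : 0 <= `|C| by [].
have coord' q k : aQ (i (q k)) <= `|C| * aK (j (S q)).
  rewrite (compl_isometry cQ) (compl_isometry cK).
  apply: le_trans (coord q k) _.
  by rewrite ler_wpM2r ?ler_norm // -(compl_isometry cK) absv_ge0.
have SB q q' : S q - S q' = S (fun k => q k - q' k).
  rewrite /S -sumrB; apply: eq_bigr => k _.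
  by rewrite -mulrBl scalerBl.
suff span_all (y : Kw) : y \in <<[seq j (e k) | k <- enum 'I_m]>>%VS.
  have : ({:Kw} <= <<[seq j (e k) | k <- enum 'I_m]>>)%VS.
    by apply/subvP => y _; apply: span_all.
  move=> /dimvS /leq_trans; apply.
  by apply: leq_trans (dim_span _) _; rewrite size_map size_enum_ord.
have approx (eps : R) : 0 < eps -> exists q, aK (j (S q) - y) < eps.
  move=> eps0; have e2 : 0 < eps / 2 by lra.
  have [x hx] := compl_dense cK y e2.
  have [q hq] := dense x _ e2; exists q.
  have -> : j (S q) - y = (j x - y) - j (x - S q) by rewrite rmorphB /=; ring.
  apply: le_lt_trans (absvB _ _ hK) _.
  rewrite (compl_isometry cK); move: hx hq; rewrite -/(S q); lra.
have [q hq] : {q : nat -> 'I_m -> rat | forall N, aK (j (S (q N)) - y) < N.+1%:R^-1}.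
  have h N : {q | aK (j (S q) - y) < N.+1%:R^-1}.
    by apply: cid; apply: approx; rewrite invr_gt0 ltr0n.
  by exists (fun N => sval (h N)) => N; exact: (svalP (h N)).
have small (eps : R) : 0 < eps -> exists N0, forall N, (N0 <= N)%N -> N.+1%:R^-1 < eps.
  move=> eps0; exists (Num.bound eps^-1) => N hN.
  rewrite -[ltRHS]invrK ltf_pV2 ?posrE ?invr_gt0 ?ltr0n //.
  apply: lt_le_trans (archi_boundP _) _; first by rewrite invr_ge0 ltW.
  by rewrite ler_nat ltnW // ltnS.
(* The combinations [S (q N)] tend to [y], so each coordinate sequence is Cauchy by [coord']; its
   limit will be the coordinate of [y]. *)
have lims k : {c : Qv | forall eps : R, 0 < eps -> exists N0, forall N, (N0 <= N)%N -> aQ (i (q N k) - c) < eps}.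
  apply: cid; apply: (compl_complete cQ) => eps eps0.
  have D0 : 0 < eps / (2 * (`|C| + 1)).
    by rewrite divr_gt0 // mulr_gt0 // ltr_wpDl.
  have [N0 hN0] := small _ D0; exists N0 => a b ha hb.
  have := coord' (fun k => q a k - q b k) k.
  rewrite -SB !rmorphB /= => /le_lt_trans; apply.
  apply: (@le_lt_trans _ _ ((`|C| + 1) * aK (j (S (q a)) - j (S (q b))))).
    by rewrite ler_wpM2r ?lerDl // absv_ge0.
  rewrite mulrC -ltr_pdivlMr ?ltr_wpDl //.
  have -> : j (S (q a)) - j (S (q b)) = (j (S (q a)) - y) - (j (S (q b)) - y) by ring.
  apply: le_lt_trans (absvB _ _ hK) _.
  have := lt_trans (hq a) (hN0 a ha); have := lt_trans (hq b) (hN0 b hb).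
  rewrite invfM mulrA; lra.
pose c k := sval (lims k).
have -> : y = \sum_k c k *: j (e k).
  apply/eqP; rewrite -subr_eq0; apply/eqP/(absv_eq0 hK)/eqP.
  rewrite eq_le absv_ge0 // andbT; apply/ler_addgt0Pl => eps eps0; rewrite addr0.
  pose M := \sum_k aK (j (e k)) + 1.
  have M0 : 0 < M.
    by rewrite ltr_wpDl // sumr_ge0 // => k _; rewrite absv_ge0.
  have d0 : 0 < eps / (2 * M) by rewrite divr_gt0 // mulr_gt0.
  have [N1 h1] := small (eps / 2) ltac:(lra).
  have [N2 h2] : exists N2, forall N k, (N2 <= N)%N -> aQ (i (q N k) - c k) < eps / (2 * M).
    have h k : {N2 | forall N, (N2 <= N)%N -> aQ (i (q N k) - c k) < eps / (2 * M)}.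
      by apply: cid; apply: (svalP (lims k)).
    exists (\max_k sval (h k))%N => N k hN; apply: (svalP (h k)).
    by apply: leq_trans hN; apply: (leq_bigmax k).
  pose N := maxn N1 N2.
  have -> : y - \sum_k c k *: j (e k) =
     - (j (S (q N)) - y) + \sum_k (i (q N k) - c k)%:A * j (e k).
    suff -> : \sum_k (i (q N k) - c k)%:A * j (e k) =
        j (S (q N)) - \sum_k c k *: j (e k) by ring.
    rewrite /S rmorph_sum -sumrB; apply: eq_bigr => k _.
    by rewrite rmorphM /= jiE -!scalerAl !mul1r scalerBl.
  apply: le_trans (absvD hK _ _) _; rewrite absvN //.
  have l1 := lt_trans (hq N) (h1 N (leq_maxl _ _)).
  have l2 : aK (\sum_k (i (q N k) - c k)%:A * j (e k)) <= eps / 2.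
    apply: le_trans (absv_sum _ _ _ hK) _.
    apply: (@le_trans _ _ (\sum_k eps / (2 * M) * aK (j (e k)))).
      apply: ler_sum => k _; rewrite absvM // aKQ ler_wpM2r ?absv_ge0 //.
      by apply/ltW/h2/leq_maxr.
    rewrite -mulr_sumr invfM mulrA -mulrA ler_piMr ?divr_ge0 ?ltW //.
    by rewrite ltr_pdivrMl // mulr1 ltrDl.
  lra.
by apply: rpred_sum => k _; apply/rpredZ/memv_span/map_f/mem_enum.
Qed.

(** * Complex completions and the degree of a complex place *)

Section ComplexFieldExt.
Variable R : realType.
(** Real coordinates turn [Rcomplex R] into a [fieldExtType R], the kind of object that
    [has_local_degree] asks for as a completion. *)
Definition C2rv (z : Rcomplex R) : 'rV[R]_2 :=
  \row_i (if i == 0 then complex.Re z else complex.Im z).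
Lemma C2rv_vect : Vector.axiom 2 (Rcomplex R).
Proof.
exists C2rv.
  by move=> a [b c] [d e]; apply/rowP => i; rewrite !mxE; case: ifP.
exists (fun v : 'rV[R]_2 => Complex (v 0 0) (v 0 1)).
  by move=> [a b]; rewrite !mxE.
by move=> v; apply/rowP => i; rewrite !mxE /=; case: ifP => [/eqP->//|i0];
  congr (v _ _); apply/val_inj; case: i i0 => -[|[|[]]].
Qed.
HB.instance Definition _ := Lmodule_hasFinDim.Build R (Rcomplex R) C2rv_vect.
Lemma Rc_scaleAr (k : R) (x y : Rcomplex R) : k *: (x * y) = x * (k *: y).
Proof. by rewrite mulrC scalerAl mulrC. Qed.
HB.instance Definition _ := GRing.Lalgebra_isAlgebra.Build R (Rcomplex R) Rc_scaleAr.

Local Notation normc := (@ComplexField.Normc.normc R).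

Lemma normc_ge_absRe (z : R[i]) : `|complex.Re z| <= normc z.
Proof.
by case: z => a b /=; rewrite -sqrtr_sqr ler_wsqrtr // lerDl sqr_ge0.
Qed.

Lemma normc_ge_absIm (z : R[i]) : `|complex.Im z| <= normc z.
Proof.
by case: z => a b /=; rewrite -sqrtr_sqr ler_wsqrtr // lerDr sqr_ge0.
Qed.

Lemma normc_le_abs (z : R[i]) : normc z <= `|complex.Re z| + `|complex.Im z|.
Proof.
case: z => a b /=; rewrite -[leRHS]ger0_norm ?addr_ge0 // -sqrtr_sqr.
rewrite ler_wsqrtr // sqrrD !real_normK ?num_real // -addrA lerD2l lerDr.
by rewrite mulrn_wge0 // mulr_ge0.
Qed.

Lemma normc_rmorph_absv (K : fieldType) (s : {rmorphism K -> Rcomplex R}) :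
  absolute_value (fun x => normc (s x)).
Proof.
split=> [x|x|x y|x y].
- by case: (s x) => a b /=; rewrite sqrtr_ge0.
- split=> [/ComplexField.Normc.eq0_normc/eqP|->].
    by rewrite fmorph_eq0 => /eqP.
  by rewrite rmorph0 ComplexField.Normc.normc0.
- by rewrite rmorphM ComplexField.Normc.normcM.
- by rewrite rmorphD; apply: (le_normcD (s x) (s y)).
Qed.

Lemma normr_absv : absolute_value (Num.norm : R -> R).
Proof.
split=> //; [by move=> x; split=> [/normr0_eq0|->] //; rewrite normr0 |exact: normrM|exact: ler_normD].
Qed.

Lemma cauchy_seq_cvg (s : nat -> R) :
  (forall e, 0 < e -> exists N, forall m n, (N <= m)%N -> (N <= n)%N ->
     `|s m - s n| < e) ->
  exists l, forall e, 0 < e -> exists N, forall n, (N <= n)%N -> `|s n - l| < e.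
Proof.
move=> h.
have cv : cvgn s.
  apply/cauchy_cvgP/cauchy_exP => e e0; have [N hN] := h e e0.
  by exists (s N), N => // n hn; apply: hN.
exists (limn s) => e e0.
have /cvgrPdist_lt/(_ e e0) [N _ hN] := cv.
by exists N => n hn; rewrite distrC; apply: hN.
Qed.

Lemma ratr_dense (y e : R) : 0 < e -> exists q : rat, `|ratr q - y| < e.
Proof.
move=> e0; have [q] : exists q, ratr q \in `]y - e, y + e[ by apply: rat_in_itvoo; lra.
by rewrite in_itv /= => /andP[h1 h2]; exists q; rewrite ltr_norml; lra.
Qed.

Lemma rat_completion :
  is_completion (rat_abs R None) (Num.norm : R -> R) (ratr : {rmorphism rat -> R}).
Proof.
split; [exact: normr_absv| |exact: ratr_dense|exact: cauchy_seq_cvg].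
by move=> x; rewrite /= ratr_norm.
Qed.

Lemma rmorph_in_alg (K : fieldExtType rat) (s : {rmorphism K -> Rcomplex R}) (q : rat) :
  s q%:A = Complex (ratr q) 0.
Proof.
have -> : Complex (ratr q) 0 = (ratr q : R)%:A :> Rcomplex R.
  by congr Complex; rewrite ?mulr1 ?mulr0.
transitivity (ratr q : Rcomplex R); first exact: (fmorph_eq_rat (s \o GRing.in_alg K)).
exact/esym/(fmorph_eq_rat (GRing.in_alg (Rcomplex R) \o (ratr : {rmorphism rat -> R}))).
Qed.

Section ImaginaryEmbedding.
Variables (K : fieldExtType rat) (s : {rmorphism K -> Rcomplex R}) (z : K).
Hypothesis Im_neq0 : complex.Im (s z) != 0.

Lemma rmorph_lin (p q : rat) :
  s (p%:A + q%:A * z) = Complex (ratr p + ratr q * complex.Re (s z)) (ratr q * complex.Im (s z)).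
Proof.
rewrite rmorphD rmorphM !rmorph_in_alg; case: (s z) => a b.
by congr Complex; rewrite /= ?mul0r ?add0r ?addr0 ?subr0.
Qed.

Lemma rmorph_dense (y : Rcomplex R) (e : R) : 0 < e ->
  exists p q : rat, normc (s (p%:A + q%:A * z) - y) < e.
Proof.
move=> e0; have e2 : 0 < e / 2 by lra.
have b0 : 0 < `|complex.Im (s z)| by rewrite normr_gt0.
have [q hq] := ratr_dense (complex.Im y / complex.Im (s z)) (divr_gt0 e2 b0).
have [p hp] := ratr_dense (complex.Re y - ratr q * complex.Re (s z)) e2.
exists p, q; rewrite rmorph_lin; case: y hq hp => c d hq hp.
rewrite /= in hq hp; apply: le_lt_trans (normc_le_abs _) _ => /=.
rewrite [ltRHS]splitr; apply: ltrD; first by rewrite opprB addrA in hp.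
rewrite -(divfK Im_neq0 d) -mulrBl normrM -ltr_pdivlMr //.
Qed.

Lemma rmorph_completion :
  is_completion (fun x => normc (s x)) normc s.
Proof.
split=> //.
- exact: (normc_rmorph_absv idfun).
- by move=> y e e0; have [p [q h]] := rmorph_dense y e0; exists (p%:A + q%:A * z).
- move=> u cu.
  have [a ha] : exists a, forall e, 0 < e -> exists N, forall n, (N <= n)%N -> `|complex.Re (u n) - a| < e.
    apply: cauchy_seq_cvg => e /cu[N hN]; exists N => m n hm hn.
    by apply: le_lt_trans (hN m n hm hn); rewrite -raddfB normc_ge_absRe.
  have [b hb] : exists a, forall e, 0 < e -> exists N, forall n, (N <= n)%N -> `|complex.Im (u n) - a| < e.
    apply: cauchy_seq_cvg => e /cu[N hN]; exists N => m n hm hn.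
    by apply: le_lt_trans (hN m n hm hn); rewrite -raddfB normc_ge_absIm.
  exists (Complex a b) => e e0; have e2 : 0 < e / 2 by lra.
  have [N1 h1] := ha _ e2; have [N2 h2] := hb _ e2.
  exists (maxn N1 N2) => n; rewrite geq_max => /andP[/h1 {}h1 /h2 {}h2].
  apply: le_lt_trans (normc_le_abs _) _; rewrite [ltRHS]splitr.
  by case: (u n) h1 h2 => c d /= h1 h2; apply: ltrD.
Qed.

(** [local_degree] selects some degree satisfying [has_local_degree], so every such degree must be
    shown to be 2. It is at most 2 because the rational combinations of [1] and [z] are dense with
    controlled coordinates. *)
Lemma local_degree_complex : local_degree None (fun x => normc (s x)) = 2%N.
Proof.
have b0 : 0 < `|complex.Im (s z)| by rewrite normr_gt0.
apply: xget_unique => [|n hn].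
  exists R, Num.norm, ratr, (Rcomplex R), normc, s; split.
  - exact: rat_completion.
  - exact: rmorph_completion.
  - by move=> a /=; rewrite mulr1 mulr0 expr0n addr0 sqrtr_sqr.
  - by rewrite dimvf.
apply/eqP; rewrite eqn_leq; apply/andP; split.
  (* The imaginary part bounds the coefficient of [z], then the real part bounds the other one; [C]
     is the sum of the two bounds. *)
  pose C := `|complex.Im (s z)|^-1 + 1 + normc (s z) / `|complex.Im (s z)|.
  pose e (k : 'I_2) : K := if k == 0 then 1 else z.
  have sumE (q : 'I_2 -> rat) : \sum_k (q k)%:A * e k = (q 0)%:A + (q 1)%:A * z.
    by rewrite big_ord_recl big_ord1 /e /= mulr1; congr (_ + (q _)%:A * _); apply/val_inj.
  apply: (@has_local_degree_le _ _ _ _ _ e C n _ _ hn).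
    move=> x eps eps0; have [p [q h]] := rmorph_dense (s x) eps0.
    exists (fun k => if k == 0 then p else q).
    by rewrite sumE /= rmorphB -normcN opprB.
  move=> q k; rewrite sumE /=.
  set p0 := q 0; set p1 := q 1; set W := normc _.
  have W0 : 0 <= W by exact: (absv_ge0 (normc_rmorph_absv s)).
  have N0 : 0 <= normc (s z) by exact: (absv_ge0 (normc_rmorph_absv s)).
  have i1 : `|ratr p1 : R| <= W / `|complex.Im (s z)|.
    rewrite ler_pdivlMr // -normrM /W.
    have := normc_ge_absIm (s (p0%:A + p1%:A * z)).
    by rewrite rmorph_lin.
  have i0 : `|ratr p0 : R| <= W + W / `|complex.Im (s z)| * normc (s z).
    have h := normc_ge_absRe (s (p0%:A + p1%:A * z)).
    rewrite [X in complex.Re X]rmorph_lin /= -/W in h.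
    have -> : ratr p0 = (ratr p0 + ratr p1 * complex.Re (s z)) - ratr p1 * complex.Re (s z) :> R by ring.
    apply: le_trans (ler_normB _ _) _; apply: lerD h _.
    by rewrite normrM; apply: ler_pM => //; apply: normc_ge_absRe.
  have iv : 0 <= W / `|complex.Im (s z)| by rewrite divr_ge0.
  have CW : C * W = W / `|complex.Im (s z)| + W + W / `|complex.Im (s z)| * normc (s z).
    by rewrite /C; ring.
  have iz : 0 <= W / `|complex.Im (s z)| * normc (s z) by rewrite mulr_ge0.
  rewrite CW ratr_norm; have [->|k1] : k = 0 \/ k = 1.
    by case: k => -[|[|//]] ?; [left|right]; apply/val_inj.
    rewrite -/p0; lra.
  rewrite k1 -/p1; lra.
(* In degree at most 1, [j z] would lie in [Qv] and have rationals arbitrarily near it, whereas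
   every rational is at distance at least [|Im (s z)|] from [s z]. *)
case: hn => [Qv [aQ [i [Kw [aK [j [cQ cK aKQ dn]]]]]]].
rewrite -dn ltnNge; apply/negP => d1.
have : j z \in (1%AS : {vspace Kw}).
  suff -> : (1%AS : {vspace Kw}) = fullv by rewrite memvf.
  by apply/eqP; rewrite eqEdim subvf dimv1.
move=> /vlineP[a ja].
have [q hq] := compl_dense cQ a b0.
have jiE : j q%:A = (i q)%:A.
  transitivity (ratr q : Kw); first exact: (fmorph_eq_rat (j \o GRing.in_alg K)).
  exact/esym/(fmorph_eq_rat (GRing.in_alg Kw \o i)).
move: hq; rewrite -aKQ scalerBl -jiE -ja -rmorphB (compl_isometry cK) ltNge => /negP; apply.
apply: le_trans (normc_ge_absIm _); rewrite -(absvN _ normr_absv) /=.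
have := rmorph_lin q (-1); rewrite scaleN1r mulN1r => ->.
by rewrite normrN /= rmorphN1 mulN1r normrN.
Qed.

End ImaginaryEmbedding.
End ComplexFieldExt.

(** * Cyclotomic fields and their embeddings *)

Section Cyclotomic.

Definition hornerQ (K : fieldExtType rat) (p : {poly rat}) (x : K) : K :=
  (map_poly (GRing.in_alg K) p).[x].

(** By the factorization of ['X^n - 1], [y] is a root of some ['Phi_d] with [d %| n]; then
    [y ^+ d = 1] forces [n %| d]. *)
Lemma root_Cyclotomic_prim (L : fieldType) (n : nat) (y : L) :
  n.-primitive_root y -> root (map_poly intr 'Phi_n) y.
Proof.
move=> py; have n0 := prim_order_gt0 py.
have : root (map_poly intr ('X^n - 1) : {poly L}) y.
  by rewrite rmorphB rmorph1 /= map_polyXn rootE !hornerE (prim_expr_order py) subrr.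
rewrite -prod_Cyclotomic // rmorph_prod /= => r0.
have [d /= dn rd] : exists2 d, (d \in divisors n) & root (map_poly intr 'Phi_d : {poly L}) y.
  move: r0; rewrite /root horner_prod prodf_seq_eq0 => /hasP[d dn /= h].
  by exists d.
rewrite -dvdn_divisors // in dn.
have d0 := dvdn_gt0 n0 dn.
suff nd : (n %| d)%N.
  by have <- : d = n by apply/eqP; rewrite eqn_dvd dn nd.
rewrite (prim_order_dvd py) -subr_eq0.
have : root (map_poly intr ('X^d - 1) : {poly L}) y.
  rewrite -prod_Cyclotomic // (big_rem d) -?dvdn_divisors //= rmorphM rootM.
  by rewrite rd.
by rewrite rmorphB rmorph1 /= map_polyXn rootE !hornerE.
Qed.

Section PowerBasis.
Variables (K : fieldExtType rat) (u : K) (q : {poly rat}).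
Hypothesis q_neq0 : q != 0.
Hypothesis qP : forall p, (hornerQ p u == 0) = (q %| p).
Hypothesis gen : forall x, exists p, x = hornerQ p u.

Lemma hornerQ_sum (m : nat) (p : {poly rat}) : (size p <= m)%N ->
  hornerQ p u = \sum_(i < m) (p`_i)%:A * u ^+ i.
Proof.
move=> sp; rewrite /hornerQ (@horner_coef_wide _ m) ?size_map_poly //.
by apply: eq_bigr => i _; rewrite coef_map.
Qed.

Lemma power_basis_span (x : K) :
  exists c : 'I_(size q).-1 -> rat, x = \sum_i (c i)%:A * u ^+ i.
Proof.
have [p ->] := gen x; exists (fun i => (p %% q)`_i).
have h : (size (p %% q)%R <= (size q).-1)%N.
  by rewrite -ltnS prednK ?ltn_modp // lt0n size_poly_eq0.
rewrite -hornerQ_sum //; apply/eqP; rewrite -subr_eq0.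
have -> : hornerQ p u - hornerQ (p %% q) u = hornerQ (p - p %% q) u.
  by rewrite /hornerQ rmorphB /= !hornerE.
rewrite qP {1}(divp_eq p q) addrK; exact: dvdp_mull.
Qed.

Lemma dim_power_basis : \dim {:K} = (size q).-1.
Proof.
set m := (size q).-1.
pose X := [tuple u ^+ i | i < m].
have XE (i : 'I_m) : X`_i = u ^+ i by rewrite -tnth_nth tnth_mktuple.
suff : basis_of fullv X by move/size_basis.
rewrite basisEfree; apply/and3P; split.
- apply/freeP => k hk i.
  pose p := \poly_(j < m) (if insub j is Some j' then k j' else 0).
  have pE (j : 'I_m) : p`_j = k j by rewrite coef_poly ltn_ord valK.
  have : hornerQ p u == 0.
    rewrite (@hornerQ_sum m) ?size_poly // -[X in _ == X]hk; apply/eqP.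
    by apply: eq_bigr => j _; rewrite pE XE -scalerAl mul1r.
  rewrite qP => /dvdp_leq h.
  have [p0|/h] := eqVneq p 0; first by rewrite -pE p0 coef0.
  move=> /leq_trans/(_ (size_poly _ _)).
  by rewrite leqNgt /m prednK ?leqnn // lt0n size_poly_eq0.
- exact: subvf.
- rewrite size_tuple; have : (fullv <= <<X>>)%VS.
    apply/subvP => x _; have [c ->] := power_basis_span x.
    apply: rpred_sum => i _; rewrite -scalerAl mul1r; apply/rpredZ/memv_span.
    by rewrite -XE; apply: mem_nth; rewrite size_tuple.
  by move=> /dimvS /leq_trans h; have := h _ (dim_span X); rewrite size_tuple.
Qed.

End PowerBasis.

Section CyclotomicField.
Variables (K : fieldExtType rat) (iota : {rmorphism K -> algC}).
Variables (N : nat) (z : K).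
Hypothesis zP : N.-primitive_root z.
Hypothesis gen : forall x, exists p, x = hornerQ p z.

Lemma hornerQ_rmorph (L : fieldType) (s : {rmorphism K -> L}) (phi : {rmorphism rat -> L}) p x :
  s (hornerQ p x) = (map_poly phi p).[s x].
Proof.
rewrite /hornerQ -horner_map -map_poly_comp; congr (_.[_]).
apply: eq_map_poly => a /=.
rewrite [RHS]fmorph_eq_rat; exact: (fmorph_eq_rat (s \o GRing.in_alg K)).
Qed.

Definition PhiQ : {poly rat} := map_poly intr 'Phi_N.

Lemma hornerQ_eq0 p : (hornerQ p z == 0) = (PhiQ %| p).
Proof.
have zC : N.-primitive_root (iota z) by rewrite fmorph_primitive_root.
rewrite -(fmorph_eq0 iota) (hornerQ_rmorph iota ratr).
have [q [qE _] qP] := minCpolyP (iota z).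
have -> : PhiQ = q.
  apply: (map_inj_poly (fmorph_inj (ratr : {rmorphism rat -> algC}))); rewrite ?rmorph0 //.
  rewrite -qE (minCpoly_cyclotomic zC) -(Cintr_Cyclotomic zC) -map_poly_comp.
  by apply: eq_map_poly => b; rewrite /= rmorph_int.
by rewrite -qP.
Qed.

Lemma size_PhiQ : size PhiQ = (totient N).+1.
Proof. by rewrite size_map_inj_poly ?size_Cyclotomic //; exact: intr_inj. Qed.

Lemma PhiQ_neq0 : PhiQ != 0.
Proof. by rewrite -size_poly_eq0 size_PhiQ. Qed.

Lemma dim_cyclotomic : \dim {:K} = totient N.
Proof.
by rewrite (dim_power_basis PhiQ_neq0 hornerQ_eq0 gen) size_PhiQ.
Qed.

Lemma root_PhiQ (L : fieldType) (phi : {rmorphism rat -> L}) (y : L) :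
  N.-primitive_root y -> root (map_poly phi PhiQ) y.
Proof.
move=> py; have := root_Cyclotomic_prim py; congr (root _ _).
by rewrite -map_poly_comp; apply: eq_map_poly => b; rewrite /= rmorph_int.
Qed.

(** Elements are polynomials in [z], to be evaluated at [y] instead. A chosen polynomial [P x]
    serves for each [x]; two choices differ by a multiple of the cyclotomic polynomial, which
    vanishes at [y]. *)
Lemma cyclotomic_embedding (L : fieldType) (phi : {rmorphism rat -> L}) (y : L) :
  N.-primitive_root y -> exists s : {rmorphism K -> L}, s z = y.
Proof.
move=> py.
pose P x := projT1 (cid (gen x)).
have PE x : hornerQ (P x) z = x by rewrite /P; case: cid.
pose ev p : L := (map_poly phi p).[y].
pose s x : L := ev (P x).
have evE p q : hornerQ p z = hornerQ q z -> ev p = ev q.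
  move=> e; apply/eqP; rewrite -subr_eq0.
  have -> : ev p - ev q = ev (p - q) by rewrite /ev rmorphB /= !hornerE.
  have : PhiQ %| (p - q).
    by rewrite -hornerQ_eq0 /hornerQ rmorphB /= !hornerE -/(hornerQ p z) e subrr.
  case/dvdpP => r ->; rewrite /ev rmorphM hornerM.
  by have /rootP -> := root_PhiQ phi py; rewrite mulr0.
have sB : additive s.
  move=> a b; rewrite /s.
  have -> : ev (P a) - ev (P b) = ev (P a - P b) by rewrite /ev rmorphB /= !hornerE.
  by apply: evE; rewrite PE /hornerQ rmorphB /= !hornerE -!/(hornerQ _ z) !PE.
have sM : multiplicative s.
  split=> [a b|]; rewrite /s.
    have -> : ev (P a) * ev (P b) = ev (P a * P b) by rewrite /ev rmorphM /= !hornerE.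
    by apply: evE; rewrite PE /hornerQ rmorphM /= !hornerE -!/(hornerQ _ z) !PE.
  have -> : 1 = ev 1 by rewrite /ev rmorph1 hornerE.
  by apply: evE; rewrite PE /hornerQ rmorph1 hornerE.
pose sA := GRing.isAdditive.Build K L s sB.
pose sR := GRing.isMultiplicative.Build K L s sM.
pose sRM : {rmorphism K -> L} := HB.pack s sA sR.
exists sRM; rewrite /= /s.
have -> : y = ev 'X by rewrite /ev map_polyX hornerX.
by apply: evE; rewrite PE /hornerQ map_polyX hornerX.
Qed.

End CyclotomicField.
End Cyclotomic.

Local Notation normc := (@ComplexField.Normc.normc _).

(** * Roots of unity on the complex unit circle *)

Section Cis.
Variable R : realType.

Definition cis (x : R) : Rcomplex R := Complex (cos x) (sin x).

Lemma cis0 : cis 0 = 1.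
Proof. by rewrite /cis cos0 sin0. Qed.

Lemma cisD x y : cis (x + y) = cis x * cis y.
Proof. by rewrite /cis cosD sinD; congr Complex; rewrite addrC. Qed.

Lemma cisMn x n : cis (x *+ n) = cis x ^+ n.
Proof. by elim: n => [|n IH]; rewrite ?mulr0n ?cis0 // mulrS cisD IH exprS. Qed.

Lemma normc_cis x : normc (cis x) = 1.
Proof. by rewrite /= cos2Dsin2 sqrtr1. Qed.

Definition angle (N k : nat) : R := 2 * pi * k%:R / N%:R.

Definition unit_root (N : nat) : Rcomplex R := cis (angle N 1).

Lemma unit_rootX N k : unit_root N ^+ k = cis (angle N k).
Proof. by rewrite -cisMn /angle -mulr_natr; congr cis; ring. Qed.

Lemma cos_lt1 (x : R) : 0 < x < 2 * pi -> cos x < 1.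
Proof.
move=> /andP[x0 x2].
have -> : x = (x / 2) *+ 2 by rewrite -mulr_natr divfK.
rewrite cos_mulr2n; have s0 : 0 < sin (x / 2) by apply: sin_gt0_pi; lra.
have := sin2cos2 (x / 2); have : 0 < sin (x / 2) ^+ 2 by rewrite exprn_gt0.
rewrite -mulr_natl; lra.
Qed.

Lemma angle_bounds N k : (0 < k < N)%N -> 0 < angle N k < 2 * pi.
Proof.
move=> /andP[k0 kN]; have N0 : (0 < N)%N by apply: ltn_trans kN.
have pi0 := pi_gt0 R.
rewrite /angle divr_gt0 ?mulr_gt0 ?ltr0n //= ltr_pdivrMr ?ltr0n //.
by rewrite ltr_pM2l ?mulr_gt0 // ltr_nat.
Qed.

Lemma unit_root_prim N : (0 < N)%N -> N.-primitive_root (unit_root N).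
Proof.
move=> N0; apply/andP; split => //; apply/forallP => i; apply/eqP.
rewrite unity_rootE unit_rootX.
have [eN|ltN] := eqVneq i.+1 N.
  rewrite eN; have -> : angle N N = pi *+ 2.
    by rewrite /angle mulfK ?pnatr_eq0 -?lt0n // mulr_natl.
  by rewrite /cis cos2pi sin2pi eqxx.
apply/negP => /eqP [] h _.
have := @cos_lt1 (angle N i.+1); rewrite angle_bounds ?h ?ltxx => [/(_ isT)//|].
by rewrite /= ltn_neqAle ltN ltn_ord.
Qed.

Lemma sum_cos_angle N j : (0 < N)%N -> ~~ (N %| j)%N ->
  \sum_(k < N) cos (angle N (j * k)) = 0.
Proof.
move=> N0 Nj; have py := unit_root_prim N0.
set y := unit_root N ^+ j.
have y1 : y != 1 by rewrite -(prim_order_dvd py).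
have yN : y ^+ N = 1 by rewrite /y -exprM mulnC exprM (prim_expr_order py) expr1n.
have S0 : \sum_(k < N) y ^+ k = 0.
  by apply/(mulfI (_ : y - 1 != 0)); rewrite ?subr_eq0 // mulr0 -subrX1 yN subrr.
transitivity (complex.Re (\sum_(k < N) y ^+ k)); last by rewrite S0.
rewrite (raddf_sum (@complex.Re R : Rcomplex R -> R)) /=.
by apply: eq_bigr => k _; rewrite -exprM unit_rootX.
Qed.

Lemma unit_root_neq0 N : unit_root N != 0.
Proof.
apply/eqP => h; have := normc_cis (angle N 1); rewrite -/(unit_root N) h.
by rewrite ComplexField.Normc.normc0 => /eqP; rewrite eq_sym oner_eq0.
Qed.

End Cis.

(* A polynomial in [x] reduces to [A(t) + B(t) x] with [t = x + 1/x]. *)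
Lemma poly_real_subfield (p : {poly rat}) : exists A B : {poly rat},
  forall (F : fieldType) (phi : {rmorphism rat -> F}) (x : F), x != 0 ->
    (map_poly phi p).[x] =
    (map_poly phi A).[x + x^-1] + (map_poly phi B).[x + x^-1] * x.
Proof.
elim/poly_ind: p => [|p c [A [B h]]].
  by exists 0, 0 => F phi x x0; rewrite rmorph0 !hornerE.
exists (- B + c%:P), (A + 'X * B) => F phi x x0.
rewrite !(rmorphD, rmorphM, rmorphN) /= !map_polyX !map_polyC !hornerE h //.
set a := (_).[_]; set b := (map_poly phi B).[_].
have -> : - b + phi c + (a + (x + x^-1) * b) * x =
  - b + phi c + a * x + b * x * x + b * (x^-1 * x) by ring.
by rewrite mulVf //; ring.
Qed.

(** The constant is uniform for [q] within 1 of [c]. Used for [w] at [t] and for the usual absolute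
    value at [c], it compares the values of a polynomial at two points that live in different fields
    but are approximated by the same rationals. *)
Lemma horner_lipschitz (R : realType) (F : fieldType) (w : F -> R)
    (phi : {rmorphism rat -> F}) (t : F) (c : R) (A : {poly rat}) :
  absolute_value w -> (forall q, w (phi q) = `|ratr q|) ->
  exists2 C : R, 0 <= C & forall q : rat, `|ratr q - c| < 1 ->
    w ((map_poly phi A).[t] - phi A.[q]) <= C * w (t - phi q).
Proof.
move=> hw hq; elim/poly_ind: A => [|A b [C C0 h]].
  by exists 0 => // q _; rewrite !(rmorph0, horner0, subr0) absv0 // mul0r.
exists (w (map_poly phi A).[t] + C * (`|c| + 1)) => [|q qc].
  by rewrite addr_ge0 ?mulr_ge0 ?(absv_ge0 hw) ?addr_ge0.
rewrite !(rmorphD, rmorphM) /= map_polyX map_polyC !hornerE rmorphD rmorphM /=.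
have -> : (map_poly phi A).[t] * t + phi b - (phi A.[q] * phi q + phi b) =
   (map_poly phi A).[t] * (t - phi q) + ((map_poly phi A).[t] - phi A.[q]) * phi q.
  by ring.
apply: le_trans (absvD hw _ _) _; rewrite !(absvM hw) mulrDl lerD2l hq.
have wt := absv_ge0 hw (t - phi q).
rewrite -mulrA [(_ + 1) * _]mulrC mulrA.
apply: ler_pM => //; rewrite ?(absv_ge0 hw) ?h //.
have -> : ratr q = c + (ratr q - c) by ring.
by apply: le_trans (ler_normD _ _) _; rewrite lerD2l ltW.
Qed.

Lemma cosD2pin (R : realType) (x : R) k : cos (x + 2 * pi * k%:R) = cos x.
Proof.
elim: k => [|k IH]; first by rewrite mulr0 addr0.
by rewrite -IH -[in RHS]cosD2pi -natr1; congr cos; rewrite -mulr_natl; ring.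
Qed.

Lemma sum_const_ord (V : pzRingType) n (c : V) : \sum_(i < n) c = n%:R * c.
Proof. by rewrite big_const_ord iter_addr_0 mulr_natl. Qed.

Lemma sum_shift_periodic (V : zmodType) (G : nat -> V) (N : nat) : G N = G 0 ->
  \sum_(j < N) G j.+1 = \sum_(j < N) G j.
Proof.
move=> GN; apply: (addrI (G 0)); transitivity (\sum_(j < N.+1) G j).
  by rewrite big_ord_recl.
by rewrite big_ord_recr /= GN addrC.
Qed.

Lemma cos_angle_mod (R : realType) N m : (0 < N)%N ->
  cos (angle R N (m %% N)) = cos (angle R N m).
Proof.
move=> N0; rewrite {2}(divn_eq m N) -(cosD2pin (angle R N (m %% N)) (m %/ N)).
congr cos; rewrite /angle natrD natrM.
have : N%:R != 0 :> R by rewrite pnatr_eq0 -lt0n.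
by move=> h; field.
Qed.

Lemma coprime_subr u N : (u <= N)%N -> coprime (N - u) N = coprime u N.
Proof.
have h a b : coprime a (b + a) = coprime a b by rewrite /coprime gcdnDr.
move=> uN; transitivity (coprime (N - u) u); first by rewrite -{2}(subnKC uN) h.
by rewrite coprime_sym -[in RHS](subnK uN) h.
Qed.

Lemma coprime_double_neq u N : (2 < N)%N -> coprime u N -> u.*2 != N.
Proof.
move=> N2 cu; apply/eqP => uN; move: cu N2.
by rewrite -uN /coprime -addnn gcdnDr gcdnn => /eqP ->.
Qed.

(** * Archimedean places of a cyclotomic field *)

Section ArchimedeanPlaces.
Variables (R : realType) (K : fieldExtType rat) (iota : {rmorphism K -> algC}).
Variables (N : nat) (z : K).
Hypothesis zP : N.-primitive_root z.
Hypothesis gen : forall x, exists p, x = hornerQ p z.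
Hypothesis N_gt2 : (2 < N)%N.

Let N_gt0 : (0 < N)%N. Proof. exact: ltn_trans N_gt2. Qed.
Let z_neq0 : z != 0. Proof. by rewrite (prim_root_eq0 zP) -lt0n. Qed.
Let theta := z + z^-1.
Section Place.
Variable w : K -> R.
Hypothesis hw : places_above R K None w.
Let aw : absolute_value w. Proof. by case: hw. Qed.

Lemma arch_place_rat q : w q%:A = `|ratr q|.
Proof. by case: hw => _ ->; rewrite /= ratr_norm. Qed.

Lemma arch_place_zX j : w (z ^+ j) = 1.
Proof. by rewrite (absvX _ _ aw) (absv_unity_root aw N_gt0 (prim_expr_order zP)) expr1n. Qed.

Lemma arch_place_comb (a : 'I_N -> rat) :
  w (\sum_(j < N) (a j)%:A * z ^+ j) <= \sum_(j < N) `|ratr (a j)|.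
Proof.
apply: le_trans (absv_sum _ _ _ aw) _; apply: ler_sum => j _.
by rewrite (absvM aw) arch_place_zX mulr1 arch_place_rat.
Qed.

(* The sums [eps k] approximate the elements
   [\sum_j cos (2 pi j k / N) z ^+ j] of [K (x) R], which are killed by
   [theta - 2 cos (2 pi k / N)] and add up to [N]. *)
Lemma arch_place_near (d : R) : 0 < d -> exists (k : 'I_N) (q : rat),
  `|ratr q - 2 * cos (angle R N k)| < d /\ w (theta - q%:A) < d.
Proof.
move=> d0.
have N0 : 0 < N%:R :> R by rewrite ltr0n.
have N1 : 1 <= N%:R :> R by rewrite ler1n.
(* The first bound keeps the total error [N * (N * e)] at most [N / 2], so that some [eps k] has
   size at least [1 / 2]; the second makes the final estimate [12 * N * e] smaller than [d]. *)
pose e := Num.min (2 * N%:R)^-1 (d / (13 * N%:R)).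
have e0 : 0 < e by rewrite lt_min invr_gt0 divr_gt0 ?mulr_gt0.
have e1 : e * (2 * N%:R) <= 1 by rewrite -ler_pdivlMr ?mulr_gt0 // mul1r ge_min lexx.
have e2 : e * (13 * N%:R) <= d by rewrite -ler_pdivlMr ?mulr_gt0 // ge_min lexx orbT.
have e3 : e <= 1 by nra.
have ed : e < d by nra.
have [rho0 h0] : {r : nat -> rat | forall m, `|ratr (r m) - cos (angle R N m)| < e}.
  have h m : {q : rat | `|ratr q - cos (angle R N m)| < e} by apply/cid/ratr_dense.
  by exists (fun m => sval (h m)) => m; apply: (svalP (h m)).
(* Exact periodicity makes multiplication by [z] or [z^-1] an exact shift of the indices. *)
pose rho m := rho0 (m %% N)%N.
have hr m : `|ratr (rho m) - cos (angle R N m)| < e.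
  by rewrite -(cos_angle_mod R m N_gt0); apply: h0.
have [q hq] : {q : nat -> rat | forall k, `|ratr (q k) - 2 * cos (angle R N k)| < e}.
  have h m : {q : rat | `|ratr q - 2 * cos (angle R N m)| < e} by apply/cid/ratr_dense.
  by exists (fun m => sval (h m)) => m; apply: (svalP (h m)).
pose eps k := \sum_(j < N) (rho (j * k)%N)%:A * z ^+ j.
have sum_eps : w (\sum_(k < N) eps k - N%:R) <= N%:R * (N%:R * e).
  have -> : \sum_(k < N) eps k - N%:R = \sum_(j < N)
     (\sum_(k < N) rho (j * k)%N - (if j == 0%N :> nat then N%:R else 0))%:A * z ^+ j.
    rewrite /eps exchange_big /=.
    have {1}-> : N%:R = \sum_(j < N) (if j == 0%N :> nat then N%:R else 0 : rat)%:A * z ^+ j.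
      rewrite (bigD1 (Ordinal N_gt0)) //= expr0 mulr1 big1 ?addr0.
        by rewrite scaler_nat.
      by move=> j j0; rewrite ifN ?scale0r ?mul0r.
    rewrite -sumrB; apply: eq_bigr => j _.
    rewrite scalerBl mulrBl; congr (_ - _).
    by rewrite scaler_suml mulr_suml.
  apply: le_trans (arch_place_comb _) _.
  apply: (@le_trans _ _ (\sum_(j < N) N%:R * e)); last first.
    by rewrite sum_const_ord.
  apply: ler_sum => j _.
  have -> : ratr (\sum_(k < N) rho (j * k)%N - (if j == 0%N :> nat then N%:R else 0)) =
     \sum_(k < N) (ratr (rho (j * k)%N) - cos (angle R N (j * k))).
    rewrite rmorphB rmorph_sum /= sumrB; congr (_ - _).
    case: eqP => [->|j0].
      rewrite rmorph_nat (eq_bigr (fun => 1)) ?sumr_const ?card_ord //.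
      by move=> k _; rewrite mul0n /angle mulr0 mul0r cos0.
    rewrite rmorph0 sum_cos_angle // gtnNdvd ?ltn_ord // lt0n; exact/eqP.
  apply: le_trans (ler_norm_sum _ _ _) _.
  apply: (@le_trans _ _ (\sum_(k < N) e)); last by rewrite sum_const_ord.
  by apply: ler_sum => k _; apply/ltW/hr.
have [k hk] : exists k : 'I_N, 1 / 2 <= w (eps k).
  apply: contrapT => /forallNP hn.
  have : w N%:R <= \sum_(k < N) w (eps k) + N%:R * (N%:R * e).
    have -> : N%:R = \sum_(k < N) eps k - (\sum_(k < N) eps k - N%:R) by ring.
    apply: le_trans (absvB _ _ aw) _; apply: lerD sum_eps.
    exact: absv_sum.
  have -> : w N%:R = N%:R.
    have -> : N%:R = (N%:R : rat)%:A :> K by rewrite scaler_nat.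
    by rewrite arch_place_rat rmorph_nat ger0_norm.
  apply/negP; rewrite -ltNge.
  have : \sum_(k < N) w (eps k) < \sum_(k < N) 1 / 2.
    apply: ltr_sum => [|k _]; last by rewrite ltNge; apply/negP/hn.
    by apply/hasP; exists (Ordinal N_gt0); rewrite ?mem_index_enum.
  rewrite sum_const_ord.
  have : N%:R * (N%:R * e) <= N%:R * (1 / 2).
    by rewrite ler_pM2l // ler_pdivlMr //; lra.
  lra.
exists k, (q k); split; first by apply: lt_trans (hq k) ed.
(* Modulo [N], [j + N.-1] is [j - 1]. With [t = angle R N k], the coefficients approximate [cos ((j
   + 1) t) + cos ((j - 1) t) - 2 cos t cos (j t) = 0]. *)
have prodE : (theta - (q k)%:A) * eps k = \sum_(j < N)
    (rho (j.+1 * k)%N + rho ((j + N.-1) * k)%N - q k * rho (j * k)%N)%:A * z ^+ j.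
  rewrite mulrBl mulrDl.
  have -> : z * eps k = \sum_(j < N) (rho ((j + N.-1) * k)%N)%:A * z ^+ j.
    rewrite -(@sum_shift_periodic _ (fun j => (rho ((j + N.-1) * k)%N)%:A * z ^+ j)).
      rewrite /eps mulr_sumr; apply: eq_bigr => j _; rewrite exprS.
      have -> : rho ((j.+1 + N.-1) * k)%N = rho (j * k)%N.
        by rewrite /rho addSnnS prednK // mulnDl addnC mulnC modnMDl.
      by rewrite mulrCA.
    rewrite (prim_expr_order zP) expr0 /rho; congr ((rho0 _)%:A * _).
    by rewrite mulnDl add0n addnC [(N * k)%N]mulnC addnC modnMDl.
  have -> : z^-1 * eps k = \sum_(j < N) (rho (j.+1 * k)%N)%:A * z ^+ j.
    rewrite /eps mulr_sumr.
    rewrite -(@sum_shift_periodic _ (fun j => z^-1 * ((rho (j * k)%N)%:A * z ^+ j))).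
      apply: eq_bigr => j _; by rewrite mulrCA exprS mulKf.
    by rewrite (prim_expr_order zP) expr0 /rho mul0n mod0n mulnC modnMl.
  rewrite [(q k)%:A * _]mulr_sumr -big_split -sumrB; apply: eq_bigr => j _ /=.
  rewrite scalerBl scalerDl mulrBl mulrDl [_ + (rho _)%:A * _]addrC; congr (_ - _).
  by rewrite mulrA -scalerAl mul1r scalerA.
have small : w ((theta - (q k)%:A) * eps k) <= N%:R * (6 * e).
  rewrite prodE; apply: le_trans (arch_place_comb _) _.
  apply: (@le_trans _ _ (\sum_(j < N) 6 * e)); last by rewrite sum_const_ord.
  apply: ler_sum => j _; rewrite rmorphB rmorphD rmorphM /=.
  have h1 := hr (j.+1 * k)%N; have h2 := hr ((j + N.-1) * k)%N.
  have h3 := hr (j * k)%N; have h4 := hq k.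
  have cs : cos (angle R N (j.+1 * k)) + cos (angle R N ((j + N.-1) * k)) =
     2 * cos (angle R N k) * cos (angle R N (j * k)).
    have Nn : N%:R != 0 :> R by rewrite gt_eqF.
    have -> : angle R N (j.+1 * k) = angle R N (j * k) + angle R N k.
      by rewrite /angle mulSn natrD; ring.
    have -> : cos (angle R N ((j + N.-1) * k)) = cos (angle R N (j * k) - angle R N k).
      rewrite -(cosD2pin (_ - _) k); congr cos.
      rewrite /angle !natrM natrD -subn1 natrB //; field.
      exact: Nn.
    by rewrite cosB cosD; ring.
  have c1 := cos_max (angle R N (j * k)); have c2 := cos_max (angle R N k).
  set A := ratr (q k) in h4 *; set B := ratr (rho (j * k)%N) in h3 *.
  set a := 2 * cos (angle R N k) in h4 cs; set b := cos (angle R N (j * k)) in h3 cs c1.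
  have AB : `|A * B - a * b| <= 4 * e.
    have -> : A * B - a * b = (A - a) * (B - b) + (A - a) * b + a * (B - b) by ring.
    apply: le_trans (ler_normD _ _) _; rewrite !normrM.
    apply: (@le_trans _ _ (e * 1 + e * 1 + 2 * e)); last by lra.
    apply: lerD.
      apply: le_trans (ler_normD _ _) _; rewrite !normrM.
      apply: lerD; apply: ler_pM => //; rewrite ?(ltW h4) ?(ltW h3) //.
      by apply: le_trans (ltW h3) e3.
    apply: ler_pM => //; last exact: ltW.
    by rewrite ger0_norm // ler_piMr.
  move: h1 h2 AB; rewrite !ltr_norml !ler_norml; move: cs.
  set X := cos _; set Y := cos _; lra.
move: small; rewrite (absvM aw) => small.
have wt := absv_ge0 aw (theta - (q k)%:A).
have : w (theta - (q k)%:A) * (1 / 2) <= N%:R * (6 * e).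
  by apply: le_trans small; rewrite ler_wpM2l.
have : 0 < N%:R * e by rewrite mulr_gt0.
lra.
Qed.

(** There are finitely many [k]: if each failed for some precision, all would fail for the smallest
    of these, against [arch_place_near]. *)
Lemma arch_place_root : exists k : 'I_N, forall d : R, 0 < d -> exists q : rat,
  `|ratr q - 2 * cos (angle R N k)| < d /\ w (theta - q%:A) < d.
Proof.
apply: contrapT => /forallNP hn.
have h (k : 'I_N) : {d : R | 0 < d & ~ exists q : rat,
    `|ratr q - 2 * cos (angle R N k)| < d /\ w (theta - q%:A) < d}.
  have /existsNP/cid[d /not_implyP[d0 hd]] := hn k.
  by exists d.
pose d := \big[Num.min/1]_(k < N) s2val (h k).
have d0 : 0 < d.
  rewrite /d; elim/big_ind : _ => // [x y x0 y0|k _]; first by rewrite lt_min x0.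
  exact: (s2valP (h k)).
have [k [q [h1 h2]]] := arch_place_near d0.
apply: (s2valP' (h k)); exists q; split.
  by apply: lt_le_trans h1 _; apply: bigmin_le_cond.
by apply: lt_le_trans h2 _; apply: bigmin_le_cond.
Qed.

(** Approximating [theta] by rationals gives [w (A theta) <= |A c|] for every polynomial [A].
    Writing [p z] as [A theta + B theta * z] bounds [w (p z)] by a constant times [|p y|], where
    [y = e^(2 i pi k / N)], and such a bound between absolute values is an equality. *)
Lemma arch_placeP : exists2 s : {rmorphism K -> Rcomplex R},
  N.-primitive_root (s z) & w = (fun x => normc (s x)).
Proof.
have [k hk] := arch_place_root.
set c := 2 * cos (angle R N k) in hk.
have wq (q : rat) : w (GRing.in_alg K q) = `|ratr q| by exact: arch_place_rat.
have le_theta A : w (hornerQ A theta) <= `|(map_poly ratr A).[c]|.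
  have [C1 C10 h1] := horner_lipschitz theta c A aw wq.
  have [C2 C20 h2] := @horner_lipschitz R R Num.norm ratr c c A (normr_absv R) (fun=> erefl).
  apply/ler_addgt0Pl => e e0.
  pose d := Num.min (1/2) (e / (C1 + C2 + 1)).
  have D0 : 0 < C1 + C2 + 1 by lra.
  have d0 : 0 < d by rewrite lt_min; apply/andP; split; [lra|exact: divr_gt0].
  have [q [q1 q2]] := hk d d0.
  have dl : d <= 1 / 2 by rewrite ge_min lexx.
  have de : d * (C1 + C2 + 1) <= e by rewrite -ler_pdivlMr // ge_min lexx orbT.
  have {}h1 := h1 q ltac:(lra); have {}h2 := h2 q ltac:(lra).
  rewrite -/(hornerQ A theta) in h1.
  have -> : hornerQ A theta = (hornerQ A theta - GRing.in_alg K A.[q]) + GRing.in_alg K A.[q] by ring.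
  apply: le_trans (absvD aw _ _) _; rewrite wq.
  have h3 : `|ratr A.[q] : R| <= `|(map_poly ratr A).[c]| + `|(map_poly ratr A).[c] - ratr A.[q]|.
    have {1}-> : ratr A.[q] = (map_poly ratr A).[c] - ((map_poly ratr A).[c] - ratr A.[q]) :> R by ring.
    exact: ler_normB.
  have h4 : C1 * w (theta - GRing.in_alg K q) <= C1 * d by rewrite ler_wpM2l // ltW.
  have h5 : C2 * `|c - ratr q| <= C2 * d by rewrite ler_wpM2l // distrC ltW.
  have h6 := le_trans h1 h4; have h7 := le_trans h2 h5.
  set t1 := w _ in h6 *; set t2 := `|_ - _| in h7 h3.
  set t3 := `|_| in h3 *; set t4 := `|_| in h3 *.
  lra.
pose y := unit_root R N ^+ k.
have y0 : y != 0 by rewrite expf_neq0 // unit_root_neq0.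
have yE : y = Complex (cos (angle R N k)) (sin (angle R N k)) by rewrite /y unit_rootX.
have yV : y^-1 = Complex (cos (angle R N k)) (- sin (angle R N k)).
  apply: (mulfI y0); rewrite mulfV // yE; congr Complex.
    by rewrite mulrN opprK -!expr2 cos2Dsin2.
  by rewrite mulrN mulrC addNr.
have yt : y + y^-1 = Complex c 0 by rewrite yV yE; congr Complex; rewrite /c; ring.
pose phi : {rmorphism rat -> Rcomplex R} := GRing.in_alg (Rcomplex R) \o ratr.
have phiE A : (map_poly phi A).[Complex c 0] = Complex (map_poly ratr A).[c] 0.
  have cE (x : R) : Complex x 0 = GRing.in_alg (Rcomplex R) x.
    by congr Complex; rewrite ?mulr1 ?mulr0.
  by rewrite !cE -horner_map -map_poly_comp.
(* Otherwise [c = 2 * a] with [a = 1] or [a = -1], so [theta = 2 * a] and [(z - a) ^+ 2 = 0], which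
   contradicts [2 < N]. *)
have im0 : sin (angle R N k) != 0.
  apply/eqP => s0.
  have c2 : cos (angle R N k) ^+ 2 = 1 by rewrite -(cos2Dsin2 (angle R N k)) s0 expr0n addr0.
  have {}c2 : exists2 a : rat, a ^+ 2 = 1 & cos (angle R N k) = ratr a.
    move/eqP: c2; rewrite sqrf_eq1 => /orP[]/eqP ->.
      by exists 1; rewrite ?expr1n ?rmorph1.
    by exists (-1); rewrite ?sqrrN ?expr1n ?rmorphN1.
  case: c2 => a a2 ca.
  have [b bE] : exists b : rat, b = 2 * a by exists (2 * a).
  have : w (hornerQ ('X - b%:P) theta) <= 0.
    apply: le_trans (le_theta _) _.
    rewrite rmorphB /= map_polyX map_polyC hornerD hornerN hornerX hornerC /c ca /=.
    have -> : ratr b = 2 * ratr a :> R by rewrite bE rmorphM rmorph_nat.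
    by rewrite subrr normr0.
  rewrite /hornerQ rmorphB /= map_polyX map_polyC !hornerE => h.
  have /eqP : theta - GRing.in_alg K b = 0.
    by apply/(absv_eq0 aw)/eqP; rewrite eq_le h (absv_ge0 aw).
  rewrite subr_eq0 => /eqP th.
  have : (z - GRing.in_alg K a) ^+ 2 = 0.
    have -> : (z - GRing.in_alg K a) ^+ 2 = z * (theta - GRing.in_alg K b) + (GRing.in_alg K a ^+ 2 - z * z^-1).
      by rewrite /theta bE rmorphM rmorph_nat; ring.
    by rewrite th subrr mulr0 add0r mulfV // -rmorphXn a2 rmorph1 subrr.
  move/eqP; rewrite expf_eq0 /= subr_eq0 => /eqP za.
  have : z ^+ 2 == 1 by rewrite za -[a%:A]/(GRing.in_alg K a) -rmorphXn a2 rmorph1.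
  rewrite -(prim_order_dvd zP) => /dvdn_leq; lia.
have s0 : 0 < `|sin (angle R N k)| by rewrite normr_gt0.
(* For [u = |a + b y|] with [a] and [b] real, the imaginary part gives [|b| <= u / |sin|] and the
   real part then gives [|a| <= u + u / |sin|]. *)
pose C := 2 + 2 / `|sin (angle R N k)| .
have le_p p : w (hornerQ p z) <= C * normc (map_poly phi p).[y].
  have [A [B hAB]] := poly_real_subfield p.
  rewrite {1}/hornerQ hAB // -!/(hornerQ _ _) -/theta hAB // yt !phiE.
  apply: le_trans (absvD aw _ _) _; rewrite (absvM aw).
  rewrite (absv_unity_root aw N_gt0 (prim_expr_order zP)) mulr1.
  apply: le_trans (lerD (le_theta A) (le_theta B)) _.
  set a := (map_poly ratr A).[c]; set b := (map_poly ratr B).[c].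
  rewrite yE; set u := normc _.
  have u0 : 0 <= u by rewrite /u /= sqrtr_ge0.
  have hr : `|a + b * cos (angle R N k)| <= u.
    apply: le_trans (normc_ge_absRe _); rewrite /= mul0r subr0 //.
  have hi : `|b| * `|sin (angle R N k)| <= u.
    by apply: le_trans (normc_ge_absIm _); rewrite /= mul0r addr0 add0r normrM.
  have hb : `|b| <= u / `|sin (angle R N k)| by rewrite ler_pdivlMr.
  have ha : `|a| <= u + u / `|sin (angle R N k)|.
    have -> : a = (a + b * cos (angle R N k)) - b * cos (angle R N k) by ring.
    apply: le_trans (ler_normB _ _) _; apply: lerD hr _.
    apply: le_trans hb; rewrite normrM ler_piMr //.
    exact: cos_max.
  rewrite /C; have -> : (2 + 2 / `|sin (angle R N k)|) * u = 2 * u + 2 * (u / `|sin (angle R N k)|) by ring.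
  lra.
have yN : y ^+ N = 1.
  by rewrite /y -exprM mulnC exprM (prim_expr_order (unit_root_prim R N_gt0)) expr1n.
(* If [y] has order [M], then [le_p] at ['X^M - 1] gives [w (z ^+ M - 1) <= 0], so [N %| M]. *)
have yp : N.-primitive_root y.
  have [M yM MN] := prim_order_exists N_gt0 yN.
  suff -> : N = M by [].
  apply/eqP; rewrite eqn_dvd MN andbT (prim_order_dvd zP) -subr_eq0.
  have := le_p ('X^M - 1).
  rewrite /hornerQ !rmorphB !rmorph1 /= !map_polyXn !hornerE (prim_expr_order yM) subrr.
  rewrite ComplexField.Normc.normc0 mulr0 => h; apply/eqP/(absv_eq0 aw)/eqP.
  by rewrite eq_le h (absv_ge0 aw).
have [s sz] := cyclotomic_embedding iota zP gen phi yp.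
exists s; first by rewrite sz.
apply: (@absv_eq_of_le _ _ _ _ C) => //; first exact: normc_rmorph_absv.
move=> x; have [p ->] := gen x; rewrite (hornerQ_rmorph s phi) sz.
exact: le_p.
Qed.

End Place.

Let phi : {rmorphism rat -> Rcomplex R} := GRing.in_alg (Rcomplex R) \o ratr.

(** Conjugate points: the value is [A + B * cis c] with [A] and [B] real and depending only on
    [cos c], and so is its modulus. *)
Lemma normc_horner_cis (p : {poly rat}) (a b : R) : cos a = cos b ->
  normc (map_poly phi p).[cis a] = normc (map_poly phi p).[cis b].
Proof.
have [A [B hAB]] := poly_real_subfield p.
suff h c : normc (map_poly phi p).[cis c] =
    Num.sqrt (((map_poly ratr A).[2 * cos c] + (map_poly ratr B).[2 * cos c] * cos c) ^+ 2
      + (map_poly ratr B).[2 * cos c] ^+ 2 * (1 - cos c ^+ 2)).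
  by move=> e; rewrite !h e.
have y0 : cis c != 0.
  apply/eqP => h; have := normc_cis c; rewrite h.
  by rewrite ComplexField.Normc.normc0 => /eqP; rewrite eq_sym oner_eq0.
have yV : (cis c)^-1 = Complex (cos c) (- sin c).
  apply: (mulfI y0); rewrite mulfV // /cis; congr Complex.
    by rewrite mulrN opprK -!expr2 cos2Dsin2.
  by rewrite mulrN mulrC addNr.
have yt : cis c + (cis c)^-1 = Complex (2 * cos c) 0 by rewrite yV; congr Complex; ring.
have phiE D (x : R) : (map_poly phi D).[Complex x 0] = Complex (map_poly ratr D).[x] 0.
  have cE (t : R) : Complex t 0 = GRing.in_alg (Rcomplex R) t.
    by congr Complex; rewrite ?mulr1 ?mulr0.
  by rewrite !cE -horner_map -map_poly_comp.
rewrite hAB // yt !phiE /=; congr Num.sqrt.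
by rewrite -sin2cos2; ring.
Qed.

Lemma prim_root_normc (s s' : {rmorphism K -> Rcomplex R}) (a b : R) :
  s z = cis a -> s' z = cis b -> cos a = cos b ->
  (fun x => normc (s x)) = (fun x => normc (s' x)).
Proof.
move=> sa sb ab; apply/funext => x; have [p ->] := gen x.
by rewrite !(hornerQ_rmorph _ phi) sa sb; apply: normc_horner_cis.
Qed.

(** The involution [u -> N - u] has no fixed point among the units, as [2 < N]. *)
Lemma sum_coprime_half (G : nat -> R) : (forall u, (u < N)%N -> coprime u N -> G (N - u)%N = G u) ->
  \sum_(u < N | coprime u N) G u = 2 * \sum_(u < N | coprime u N && (u.*2 < N)%N) G u.
Proof.
move=> hG; rewrite (bigID (fun u : 'I_N => (u.*2 < N)%N)) /= mulr_natl mulr2n; congr (_ + _).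
pose h (u : 'I_N) := Ordinal (ltn_pmod (N - u) N_gt0).
have hK : involutive h.
  move=> u; apply/val_inj => /=; have := ltn_ord u; have [->|u0] := posnP (val u).
    by rewrite subn0 modnn subn0 modnn.
  move=> uN; rewrite (@modn_small (N - u) N); last by rewrite ltn_subrL u0.
  by rewrite subKn ?modn_small // ltnW.
rewrite (reindex_inj (inv_inj hK)) /=; apply: eq_big => u; last first.
  move=> /andP[]; have [->|u0] := posnP (val u).
    by rewrite subn0 modnn /coprime gcd0n => /eqP N1; move: N_gt2; rewrite N1.
  rewrite modn_small ?ltn_subrL ?u0 ?N_gt0 // => cu _; rewrite -hG ?subKn //.
  - exact/ltnW.
  - by rewrite ltn_subrL u0.
have cN : coprime (h u) N = coprime u N.
  by rewrite /= coprime_modl coprime_subr // ltnW.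
rewrite -[coprime (_ %% _) N]/(coprime (h u) N) cN; case cu: (coprime u N) => //=.
have u0 : (0 < u)%N.
  rewrite lt0n; apply/eqP => u0; move: cu; rewrite u0 /coprime gcd0n => /eqP N1.
  by move: N_gt2; rewrite N1.
rewrite modn_small ?ltn_subrL ?u0 ?N_gt0 //.
have : u.*2 != N.
  exact: coprime_double_neq.
have := ltn_ord u; lia.
Qed.

Lemma angle_half u : (0 < u)%N -> (u.*2 < N)%N -> 0 < angle R N u < pi.
Proof.
move=> u0 uN; have N0 : 0 < N%:R :> R by rewrite ltr0n.
rewrite /angle divr_gt0 ?mulr_gt0 ?pi_gt0 ?ltr0n //= ltr_pdivrMr // mulrAC.
rewrite [ltRHS]mulrC ltr_pM2r ?pi_gt0 // -natrM ltr_nat; lia.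
Qed.

(** Conjugate embeddings give the same place, so the places are the [v u] with [u.*2 < N]. Each has
    local degree 2, which restores the sum over all units. *)
Lemma arch_sum (G : (K -> R) -> R) (v : nat -> K -> R) :
  (forall u, coprime u N -> exists2 s : {rmorphism K -> Rcomplex R},
     s z = unit_root R N ^+ u & v u = fun x => normc (s x)) ->
  \sum_(w \in places_above R K None)
     (local_degree None w)%:R / (\dim {:K})%:R * G w =
  (\sum_(u < N | coprime u N) G (v u)) / (totient N)%:R.
Proof.
move=> hv.
have co_gt0 u : coprime u N -> (0 < u)%N.
  rewrite lt0n => cu; apply/eqP => u0; move: cu; rewrite u0 /coprime gcd0n => /eqP N1.
  by move: N_gt2; rewrite N1.
have coB u : (u < N)%N -> coprime u N -> coprime (N - u) N.
by move=> uN; rewrite coprime_subr // ltnW.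
have vsym u : (u < N)%N -> coprime u N -> v (N - u)%N = v u.
  move=> uN cu; have [s sz ->] := hv _ (coB _ uN cu); have [s' s'z ->] := hv _ cu.
  rewrite !unit_rootX in sz s'z; apply: prim_root_normc sz s'z _.
  rewrite -[RHS]cosN -[RHS](cosD2pin _ 1); congr cos.
  rewrite /angle natrB ?(ltnW uN) //.
  by field; rewrite pnatr_eq0 -lt0n.
pose H : pred 'I_N := fun u => coprime u N && (u.*2 < N)%N.
have placesE : places_above R K None = [set v (val u) | u in [set` H]].
  apply/seteqP; split=> [w hw|_ [u /andP[cu _] <-]].
    have [s sp wE] := arch_placeP hw.
    have [u su] := prim_rootP (unit_root_prim R N_gt0) (prim_expr_order sp).
    have cu : coprime u N.
      by rewrite -(prim_root_exp_coprime _ (unit_root_prim R N_gt0)) -su.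
    have wv : w = v u.
      have [s' s'z ->] := hv _ cu; rewrite wE.
      by apply: (@prim_root_normc _ _ (angle R N u) (angle R N u)); rewrite // -unit_rootX.
    have [uN|uN] := ltnP u.*2 N; first by exists u => //; apply/andP.
    have N_u : (N - u < N)%N by rewrite ltn_subrL co_gt0.
    exists (Ordinal N_u) => /=; last by rewrite wv vsym.
    have : u.*2 != N.
      exact: coprime_double_neq.
    move=> uN'; apply/andP; split; first exact: coB.
    by move: uN uN' => /=; have := ltn_ord u; lia.
  have [s sz ->] := hv _ cu; split; first exact: normc_rmorph_absv.
  by move=> q; rewrite rmorph_in_alg /= expr0n addr0 sqrtr_sqr ratr_norm.
have sin0 (u : 'I_N) : H u -> sin (angle R N u) != 0.
  move=> /andP[cu uN]; rewrite gt_eqF // sin_gt0_pi // angle_half // co_gt0 //.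
(* The place determines the distances from [2 * cos (angle R N u)] to all rationals, hence this real
   number, and [cos] is injective on the half circle. *)
have vinj : set_inj [set` H] (fun u : 'I_N => v u).
  move=> u u'; rewrite !inE => Hu Hu'; have /andP[cu uN] := Hu; have /andP[cu' uN'] := Hu'.
  have [s sz ->] := hv _ cu; have [s' s'z ->] := hv _ cu'.
  move=> e; apply/val_inj.
  have sth (t : {rmorphism K -> Rcomplex R}) (a : R) q : t z = cis a ->
      normc (t (theta - q%:A)) = `|2 * cos a - ratr q|.
    move=> ta; rewrite rmorphB rmorph_in_alg /theta rmorphD fmorphV ta.
    have y0 : cis a != 0.
      apply/eqP => h; have := normc_cis a; rewrite h.
      by rewrite ComplexField.Normc.normc0 => /eqP; rewrite eq_sym oner_eq0.
    have -> : (cis a)^-1 = Complex (cos a) (- sin a).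
      apply: (mulfI y0); rewrite mulfV // /cis; congr Complex.
        by rewrite mulrN opprK -!expr2 cos2Dsin2.
      by rewrite mulrN mulrC addNr.
    by rewrite /= -mulr2n subrr subr0 expr0n addr0 sqrtr_sqr mulr_natl.
  rewrite !unit_rootX in sz s'z.
  have ce : 2 * cos (angle R N u) = 2 * cos (angle R N u').
    apply/eqP; rewrite eq_sym; apply/negPn/negP; rewrite -subr_eq0 -normr_gt0 => d0.
    have [q hq] := @ratr_dense R (2 * cos (angle R N u)) _ (divr_gt0 d0 (ltr0n _ 2)).
    have := sth s _ q sz; have -> := congr1 (fun f => f (theta - q%:A)) e.
    rewrite (sth s' _ q s'z) => h; rewrite distrC -h in hq.
    have := ler_distD (ratr q) (2 * cos (angle R N u')) (2 * cos (angle R N u)).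
    rewrite h [ `|ratr q - _|]distrC -h in hq *; lra.
  have {}ce : cos (angle R N u) = cos (angle R N u') by lra.
  have b1 := angle_half (co_gt0 _ cu) uN; have b2 := angle_half (co_gt0 _ cu') uN'.
  have : angle R N u = angle R N u'.
    by apply: cos_inj; rewrite // in_itv /=; [move: b1|move: b2] => /andP[/ltW -> /ltW ->].
  have N0 : N%:R != 0 :> R by rewrite pnatr_eq0 -lt0n.
  have p0 : 2 * pi != 0 :> R by rewrite mulf_neq0 // gt_eqF ?pi_gt0.
  by move=> /(mulIf (invr_neq0 N0)) /(mulfI p0) /eqP; rewrite eqr_nat => /eqP.
rewrite placesE (fsbig_image _ _ _ vinj) -(@bigfs _ _ _ _ (index_enum 'I_N)) ?index_enum_uniq //; last first.
  by move=> u _; rewrite mem_index_enum.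
rewrite (dim_cyclotomic iota zP gen).
rewrite (sum_coprime_half (G := fun u => G (v u))); last by move=> u uN cu; rewrite vsym.
rewrite mulr_sumr mulr_suml; apply: eq_bigr => u Hu.
have /andP[cu uN] := Hu; have [s sz ->] := hv _ cu.
rewrite (@local_degree_complex _ _ s z); first by rewrite mulrAC.
by rewrite sz unit_rootX /= sin0.
Qed.

End ArchimedeanPlaces.

(** * Products of [1 - z ^+ i] *)

Section RootsOfUnityProducts.
Variable F : fieldType.

Lemma prod_1subX (N : nat) (z : F) : N.-primitive_root z ->
  \prod_(1 <= i < N) (1 - z ^+ i) = N%:R.
Proof.
move=> zP; have N0 := prim_order_gt0 zP.
have h : \prod_(1 <= i < N) ('X - (z ^+ i)%:P) = \sum_(i < N) 'X^i.
  apply: (mulfI (_ : 'X - 1 != 0)); first by rewrite polyXsubC_eq0.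
  rewrite -subrX1 -(factor_Xn_sub_1 zP) [RHS]big_ltn // expr0.
have := congr1 (fun p : {poly F} => p.[1]) h.
rewrite horner_prod horner_sum.
under eq_bigr do rewrite hornerXsubC.
move=> ->; under eq_bigr do rewrite hornerXn expr1n.
by rewrite sumr_const card_ord.
Qed.

(** The product is the value at 1 of the cyclotomic polynomial [\sum_(i < p) ('X^m) ^+ i], obtained
    by dividing ['X^N - 1] by ['X^m - 1], whose roots are the powers with exponent divisible by
    [p]. *)
Lemma prod_coprime_1subX (p k : nat) (z : F) : prime p ->
  (p ^ k.+1).-primitive_root z ->
  \prod_(i < p ^ k.+1 | coprime i (p ^ k.+1)) (1 - z ^+ i) = p%:R.
Proof.
move=> pp zP; set N := (p ^ k.+1)%N in zP *; set m := (p ^ k)%N.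
have Nm : N = (m * p)%N by rewrite /N expnSr.
have p0 := prime_gt0 pp; have m0 : (0 < m)%N by rewrite expn_gt0 p0.
have N0 : (0 < N)%N := prim_order_gt0 zP.
have zpP : m.-primitive_root (z ^+ p).
  have := dvdn_prim_root zP (_ : m %| N)%N; rewrite Nm mulKn //; apply.
  exact: dvdn_mulr.
have copE (i : nat) : coprime i N = ~~ (p %| i)%N.
  by rewrite /N coprime_pexpr // coprime_sym prime_coprime.
have h : \prod_(i < N | coprime i N) ('X - (z ^+ i)%:P) = \sum_(i < p) ('X^m) ^+ i.
  have Xm1 : 'X^m - 1 != 0 :> {poly F} by rewrite monic_neq0 // monicXnsubC.
  apply: (mulfI Xm1); rewrite -subrX1 -exprM -Nm -(factor_Xn_sub_1 zP).
  rewrite big_mkord [RHS](bigID (fun i : 'I_N => coprime i N)) /= mulrC; congr (_ * _).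
  rewrite -(factor_Xn_sub_1 zpP) big_mkord.
  have lt_pi (i : 'I_m) : (p * i < N)%N by rewrite Nm mulnC ltn_pmul2r.
  have lt_ip (i : 'I_N) : (i %/ p < m)%N by rewrite ltn_divLR // -Nm.
  rewrite (reindex_onto (fun i : 'I_m => Ordinal (lt_pi i)) (fun i : 'I_N => Ordinal (lt_ip i))) /=.
    apply: eq_big => i.
      by rewrite copE negbK dvdn_mulr //= ; apply/esym/eqP/val_inj; rewrite /= mulKn.
    by move=> _; rewrite exprM.
  by move=> i; rewrite copE negbK => pi; apply/val_inj; rewrite /= mulnC divnK.
have := congr1 (fun p : {poly F} => p.[1]) h.
rewrite horner_prod horner_sum.
under eq_bigr do rewrite hornerXsubC.
move=> ->; under eq_bigr do rewrite horner_exp hornerXn !expr1n.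
by rewrite sumr_const card_ord.
Qed.

End RootsOfUnityProducts.

(** * Ultrametric absolute values *)

Section Ultrametric.
Variables (R : realType) (K : fieldType) (w : K -> R).
Hypothesis aw : absolute_value w.
Hypothesis w_nat : forall n : nat, w n%:R <= 1.

Lemma ultra_sum (I : Type) (r : seq I) (P : pred I) (F : I -> K) (M : R) :
  0 <= M -> (forall i, P i -> w (F i) <= M) -> w (\sum_(i <- r | P i) F i) <= M.
Proof.
move=> M0 h; elim/big_ind : _ => //; first by rewrite absv0.
move=> x y hx hy; apply: le_trans (absv_ultrametric _ _ aw w_nat) _.
by rewrite ge_max hx hy.
Qed.

Lemma ultra_sum_lt (I : Type) (r : seq I) (P : pred I) (F : I -> K) (M : R) :
  0 < M -> (forall i, P i -> w (F i) < M) -> w (\sum_(i <- r | P i) F i) < M.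
Proof.
move=> M0 h; elim/big_ind : _ => //; first by rewrite absv0.
move=> x y hx hy; apply: le_lt_trans (absv_ultrametric _ _ aw w_nat) _.
by rewrite gt_max hx hy.
Qed.

(** The hypothesis says that nonzero terms have distinct sizes; the largest then strictly dominates
    the sum of the others, so it has the size of the whole sum. *)
Lemma ultra_sum_ge (n : nat) (y : 'I_n -> K) :
  (forall i j, w (y i) = w (y j) -> y i != 0 -> i = j) ->
  forall i, w (y i) <= w (\sum_i y i).
Proof.
move=> dist i.
have [m _ hm] := @arg_maxP _ _ _ i xpredT (fun i => w (y i)) isT.
have {}hm j : w (y j) <= w (y m) by exact: hm.
apply: le_trans (hm i) _.
have [ym0|ym0] := eqVneq (y m) 0; first by rewrite ym0 absv0 // absv_ge0.
have wm : 0 < w (y m) by rewrite absv_gt0.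
have rest : w (\sum_(j | j != m) y j) < w (y m).
  apply: ultra_sum_lt => // j jm; rewrite lt_def hm andbT.
  by apply: contra jm => /eqP /dist ->.
rewrite leNgt; apply/negP => lt1.
have E : y m = \sum_j y j - \sum_(j | j != m) y j by rewrite (bigD1 m) //= addrK.
have := absv_ultrametric (\sum_j y j) (- \sum_(j | j != m) y j) aw w_nat.
by rewrite -E absvN // leNgt gt_max lt1 rest.
Qed.

Lemma ultra_unity_root_le (z : K) (n j : nat) : (0 < n)%N -> z ^+ n = 1 ->
  w (1 - z ^+ j) <= w (1 - z).
Proof.
move=> n0 zn; rewrite -opprB -[X in _ <= w X]opprB !absvN // subrX1 absvM //.
rewrite ler_piMr ?absv_ge0 //; apply: ultra_sum => // i _.
by rewrite absvX // (absv_unity_root aw n0 zn) expr1n.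
Qed.

Lemma ultra_unity_root_le1 (z : K) (n : nat) : (0 < n)%N -> z ^+ n = 1 ->
  w (1 - z) <= 1.
Proof.
move=> n0 zn; apply: le_trans (absv_ultrametric _ _ aw w_nat) _.
by rewrite ge_max (absvN _ aw) (absv1 aw) (absv_unity_root aw n0 zn) lexx.
Qed.

End Ultrametric.

(** * Places of a cyclotomic field above a prime *)

Section PadicPlaces.
Variables (R : realType) (K : fieldExtType rat) (P : {p : nat | prime p}).
Let p := val P.
Let pp : prime p. Proof. exact: valP. Qed.

Lemma padic_abs_nat n : (0 < n)%N -> padic_abs R p n%:R = (p%:R ^+ logn p n)^-1.
Proof.
move=> n0; rewrite /padic_abs pnatr_eq0 eqn0Ngt n0 /=.
have -> : n%:R = (n%:Z)%:~R :> rat by rewrite pmulrn.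
by rewrite numq_int denq_int /= logn1 expr0 div1r.
Qed.

Section Place.
Variable w : K -> R.
Hypothesis hw : places_above R K (Some P) w.
Let aw : absolute_value w. Proof. by case: hw. Qed.
Let p_gt0 : 0 < p%:R :> R. Proof. by rewrite ltr0n prime_gt0. Qed.
Let p_ge1 : 1 <= p%:R :> R. Proof. by rewrite ler1n prime_gt0. Qed.

Lemma padic_place_natE n : (0 < n)%N -> w n%:R = (p%:R ^+ logn p n)^-1.
Proof.
move=> n0; case: hw => _ /(_ n%:R); rewrite scaler_nat /= => ->.
exact: padic_abs_nat.
Qed.

Lemma padic_place_nat n : w n%:R <= 1.
Proof.
have [->|n0] := posnP n; first by rewrite absv0.
by rewrite padic_place_natE // invf_le1 ?exprn_gt0 // exprn_ege1.
Qed.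

(** The [1 - z ^+ i] have size at most 1 and their product [q] has size 1, so none can be
    smaller. *)
Lemma padic_place_prime_root (q : nat) (z : K) : prime q -> q != p ->
  q.-primitive_root z -> w (1 - z) = 1.
Proof.
move=> pq qp zP; have zq := prim_expr_order zP; have q0 := prime_gt0 pq.
have le1 := ultra_unity_root_le1 aw padic_place_nat q0 zq.
apply/eqP; rewrite eq_le le1 /=.
have : w q%:R = 1.
  by rewrite padic_place_natE // lognE; case: ifP => [/and3P[_ _]|]; rewrite ?expr0 ?invr1 // dvdn_prime2 // eq_sym (negbTE qp).
rewrite -(prod_1subX zP) absv_prod // big_ltn ?prime_gt1 // expr1 => h.
rewrite -{1}h ler_piMr ?absv_ge0 //; apply: prodr_ile1 => i _.
rewrite absv_ge0 //=; apply: (ultra_unity_root_le1 aw padic_place_nat q0).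
by rewrite -exprM mulnC exprM zq expr1n.
Qed.

(** The power [(z ^+ r) ^+ (N %/ q)] is a primitive [q]-th root of unity, so its distance 1 to 1 is
    a lower bound for that of [z ^+ r]. *)
Lemma padic_place_not_ppower (N q r : nat) (z : K) : N.-primitive_root z ->
  prime q -> q != p -> (q %| N)%N -> ~~ (q %| r)%N -> w (1 - z ^+ r) = 1.
Proof.
move=> zP pq qp qN qr; have N0 := prim_order_gt0 zP.
have zrN : (z ^+ r) ^+ N = 1 by rewrite -exprM mulnC exprM (prim_expr_order zP) expr1n.
apply/eqP; rewrite eq_le (ultra_unity_root_le1 aw padic_place_nat N0 zrN) /=.
apply: le_trans (ultra_unity_root_le aw padic_place_nat (N %/ q) N0 zrN).
rewrite le_eqVlt; apply/orP; left; apply/eqP/esym.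
apply: (@padic_place_prime_root q) => //.
rewrite -exprM mulnC exprM prim_root_exp_coprime ?dvdn_prim_root //.
by rewrite coprime_sym prime_coprime.
Qed.

Variables (k : nat) (z : K).
Hypothesis zP : (p ^ k.+1).-primitive_root z.
Let N := (p ^ k.+1)%N.
Let N_gt0 : (0 < N)%N. Proof. by rewrite expn_gt0 prime_gt0. Qed.
Let phi_gt0 : (0 < totient N)%N. Proof. by rewrite totient_gt0. Qed.

Lemma padic_place_coprime (i : nat) : coprime i N -> w (1 - z ^+ i) = w (1 - z).
Proof.
move=> ci; have zN := prim_expr_order zP.
apply/eqP; rewrite eq_le (ultra_unity_root_le aw padic_place_nat i N_gt0 zN) /=.
have i0 : (0 < i)%N.
  rewrite lt0n; apply/eqP => i0; move: ci; rewrite i0 /coprime gcd0n => /eqP N1.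
  by have := prime_gt1 pp; rewrite -(ltn_exp2r _ _ (ltn0Sn k)) exp1n -/N N1.
have [a b ab _] := egcdnP N i0.
have za : (z ^+ i) ^+ a = z.
  by rewrite -exprM mulnC ab (eqP ci) exprD mulnC exprM zN expr1n mul1r expr1.
rewrite -[X in w (1 - X) <= _]za.
apply: (ultra_unity_root_le aw padic_place_nat a N_gt0).
by rewrite -exprM mulnC exprM zN expr1n.
Qed.

(** The [totient N] factors of the product [p] all have the size of [1 - z]: total ramification. *)
Lemma padic_place_uniformizer : w (1 - z) ^+ totient N = p%:R^-1.
Proof.
have <- : w p%:R = p%:R^-1.
  by rewrite padic_place_natE ?prime_gt0 // -[X in logn _ X]expn1 pfactorK // expr1.
rewrite -(prod_coprime_1subX pp zP) absv_prod //.
rewrite (eq_bigr (fun=> w (1 - z))); last by move=> i ci; apply: padic_place_coprime.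
rewrite prodr_const totient_count_coprime -/N; congr (_ ^+ _).
rewrite -sum1_card big_mkord [RHS]big_mkcond /=; apply: eq_bigr => i _.
by rewrite unfold_in coprime_sym /coprime; case: ifP => [/eqP ->|/eqP]; case: eqP.
Qed.

Lemma padic_place_uniformizer_gt0 : 0 < w (1 - z).
Proof.
rewrite lt_def absv_ge0 // andbT; apply/eqP => h.
have := padic_place_uniformizer; rewrite h expr0n -(prednK phi_gt0) /=.
by move/esym/eqP; rewrite invr_eq0 gt_eqF.
Qed.

(** On raising to the power [totient N], the size of a nonzero [c i * (1 - z) ^+ i] becomes a power
    of [p] whose exponent is [- i] modulo [totient N]. So distinct terms have distinct sizes and
    each is bounded by the sum. The factor [p] pays for [(1 - z) ^+ i], of size at least [p^-1]. *)
Lemma padic_place_coord (c : 'I_(totient N) -> rat) i :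
  rat_abs R (Some P) (c i) <= p%:R * w (\sum_i (c i)%:A * (1 - z) ^+ i).
Proof.
have wc q : w q%:A = padic_abs R p q by case: hw => _ ->.
have p1 := padic_place_uniformizer_gt0.
have le1 := ultra_unity_root_le1 aw padic_place_nat N_gt0 (prim_expr_order zP).
have dist (a b : 'I_(totient N)) :
    w ((c a)%:A * (1 - z) ^+ a) = w ((c b)%:A * (1 - z) ^+ b) ->
    (c a)%:A * (1 - z) ^+ a != 0 -> a = b.
  move=> e na.
  have nb : (c b)%:A * (1 - z) ^+ b != 0.
    by apply: contra na => /eqP b0; apply/eqP/(absv_eq0 aw); rewrite e b0 absv0.
  have ca : c a != 0 by apply: contraNneq na => ->; rewrite scale0r mul0r.
  have cb : c b != 0 by apply: contraNneq nb => ->; rewrite scale0r mul0r.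
  move: e; rewrite !(absvM aw) !(absvX _ _ aw) !wc /padic_abs (negbTE ca) (negbTE cb).
  set a1 := logn _ _; set a2 := logn _ _; set b1 := logn _ _; set b2 := logn _ _.
  move=> /(congr1 (fun x => x ^+ totient N)); rewrite !exprMn !exprVn -!exprM.
  rewrite ![(_ * totient N)%N]mulnC (exprM (w (1 - z)) _ a) (exprM (w (1 - z)) _ b) padic_place_uniformizer !exprVn.
  have np n : p%:R ^+ n != 0 :> R by rewrite expf_neq0 // gt_eqF.
  rewrite -mulrA -invfM -mulrA -invfM -!exprD => /eqP.
  rewrite eqr_div // -!exprD => /eqP/eqP.
  rewrite -!natrX eqr_nat eqn_exp2l ?prime_gt1 // => /eqP h.
  apply/val_inj => /=.
  have : (a %% totient N = b %% totient N)%N.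
    move: h; move/(congr1 (fun x => x %% totient N)%N).
    rewrite ![(totient N * _)%N]mulnC !addnA -!addnA.
    rewrite !modnMDl => -> //.
  by rewrite !modn_small.
have := @ultra_sum_ge _ _ w aw padic_place_nat _ (fun i => (c i)%:A * (1 - z) ^+ i) dist i.
rewrite absvM // absvX // wc /= => h.
apply: le_trans (_ : p%:R * (padic_abs R p (c i) * w (1 - z) ^+ i) <= _); last by rewrite ler_pM2l.
have pa : 0 <= padic_abs R p (c i) by rewrite -wc absv_ge0.
rewrite mulrCA ler_peMr // -ler_pdivrMl // mulr1 -padic_place_uniformizer.
by apply: ler_wiXn2l => //; [exact: ltW | exact: ltnW].
Qed.

End Place.

Variables (k : nat) (z : K) (iota : {rmorphism K -> algC}).
Hypothesis zP : (p ^ k.+1).-primitive_root z.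
Hypothesis gen : forall x, exists q, x = hornerQ q z.
Let N := (p ^ k.+1)%N.

Lemma uniformizer_span (x : K) :
  exists c : 'I_(totient N) -> rat, x = \sum_i (c i)%:A * (1 - z) ^+ i.
Proof.
have [c ->] := power_basis_span (PhiQ_neq0 _) (hornerQ_eq0 iota zP) gen x.
rewrite size_PhiQ /= in c *.
pose Q := \poly_(j < totient N) (if insub j is Some j' then c j' else 0).
have QE (j : 'I_(totient N)) : Q`_j = c j by rewrite coef_poly ltn_ord valK.
pose Q' := Q \Po (1 - 'X).
have sz : (size Q' <= totient N)%N.
  rewrite /Q' size_comp_poly2 ?size_poly //.
  by rewrite -opprB size_polyN size_XsubC.
exists (fun i => Q'`_i); rewrite -(hornerQ_sum _ sz) -(eq_bigr _ (fun (i : 'I_(totient N)) _ => congr1 (fun t => t%:A * z ^+ i) (QE i))).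
rewrite -(hornerQ_sum _ (size_poly _ _)) /Q' /hornerQ map_comp_poly horner_comp.
by rewrite rmorphB rmorph1 /= map_polyX !hornerE; congr (_.[_]); ring.
Qed.

(** Each term of the expansion in powers of [1 - z] has [w]-size at most that of its coefficient,
    which is at most [p] times the [w']-size of the sum. *)
Lemma padic_place_unique (w w' : K -> R) : places_above R K (Some P) w ->
  places_above R K (Some P) w' -> w = w'.
Proof.
move=> hw hw'; have [aw wq] := hw; have [aw' wq'] := hw'.
apply: (@absv_eq_of_le _ _ _ _ p%:R) => // x.
have [c ->] := uniformizer_span x.
apply: (ultra_sum aw (padic_place_nat hw)).
  by rewrite mulr_ge0 ?(absv_ge0 aw') ?ler0n.
move=> i _; rewrite absvM // absvX //.
apply: le_trans (padic_place_coord hw' zP c i).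
rewrite wq ler_piMr //; first by rewrite -wq absv_ge0.
apply: exprn_ile1; first exact: absv_ge0.
apply: (ultra_unity_root_le1 aw (padic_place_nat hw)) (prim_expr_order zP).
by rewrite expn_gt0 prime_gt0.
Qed.

Lemma padic_local_degree_le (w : K -> R) : places_above R K (Some P) w ->
  (local_degree (Some P) w <= totient N)%N.
Proof.
(* In the absence of any degree the default value 0 satisfies the bound. *)
move=> hw; rewrite /local_degree; case: xgetP => [n _ hn|_] //.
apply: (@has_local_degree_le _ _ _ _ _ (fun i => (1 - z) ^+ i) p%:R) hn.
  move=> x e e0; have [c xE] := uniformizer_span x; exists c.
  by rewrite -xE subrr absv0 //; case: hw.
by move=> c i; apply: padic_place_coord.
Qed.

End PadicPlaces.

Lemma ord3P (Q : 'I_3 -> Prop) : Q 0 -> Q 1 -> Q 2%:R -> forall i, Q i.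
Proof.
move=> Q0 Q1 Q2 [[|[|[|//]]] i3].
- by have -> : Ordinal i3 = 0 by exact/val_inj.
- by have -> : Ordinal i3 = 1 by exact/val_inj.
- by have -> : Ordinal i3 = 2%:R by exact/val_inj.
Qed.

(** * The p-adic contributions to the height *)

Section PadicSum.
Variables (R : realType) (K : fieldExtType rat) (iota : {rmorphism K -> algC}).
Variables (N : nat) (z : K) (r s : nat) (x : 'rV[K]_3).
Hypothesis zP : N.-primitive_root z.
Hypothesis gen : forall y, exists q, y = hornerQ q z.
Hypothesis rsN : coprime (gcdn r s) N.
Hypothesis x0 : x 0 0 = z ^+ s - z ^+ r.
Hypothesis x1 : x 0 1 = 1 - z ^+ s.
Hypothesis x2 : x 0 2%:R = z ^+ r - 1.

Let maxabs (w : K -> R) : R := \big[Num.max/0]_(i < 3) w (x 0 i).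

Lemma gcd_prime_ndvd q : prime q -> (q %| N)%N -> ~~ (q %| r)%N \/ ~~ (q %| s)%N.
Proof.
move=> pq qN; have : ~~ (q %| gcdn r s)%N.
  apply/negP => qrs; have := dvdn_gcd q (gcdn r s) N; rewrite qrs qN (eqP rsN) dvdn1.
  by move/eqP=> q1; move: pq; rewrite q1.
by rewrite dvdn_gcd negb_and => /orP.
Qed.

Section Place.
Variables (P : {p : nat | prime p}) (w : K -> R).
Hypothesis hw : places_above R K (Some P) w.
Let aw : absolute_value w. Proof. by case: hw. Qed.

Lemma padic_zX j : w (z ^+ j) = 1.
Proof.
by rewrite (absvX _ _ aw) (absv_unity_root aw (prim_order_gt0 zP) (prim_expr_order zP)) expr1n.
Qed.

Lemma padic_max_le1 : maxabs w <= 1.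
Proof.
have um y y' : w y <= 1 -> w y' <= 1 -> w (y - y') <= 1.
  move=> h h'; apply: le_trans (absv_ultrametric _ _ aw (padic_place_nat hw)) _.
  by rewrite ge_max absvN // h h'.
apply: bigmax_le => // i _; move: i; apply: ord3P.
- by rewrite x0 um ?padic_zX.
- by rewrite x1 um ?padic_zX ?absv1.
- by rewrite x2 um ?padic_zX ?absv1.
Qed.

Lemma padic_max_ge : w (1 - z ^+ r) <= maxabs w /\ w (1 - z ^+ s) <= maxabs w.
Proof.
split; first by rewrite -absvN // opprB -x2; apply: le_bigmax.
by rewrite -x1; apply: le_bigmax.
Qed.

Lemma padic_max_eq1 q : prime q -> q != val P -> (q %| N)%N -> maxabs w = 1.
Proof.
move=> pq qp qN; apply/eqP; rewrite eq_le padic_max_le1 /=.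
have [h1 h2] := padic_max_ge.
have [qr|qs] := gcd_prime_ndvd pq qN.
  by rewrite -(padic_place_not_ppower hw zP pq qp qN qr).
by rewrite -(padic_place_not_ppower hw zP pq qp qN qs).
Qed.

Lemma padic_max_ge_unif k : N = (val P ^ k.+1)%N -> w (1 - z) <= maxabs w.
Proof.
move=> NE; have [h1 h2] := padic_max_ge.
have zP' : (val P ^ k.+1).-primitive_root z by rewrite -NE.
have pp : prime (val P) by exact: valP.
have pN : (val P %| N)%N by rewrite NE dvdn_exp.
have co j : ~~ (val P %| j)%N -> coprime j (val P ^ k.+1).
  by move=> pj; rewrite coprime_pexpr // coprime_sym prime_coprime.
have [/co qr|/co qs] := gcd_prime_ndvd pp pN.
  by rewrite -(padic_place_coprime hw zP' qr).
by rewrite -(padic_place_coprime hw zP' qs).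
Qed.

End Place.

Lemma padic_sum_eq0 P q : prime q -> q != val P -> (q %| N)%N ->
  \sum_(w \in places_above R K (Some P))
    (local_degree (Some P) w)%:R / (\dim {:K})%:R * ln (maxabs w) = 0.
Proof.
move=> pq qp qN; apply: fsbig1 => w hw.
by rewrite (padic_max_eq1 hw pq qp qN) ln1 mulr0.
Qed.

(** At most one place contributes, with weight at most 1. The largest coordinate has size between
    [w (1 - z)] and 1, and [ln (w (1 - z))] is [- ln p / totient N]. *)
Lemma padic_sum_le P k : N = (val P ^ k.+1)%N ->
  `|\sum_(w \in places_above R K (Some P))
    (local_degree (Some P) w)%:R / (\dim {:K})%:R * ln (maxabs w)|
  <= ln (val P)%:R / (totient N)%:R.
Proof.
move=> NE; have zP' : (val P ^ k.+1).-primitive_root z by rewrite -NE.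
have pp : prime (val P) by exact: valP.
have p1 : 1 <= (val P)%:R :> R by rewrite ler1n prime_gt0.
have t0 : 0 < (totient N)%:R :> R by rewrite ltr0n totient_gt0 (prim_order_gt0 zP).
have [->|/set0P[w hw]] := eqVneq (places_above R K (Some P)) set0.
  by rewrite fsbig_set0 normr0 divr_ge0 ?ln_ge0 // ltW.
have -> : places_above R K (Some P) = [set w].
  apply/seteqP; split=> [w' hw'|_ ->] //=.
  exact: (padic_place_unique iota zP' gen hw' hw).
rewrite fsbig_set1 (dim_cyclotomic iota zP gen).
have le1 := padic_max_le1 hw; have ge := padic_max_ge_unif hw NE.
have u0 := padic_place_uniformizer_gt0 hw zP'.
have m0 : 0 < maxabs w by apply: lt_le_trans ge.
have lnu : (totient N)%:R * ln (w (1 - z)) = - ln (val P)%:R.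
  rewrite mulr_natl -lnXn ?u0 //.
  by rewrite -lnV ?posrE ?(lt_le_trans ltr01 p1) // -(padic_place_uniformizer hw zP') NE.
have dle := padic_local_degree_le iota zP' gen hw; rewrite -NE in dle.
rewrite normrM; have -> : ln (val P)%:R / (totient N)%:R = 1 * - ln (w (1 - z)).
  by rewrite mul1r -[ln _]opprK -lnu mulNr mulrC mulKf // gt_eqF.
apply: ler_pM => //.
  by rewrite ger0_norm ?divr_ge0 ?ler0n // ler_pdivrMr // mul1r ler_nat.
rewrite ler0_norm ?ln_le0 // lerN2 ler_ln ?posrE //.
Qed.

End PadicSum.

Lemma num_field_coords_gen (n : nat) (x : 'rV[algC]_n.+1) :
  exists2 iota : {rmorphism num_field x -> algC},
    map_mx iota (num_field_coords x) = x &
    <<1 & [seq num_field_coords x 0%R i | i <- enum 'I_n.+1]>>%VS = fullv.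
Proof.
rewrite /num_field_coords /num_field.
case: (num_field_exists _) => F [iota [s1 /= Es gen]].
have szs : size s1 = n.+1 by rewrite -(size_map iota) Es size_map size_enum_ord.
have s1E : [seq (\row_(i < n.+1) nth 0 s1 i) 0 i | i <- enum 'I_n.+1] = s1.
  apply: (@eq_from_nth _ 0); first by rewrite size_map size_enum_ord.
  move=> i; rewrite size_map size_enum_ord => hi.
  by rewrite (nth_map ord0) ?size_enum_ord // mxE nth_enum_ord.
exists iota; last by rewrite s1E.
apply/rowP => i; rewrite !mxE -(nth_map 0 0) ?szs // Es (nth_map ord0) ?size_enum_ord //.
by rewrite nth_ord_enum.
Qed.

(** The coefficients must be natural numbers, as they serve as exponents in the construction of a
    primitive element. *)
Lemma bezout_mod r s d : (0 < d)%N ->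
  exists a b, a * r + b * s = gcdn (gcdn r s) d %[mod d].
Proof.
move=> d0.
have step m n : exists a b, a * m + b * n = gcdn m n %[mod d].
  have [->|m0] := posnP m; first by exists 0%N, 1%N; rewrite gcd0n mul0n mul1n.
  (* Modulo [d], [d.-1 * b] is [- b]. *)
  have [a b ab _] := egcdnP n m0; exists a, (d.-1 * b)%N.
  have -> : (a * m + d.-1 * b * n = b * n * d + gcdn m n)%N.
    by rewrite ab -(mulnA d.-1) -[in RHS](prednK d0) mulnS [(d.-1 * _)%N]mulnC; lia.
  by rewrite modnMDl.
have [a [b ab]] := step r s; have [a' [b' ab']] := step (gcdn r s) d.
exists (a' * a)%N, (a' * b)%N.
rewrite -ab' -!mulnA -mulnDr -modnMmr ab modnMmr.
by rewrite [in RHS]addnC modnMDl.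
Qed.

Lemma gcdn3_dvd (r s d : nat) (g := gcdn (gcdn r s) d) :
  [/\ (g %| r)%N, (g %| s)%N & (g %| d)%N].
Proof.
split; last exact: dvdn_gcdr.
  exact: dvdn_trans (dvdn_gcdl _ _) (dvdn_gcdl _ _).
exact: dvdn_trans (dvdn_gcdl _ _) (dvdn_gcdr _ _).
Qed.

Lemma gcdn_cofactor (r s d : nat) (g := gcdn (gcdn r s) d) : (0 < d)%N ->
  coprime (gcdn (r %/ g) (s %/ g)) (d %/ g).
Proof.
move=> d0; have g0 : (0 < g)%N by rewrite gcdn_gt0 d0 orbT.
have [gr gs gd] := gcdn3_dvd r s d; rewrite -/g in gr gs gd.
rewrite /coprime -(eqn_pmul2r g0) mul1n !muln_gcdl !divnK //.
Qed.

(** * The field generated by the coordinates of the intersection point *)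

Section CapPoint.
Variables (d : nat) (zd : algC) (r s : nat).
Hypothesis zdP : d.-primitive_root zd.
Let d_gt0 : (0 < d)%N := prim_order_gt0 zdP.
Let w : algC * algC := ((zd ^+ r)^-1, (zd ^+ s)^-1).
Let g := gcdn (gcdn r s) d.
Let g_gt0 : (0 < g)%N. Proof. by rewrite gcdn_gt0 d_gt0 orbT. Qed.
Let N := (d %/ g)%N.
Let K := num_field (cap_point w).
Let x : 'rV[K]_3 := num_field_coords (cap_point w).

(** With this normalization of the coordinates, [zd ^+ r] and [zd ^+ s] differ from two of them by
    sign and by 1. Bezout then produces a [z] mapped to [zd ^+ g], of order [N], in which the
    coordinates are polynomials, so [z] generates the field. *)
Lemma cap_point_cyclotomic : exists (iota : {rmorphism K -> algC}) (z : K),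
  [/\ N.-primitive_root z, (forall y, exists q, y = hornerQ q z) &
   [/\ x 0 0 = z ^+ (s %/ g) - z ^+ (r %/ g), x 0 1 = 1 - z ^+ (s %/ g)
     & x 0 2%:R = z ^+ (r %/ g) - 1]].
Proof.
have [iota Ex gen] := num_field_coords_gen (cap_point w).
have [gr gs gd] := gcdn3_dvd r s d; rewrite -/g in gr gs gd.
have Exi i : iota (x 0 i) = cap_point w 0 i.
  by have := congr1 (fun y : 'rV_3 => y 0 i) Ex; rewrite mxE.
pose A : K := 1 + x 0 2%:R; pose B : K := 1 - x 0 1.
have iA : iota A = zd ^+ r by rewrite rmorphD rmorph1 Exi mxE /= invrK addrC subrK.
have iB : iota B = zd ^+ s by rewrite rmorphB rmorph1 Exi mxE /= invrK opprB addrC subrK.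
have [a [b ab]] := bezout_mod r s d_gt0.
pose z := A ^+ a * B ^+ b.
have iz : iota z = zd ^+ g.
  rewrite rmorphM !rmorphXn iA iB -!exprM -exprD.
  by rewrite -(prim_expr_mod zdP) mulnC (mulnC s) ab (prim_expr_mod zdP).
have zA : z ^+ (r %/ g) = A by apply: (fmorph_inj iota); rewrite rmorphXn iz -exprM mulnC divnK.
have zB : z ^+ (s %/ g) = B by apply: (fmorph_inj iota); rewrite rmorphXn iz -exprM mulnC divnK.
have xE : [/\ x 0 0 = z ^+ (s %/ g) - z ^+ (r %/ g), x 0 1 = 1 - z ^+ (s %/ g)
     & x 0 2%:R = z ^+ (r %/ g) - 1].
  rewrite zA zB; split.
  - by apply: (fmorph_inj iota); rewrite rmorphB iA iB Exi mxE /= !invrK.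
  - by rewrite /B opprB addrC subrK.
  - by rewrite /A addrC addKr.
exists iota, z; split=> //.
  have := dvdn_prim_root zdP (_ : N %| d)%N.
  rewrite /N divnA // mulKn // -iz fmorph_primitive_root; apply.
  exact: dvdn_div.
move=> y.
have : y \in <<1; z>>%VS.
  have : (fullv <= <<1; z>>)%VS.
    rewrite -gen; apply/Fadjoin_seqP; split; first exact: sub1v.
    have zin : z \in <<1; z>>%VS := memv_adjoin _ _.
    move=> _ /mapP[i _ ->]; rewrite -/x; have [e0 e1 e2] := xE.
    by move: i; apply: ord3P; rewrite ?e0 ?e1 ?e2 rpredB ?rpredX ?rpred1.
  by move/subvP; apply; rewrite memvf.
move=> /Fadjoin_polyP[p /polyOverP pK ->].
have a_ i := sig_eqW (vlineP _ _ (pK i)).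
exists (\poly_(i < size p) sval (a_ i)).
rewrite /hornerQ; congr (_.[_]); apply/polyP => i; rewrite coef_map coef_poly /=.
case: ltnP => hi; first by case: (a_ i).
by rewrite scale0r nth_default.
Qed.

End CapPoint.

(** * The Archimedean height function in terms of chords *)

Section Triangle.
Variable R : realType.

(** The square of [|1 - e^(i t)|], which unlike the modulus is a trigonometric polynomial. *)
Definition chord2 (t : R) : R := 2 - 2 * cos t.

(** The function [f] of the overview; the division by 2 undoes the squaring of the chords. At
    [(0, 0)] its value is 0, the default value of [ln] at 0. *)
Definition logtri (a b : R) : R :=
  ln (Num.max (chord2 (a - b)) (Num.max (chord2 b) (chord2 a))) / 2.

Lemma chord2_ge0 t : 0 <= chord2 t.
Proof. by rewrite /chord2; have := cos_le1 t; lra. Qed.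

Lemma normc_1Bcis t : normc (1 - cis t) = Num.sqrt (chord2 t).
Proof.
rewrite /= add0r sqrrN sin2cos2 /chord2; congr Num.sqrt; ring.
Qed.

Lemma normc_cisB a b : normc (cis b - cis a) = Num.sqrt (chord2 (a - b)).
Proof.
have -> : cis b - cis a = cis b * (1 - cis (a - b)).
  by rewrite mulrBr mulr1 -cisD [b + _]addrC subrK.
by rewrite ComplexField.Normc.normcM normc_cis mul1r normc_1Bcis.
Qed.

Lemma ln_sqrt (t : R) : 0 <= t -> ln (Num.sqrt t) = ln t / 2.
Proof.
rewrite le_eqVlt => /orP[/eqP <-|t0]; first by rewrite sqrtr0 ln0 ?mul0r.
rewrite -[in RHS](sqr_sqrtr (ltW t0)) lnXn ?sqrtr_gt0 // mulr2n; lra.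
Qed.

Lemma max_sqrt (a b : R) : Num.max (Num.sqrt a) (Num.sqrt b) = Num.sqrt (Num.max a b).
Proof.
have [ab|/ltW ba] := leP a b; first by apply/max_r/ler_wsqrtr.
by apply/max_l/ler_wsqrtr.
Qed.

Lemma ln_max_chord a b (F : 'I_3 -> R) :
  F 0 = normc (cis b - cis a) -> F 1 = normc (1 - cis b) ->
  F 2%:R = normc (cis a - 1) ->
  ln (\big[Num.max/0]_(i < 3) F i) = logtri a b.
Proof.
move=> e0 e1 e2; rewrite !big_ord_recl big_ord0.
have -> : lift ord0 (lift ord0 ord0) = 2%:R :> 'I_3 by exact/val_inj.
have -> : lift ord0 ord0 = 1 :> 'I_3 by exact/val_inj.
rewrite e0 e1 e2 -cis0 !normc_cisB subr0 sub0r.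
have -> : chord2 (- a) = chord2 a by rewrite /chord2 cosN.
rewrite [Num.max _ 0]max_l ?sqrtr_ge0 // !max_sqrt ln_sqrt ?le_max ?chord2_ge0 //.
Qed.

End Triangle.

(** By the Chinese remainder theorem [t] is taken to be [v] modulo the part of [d] supported on the
    primes of [N], and 1 modulo the remaining part. *)
Lemma coprime_lift (N d v : nat) : (0 < d)%N -> (N %| d)%N -> coprime v N ->
  exists2 t, coprime t d & t = v %[mod N].
Proof.
move=> d0 Nd cvN; have N0 := dvdn_gt0 d0 Nd.
(* For [N = 1] the residue [v] may be 0, so it is made positive. *)
pose v' := (v + N)%N; have v'0 : (0 < v')%N by rewrite addn_gt0 N0 orbT.
have cv' : coprime v' N by rewrite /coprime /v' gcdnC gcdnDr gcdnC.
pose d1 := (d`_(\pi(N)))%N; pose d2 := (d`_(\pi(N)^'))%N.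
have c12 : coprime d1 d2 by apply: (@pnat_coprime \pi(N)); rewrite ?part_pnat.
have dE : (d1 * d2)%N = d by rewrite partnC.
have Nd1 : (N %| d1)%N.
  by rewrite -[N in (N %| _)%N](@part_pnat_id \pi(N)) ?pnat_pi // partn_dvd.
exists (chinese d1 d2 v' 1).
  rewrite -dE coprimeMr -coprime_modl chinese_modl // coprime_modl.
  rewrite -(coprime_modl _ d2) chinese_modr // coprime_modl coprime1n andbT.
  rewrite coprime_sym; apply: (@pnat_coprime \pi(N)); first by rewrite part_pnat.
  by rewrite -coprime_pi' // coprime_sym.
have := congr1 (fun t => t %% N)%N (chinese_modl c12 v' 1).
rewrite !modn_dvdm // => ->; by rewrite /v' modnDr.
Qed.

(** Reduction from the units modulo [d] to the units modulo [N] is onto with fibres of equal size.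
    This rewrites the orbit of a point of any order [N] dividing [d] as an average over the units
    modulo [d]. *)
Lemma coprime_average (R : numFieldType) (N d : nat) (F : nat -> R) :
  (0 < d)%N -> (N %| d)%N -> (forall t, F (t %% N)%N = F t) ->
  (\sum_(t < d | coprime t d) F t) / (totient d)%:R =
  (\sum_(u < N | coprime u N) F u) / (totient N)%:R.
Proof.
move=> d0 Nd FN; have N0 := dvdn_gt0 d0 Nd.
pose S (u : 'I_N) := [set t : 'I_d | coprime t d & (t %% N == u)%N]%SET.
have copN t : coprime t d -> coprime t N.
  by move=> ct; rewrite (coprime_dvdr Nd ct).
pose h (t : 'I_d) := Ordinal (ltn_pmod t N0).
have sumE (G : nat -> R) : (forall t, G (t %% N)%N = G t) ->
    \sum_(t < d | coprime t d) G t = \sum_(u < N | coprime u N) #|S u|%:R * G u.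
  move=> GN; rewrite (partition_big h (fun u => coprime u N)) /=; last first.
    by move=> t ct; rewrite coprime_modl copN.
  apply: eq_bigr => u _; rewrite -sum1_card natr_sum mulr_suml.
  apply: eq_big => [t|t /andP[_ /eqP <-]]; first by rewrite inE.
  by rewrite mul1r GN.
have le_card (u u' : 'I_N) : coprime u N -> coprime u' N -> (#|S u| <= #|S u'|)%N.
  (* Modulo [N], [c] is [u' / u] by Euler's theorem; multiplication by a lift of it to a unit modulo
     [d] maps [S u] injectively into [S u']. *)
  move=> cu cu'; pose c := (u ^ (totient N).-1 * u')%N.
  have cc : coprime c N by rewrite coprimeMl cu' andbT coprimeXl.
  have [t0 ct0 t0E] := coprime_lift d0 Nd cc.
  have t0u : t0 * u = u' %[mod N].
    rewrite -modnMml t0E modnMml /c mulnAC -expnSr prednK ?totient_gt0 //.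
    by rewrite -modnMml (Euler_exp_totient cu) modnMml mul1n.
  pose m (t : 'I_d) := Ordinal (ltn_pmod (t0 * t) d0).
  have minj : {in S u &, injective m}.
    have inv t : ((t0 ^ (totient d).-1 * ((t0 * t) %% d)) %% d = t %% d)%N.
      rewrite modnMmr mulnA -expnSr prednK ?totient_gt0 //.
      by rewrite -modnMml (Euler_exp_totient ct0) modnMml mul1n.
    move=> t t' _ _ /(congr1 val) /= e; apply/val_inj => /=.
    have := congr1 (fun v => (t0 ^ (totient d).-1 * v) %% d)%N e.
    by rewrite /= !inv !modn_small.
  rewrite -(card_in_imset minj); apply: subset_leq_card; apply/fintype.subsetP => _ /imsetP[t tS ->].
  move: tS; rewrite !inE /= => /andP[ct /eqP tu].
  rewrite coprime_modl coprimeMl ct0 ct /= modn_dvdm // -modnMmr tu t0u modn_small //.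
have N1 : coprime (1 %% N) N by rewrite coprime_modl coprime1n.
pose u1 := Ordinal (ltn_pmod 1 N0).
have cE (u : 'I_N) : coprime u N -> #|S u| = #|S u1|.
  by move=> cu; apply/eqP; rewrite eqn_leq !le_card.
have constE (G : nat -> R) : (forall t, G (t %% N)%N = G t) ->
    \sum_(t < d | coprime t d) G t = #|S u1|%:R * \sum_(u < N | coprime u N) G u.
  by move=> GN; rewrite sumE // mulr_sumr; apply: eq_bigr => u cu; rewrite cE.
have totE n : (totient n)%:R = \sum_(t < n | coprime t n) 1 :> R.
  rewrite totient_count_coprime big_mkord natr_sum [RHS]big_mkcond /=.
  by apply: eq_bigr => t _; rewrite coprime_sym; case: coprime.
have tdE : (totient d)%:R = #|S u1|%:R * (totient N)%:R :> R.
  by rewrite !totE (constE (fun=> 1)).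
rewrite constE // tdE invfM mulrACA mulfV ?mul1r //.
have : (totient d)%:R != 0 :> R by rewrite pnatr_eq0 -lt0n totient_gt0.
by rewrite tdE mulf_eq0 negb_or => /andP[].
Qed.

(** * The height compared with an orbit average *)

Section HeightApprox.
Variable R : realType.

Definition orbit_mean (d r s : nat) : R :=
  (\sum_(t < d | coprime t d) logtri (angle R d (t * r)) (angle R d (t * s)))
    / (totient d)%:R.

Lemma ln_le_sqrt (x : R) : 0 < x -> ln x <= 2 * Num.sqrt x.
Proof.
move=> x0; have s0 : 0 < Num.sqrt x by rewrite sqrtr_gt0.
rewrite -[in ln x](sqr_sqrtr (ltW x0)) lnXn // mulr2n.
have := le_ln1Dx (_ : -1 < Num.sqrt x - 1); rewrite [1 + _]addrC subrK => h.
have := h ltac:(lra); lra.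
Qed.

(** [ln p <= ln N <= 2 * sqrt N], and [totient N] is at least [N / 2] for a prime power [N]. *)
Lemma ln_prime_totient_le (p k : nat) : prime p ->
  ln p%:R / (totient (p ^ k.+1))%:R <= 4 / Num.sqrt (p ^ k.+1)%:R :> R.
Proof.
move=> pp; set N := (p ^ k.+1)%N.
have p1 := prime_gt1 pp; have p0 := prime_gt0 pp.
have N0 : 0 < N%:R :> R by rewrite ltr0n expn_gt0 p0.
have t2 : N%:R <= 2 * (totient N)%:R :> R.
  rewrite -natrM ler_nat totient_pfactor // /N expnSr mulnC mulnA leq_mul2r.
  by apply/orP; right; lia.
have t0 : 0 < (totient N)%:R :> R by lra.
have s0 : 0 < Num.sqrt N%:R :> R by rewrite sqrtr_gt0.
have lnp : ln p%:R <= ln N%:R :> R.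
  rewrite ler_ln ?posrE // ?ltr0n // ler_nat /N -[X in (X <= _)%N]expn1 leq_exp2l //.
have h := le_trans lnp (ln_le_sqrt N0).
rewrite ler_pdivrMr // mulrAC ler_pdivlMr //.
apply: le_trans (_ : 2 * Num.sqrt N%:R * Num.sqrt N%:R <= _); first by rewrite ler_pM2r.
by rewrite -mulrA -expr2 sqr_sqrtr ?(ltW N0) //; lra.
Qed.

Lemma heightCap_approx (d : nat) (zd : algC) (r s : nat) :
  d.-primitive_root zd -> let N := (d %/ gcdn (gcdn r s) d)%N in (2 < N)%N ->
  `|heightCap R ((zd ^+ r)^-1, (zd ^+ s)^-1) - orbit_mean d r s|
    <= 4 / Num.sqrt N%:R.
Proof.
move=> zdP N N2; have d0 := prim_order_gt0 zdP.
set w := (_, _); set g := gcdn (gcdn r s) d.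
have g0 : (0 < g)%N by rewrite gcdn_gt0 d0 orbT.
have N0 : (0 < N)%N by apply: ltn_trans N2.
have [gr gs gd] := gcdn3_dvd r s d; rewrite -/g in gr gs gd.
have [iota [z [zP gen [x0 x1 x2]]]] := cap_point_cyclotomic r s zdP.
rewrite -/g in zP x0 x1 x2; rewrite -/N in zP.
have rsN := gcdn_cofactor r s d0; rewrite -/g -/N in rsN.
rewrite /heightCap /height /height_in.
set K := num_field _ in iota z zP gen x0 x1 x2 *; set x := num_field_coords _ in x0 x1 x2 *.
set T := fun v : rat_place => \sum_(w0 \in places_above R K v) _.
have archE : T None = orbit_mean d r s.
  rewrite /T; have Cphi := GRing.in_alg (Rcomplex R) \o ratr : {rmorphism rat -> Rcomplex R}.
  have prim u : coprime u N -> N.-primitive_root (unit_root R N ^+ u).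
    by move=> cu; rewrite prim_root_exp_coprime // unit_root_prim.
  have emb u : coprime u N -> exists t : {rmorphism K -> Rcomplex R}, t z = unit_root R N ^+ u.
    by move=> /prim; apply: (cyclotomic_embedding iota zP gen Cphi).
  have [v hv] : {v : nat -> K -> R | forall u, coprime u N ->
      exists2 t : {rmorphism K -> Rcomplex R}, t z = unit_root R N ^+ u & v u = fun y => normc (t y)}.
    have h u : {vu : K -> R | coprime u N -> exists2 t : {rmorphism K -> Rcomplex R}, t z = unit_root R N ^+ u & vu = fun y => normc (t y)}.
      apply: cid; have [cu|] := boolP (coprime u N); last by exists (fun=> 0).
      by have [t tz] := emb u cu; exists (fun y => normc (t y)) => _; exists t.
    by exists (fun u => sval (h u)) => u; apply: (svalP (h u)).
  rewrite (arch_sum iota zP gen N2 (fun w0 => ln (\big[Num.max/0]_(i < 3) w0 (x 0 i))) hv).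
  have cosE t : (fun t => logtri (angle R d (t * r)) (angle R d (t * s))) t =
      logtri (angle R N (t * (r %/ g))) (angle R N (t * (s %/ g))).
    have aE j : (g %| j)%N -> angle R d (t * j) = angle R N (t * (j %/ g)).
      move=> gj; rewrite /angle -(divnK gj) -(divnK gd) -/N mulnK // !natrM.
      by field; rewrite ?pnatr_eq0 -?lt0n ?g0 ?N0.
    by rewrite /= !aE.
  rewrite /orbit_mean (coprime_average (N := N) (F := fun t => logtri (angle R d (t * r)) (angle R d (t * s)))) //.
  - congr (_ / _); apply: eq_bigr => u cu; rewrite cosE.
    have [t tz ->] := hv _ cu; apply: ln_max_chord.
    + by rewrite x0 rmorphB !rmorphXn tz -!exprM !unit_rootX.
    + by rewrite x1 rmorphB rmorph1 !rmorphXn tz -!exprM !unit_rootX.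
    + by rewrite x2 rmorphB rmorph1 !rmorphXn tz -!exprM !unit_rootX.
  - exact: dvdn_div.
  - move=> t; rewrite !cosE.
    have am j : exists k, angle R N (t * j) = angle R N (t %% N * j) + 2 * pi * k%:R.
      exists (t %/ N * j)%N; rewrite {1}(divn_eq t N) /angle mulnDl !natrD !natrM.
      by field; rewrite pnatr_eq0 -lt0n.
    have chordD a k : chord2 (a + 2 * pi * k%:R) = chord2 a :> R by rewrite /chord2 cosD2pin.
    have [k1 ->] := am (r %/ g)%N; have [k2 ->] := am (s %/ g)%N.
    rewrite /logtri !chordD; congr (ln (Num.max _ _) / _).
    set a := angle _ _ _; set b := angle _ _ _.
    rewrite -(chordD (a + 2 * pi * k1%:R - (b + 2 * pi * k2%:R)) k2).
    have -> : a + 2 * pi * k1%:R - (b + 2 * pi * k2%:R) + 2 * pi * k2%:R = a - b + 2 * pi * k1%:R by ring.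
    by rewrite chordD.
have s0 : 0 <= 4 / Num.sqrt N%:R :> R by rewrite divr_ge0 ?sqrtr_ge0.
have [q pq qN] := pdivP (ltnW N2).
rewrite -[X in X - _]/(\sum_(v \in [set: rat_place]) T v).
(* Either [N] is a power of [q], and only the place of [q] may contribute, or [N] has two distinct
   prime divisors, one of which differs from the prime of any given place. *)
have [allp|nall] := pselect (forall q' : nat, prime q' -> (q' %| N)%N -> q' = q).
  have NE : N = (q ^ (logn q N).-1.+1)%N.
    rewrite prednK; last by rewrite logn_gt0 mem_primes pq N0.
    rewrite -p_part; apply/esym/part_pnat_id.
    by apply/pnatP => // q' pq' /(allp _ pq') ->; rewrite inE.
  pose P : {p : nat | prime p} := Sub q pq.
  have T0 P' : P' != P -> T (Some P') = 0.
    move=> PP; have qP : q != val P' by apply: contra PP => /eqP qP; apply/eqP/val_inj.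
    exact: (padic_sum_eq0 R zP rsN x0 x1 x2 pq qP qN).
  rewrite (@fsbigE _ _ _ _ _ [:: None; Some P]) //=; last first.
    by case=> [P'|] _; rewrite !inE //= => /negP PP; apply: T0; apply/negP => /eqP e; apply: PP; rewrite e.
  rewrite !big_cons big_nil !classical_sets.in_setT addr0 archE addrAC subrr add0r.
  have h := ln_prime_totient_le (logn q N).-1 pq; rewrite -NE in h.
  apply: le_trans h.
  exact: (padic_sum_le R iota zP gen rsN x0 x1 x2 (P := P) NE).
move: nall => /existsNP[q' /not_implyP[pq' /not_implyP[q'N /eqP q'q]]].
rewrite (@fsbigE _ _ _ _ _ [:: None]) //=; last first.
  case=> [P|] _; rewrite ?inE //= => _.
  have [qP|qP] := eqVneq q (val P).
    by rewrite qP in q'q; exact: (padic_sum_eq0 R zP rsN x0 x1 x2 pq' q'q q'N).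
  exact: (padic_sum_eq0 R zP rsN x0 x1 x2 pq qP qN).
by rewrite big_cons big_nil classical_sets.in_setT addr0 archE subrr normr0.
Qed.

End HeightApprox.

(** * Orthogonality of characters and Galois orbits *)

Section Characters.
Variable R : realType.

Definition anglez (d : nat) (k : int) : R := 2 * pi * k%:~R / d%:R.

Lemma cis_anglez (d : nat) (k : int) : (0 < d)%N ->
  cis (anglez d k) = unit_root R d ^+ `|(k %% d)%Z|%N.
Proof.
move=> d0; have dz : (d%:Z != 0) by rewrite eqz_nat -lt0n.
have mp : `|(k %% d)%Z|%N%:Z = (k %% d)%Z by rewrite gez0_abs // modz_ge0.
set m := `|_|%N in mp *.
have cper (t : R) (n : nat) : cis (t + 2 * pi * n%:R) = cis t.
  rewrite cisD; suff -> : cis (2 * pi * n%:R : R) = 1 by rewrite mulr1.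
  have -> : 2 * pi * n%:R = (pi *+ 2) *+ n :> R by rewrite -mulr_natr mulr2n; ring.
  by rewrite cisMn /cis cos2pi sin2pi; apply: expr1n.
have dR : d%:R != 0 :> R by rewrite pnatr_eq0 -lt0n.
have kE : k = (k %/ d)%Z * d%:Z + m%:Z by rewrite mp -divz_eq.
rewrite unit_rootX; set q := (k %/ d)%Z in kE.
have aE : anglez d k = angle R d m + 2 * pi * q%:~R.
  by rewrite kE /anglez /angle rmorphD rmorphM /=; field.
rewrite aE; case: q {kE aE} => n; first by rewrite cper.
by rewrite -(cper _ n.+1); congr cis; rewrite NegzE rmorphN /=; ring.
Qed.

Lemma sum_cis_anglez (d : nat) (k : int) : (0 < d)%N -> ~~ (d %| k)%Z ->
  \sum_(r < d) cis (anglez d (k * r%:Z)) = 0.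
Proof.
move=> d0 dk; have py := unit_root_prim R d0.
have yE r : cis (anglez d (k * r%:Z)) = cis (anglez d k) ^+ r.
  by rewrite -cisMn -mulr_natr; congr cis; rewrite /anglez rmorphM /=; ring.
under eq_bigr do rewrite yE.
set y := cis _.
have yU : y = unit_root R d ^+ `|(k %% d)%Z|%N by exact: cis_anglez.
have y1 : y != 1.
  rewrite yU -(prim_order_dvd py); apply: contra dk => h.
  apply/dvdz_mod0P/eqP; rewrite -absz_eq0; apply/negPn/negP => m0.
  have lt : (`|(k %% d)%Z| < d)%N.
    by rewrite -ltz_nat gez0_abs ?modz_ge0 ?eqz_nat -?lt0n // ltz_pmod.
  by move: h; rewrite gtnNdvd // lt0n.
have yd : y ^+ d = 1 by rewrite yU -exprM mulnC exprM (prim_expr_order py) expr1n.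
by apply/(mulfI (_ : y - 1 != 0)); rewrite ?subr_eq0 // mulr0 -subrX1 yd subrr.
Qed.

Lemma char_sum (d : nat) (k l : int) : (0 < d)%N ->
  ~~ ((d %| k)%Z && (d %| l)%Z) ->
  \sum_(r < d) \sum_(s < d) cos (anglez d (k * r%:Z + l * s%:Z)) = 0.
Proof.
move=> d0; rewrite negb_and => dkl.
transitivity (complex.Re (\sum_(r < d) \sum_(s < d)
    cis (anglez d (k * r%:Z)) * cis (anglez d (l * s%:Z)))).
  rewrite (raddf_sum (@complex.Re R : Rcomplex R -> R)) /=; apply: eq_bigr => r _.
  rewrite (raddf_sum (@complex.Re R : Rcomplex R -> R)) /=; apply: eq_bigr => s _.
  rewrite -cosD; congr cos; rewrite /anglez rmorphD /=; ring.
rewrite -big_distrlr /=; case/orP: dkl => h.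
  by rewrite (sum_cis_anglez d0 h) mul0r.
by rewrite [X in _ * X](sum_cis_anglez d0 h) mulr0.
Qed.

Lemma char_sum_le (d : nat) (k l : int) : (0 < d)%N ->
  \sum_(r < d) \sum_(s < d) cos (anglez d (k * r%:Z + l * s%:Z))
    <= ((d %| k)%Z && (d %| l)%Z)%:R * d%:R ^+ 2.
Proof.
move=> d0; case h : (_ && _); last by rewrite mul0r char_sum ?h.
rewrite mul1r; apply: (@le_trans _ _ (\sum_(r < d) \sum_(s < d) 1)).
  by apply: ler_sum => r _; apply: ler_sum => s _; apply: cos_le1.
by rewrite !sum_const_ord mulr1 expr2.
Qed.

Lemma card_mod_le (d e c : nat) : (0 < d)%N -> (e %| d)%N ->
  (\sum_(t < d | (t == c %[mod e])%N) 1 <= d %/ e)%N.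
Proof.
move=> d0 ed; have e0 := dvdn_gt0 d0 ed.
have lt (t : 'I_d) : (t %/ e < d %/ e)%N by rewrite ltn_divLR // divnK.
pose h (t : 'I_d) := Ordinal (lt t).
rewrite sum1_card -[leqRHS]card_ord.
have hinj : {in [pred t : 'I_d | (t == c %[mod e])%N] &, injective h}.
  move=> t t'; rewrite !inE => /eqP tc /eqP t'c /(congr1 val) /= q.
  by apply/val_inj; rewrite /= (divn_eq t e) (divn_eq t' e) q tc t'c.
by rewrite -(card_in_image hinj) max_card.
Qed.

Lemma sum_totient (d : nat) : \sum_(t < d | coprime t d) 1 = (totient d)%:R :> R.
Proof.
rewrite totient_count_coprime big_mkord natr_sum big_mkcond /=.
by apply: eq_bigr => t _; rewrite coprime_sym; case: coprime.
Qed.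

Lemma dvdz_mul_cofactor (d : nat) (j m : int) : (0 < d)%N -> (d %| j * m)%Z ->
  (d %/ gcdn d `|m| %| `|j|)%N.
Proof.
move=> d0; rewrite dvdzE abszM => h; set g := gcdn d `|m|.
have g0 : (0 < g)%N by rewrite gcdn_gt0 d0.
have gd : (g %| d)%N by rewrite dvdn_gcdl.
have gm : (g %| `|m|)%N by rewrite dvdn_gcdr.
rewrite -(@Gauss_dvdl _ _ (`|m| %/ g)); last first.
  by rewrite /coprime -(eqn_pmul2r g0) mul1n muln_gcdl !divnK.
by rewrite -(dvdn_pmul2r g0) divnK // -mulnA divnK.
Qed.

(** The boolean is a sign. The condition fixes [u] modulo [d / gcd (d, m)], which leaves at most
    [gcd (d, m) <= |m|] residues. *)
Lemma count_dvdz_le (d : nat) (m : int) (t : nat) (b : bool) : (0 < d)%N -> m != 0 ->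
  (\sum_(u < d | (d %| ((Posz t + (-1) ^+ b * Posz u) * m)%R)%Z) 1 <= `|m|)%N.
Proof.
move=> d0 m0; set g := gcdn d `|m|; set e := (d %/ g)%N.
have gd : (g %| d)%N by rewrite dvdn_gcdl.
have g0 : (0 < g)%N by rewrite gcdn_gt0 d0.
have ed : (e %| d)%N by exact: dvdn_div.
have de : (d %/ e <= `|m|)%N.
  by rewrite /e divnA // mulKn // dvdn_leq ?absz_gt0 // dvdn_gcdr.
pose Q (u : 'I_d) := (d %| (Posz t + (-1) ^+ b * Posz u) * m)%Z.
rewrite -[X in (X <= _)%N]/(\sum_(u < d | Q u) 1)%N.
have [u0 Qu0|noQ] := pickP Q; last by rewrite big1 // => u; rewrite noQ.
apply: leq_trans de; apply: leq_trans (card_mod_le u0 d0 ed).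
rewrite !sum1_card; apply: subset_leq_card; apply/fintype.subsetP => u.
rewrite !unfold_in => Qu; change (is_true (u == u0 %[mod e])%N).
have {}Qu : Q u := Qu; rewrite -eqz_nat -!modz_nat eqz_mod_dvd.
have h1 : (e%:Z %| Posz t + (-1) ^+ b * Posz u)%Z by exact: (dvdz_mul_cofactor d0 Qu).
have h2 : (e%:Z %| Posz t + (-1) ^+ b * Posz u0)%Z by exact: (dvdz_mul_cofactor d0 Qu0).
have := dvdz_mull ((-1) ^+ b) (rpredB h1 h2).
have -> // : (-1) ^+ b * (Posz t + (-1) ^+ b * Posz u - (Posz t + (-1) ^+ b * Posz u0)) = Posz u - Posz u0.
by case: b {Q Qu0 Qu h1 h2} => /=; rewrite ?expr1 ?expr0; ring.
Qed.

Definition orbit_avg (d : nat) (g : R -> R -> R) (r s : nat) : R :=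
  (\sum_(t < d | coprime t d) g (angle R d (t * r)) (angle R d (t * s)))
    / (totient d)%:R.

Definition mean2 (d : nat) (F : nat -> nat -> R) : R :=
  (\sum_(r < d) \sum_(s < d) F r s) / d%:R ^+ 2.

Lemma angle_anglez (d : nat) (m n : int) (t r s : nat) :
  m%:~R * angle R d (t * r) + n%:~R * angle R d (t * s) =
  anglez d (Posz t * (m * Posz r + n * Posz s)).
Proof. rewrite /angle /anglez !(rmorphM, rmorphD) /= ?natrM; ring. Qed.

(** The square expands, over pairs of units [t] and [u], into characters with frequencies
    [(t +- u) * (m, n)]. By orthogonality only those divisible by [d] survive; for each [t] and each
    sign there are at most [M] values of [u], out of [totient d]. *)
Lemma orbit_avg_char_sq (d : nat) (m n : int) (M : nat) : (0 < d)%N ->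
  (m != 0) || (n != 0) -> (`|m| <= M)%N -> (`|n| <= M)%N ->
  mean2 d (fun r s => orbit_avg d (fun x y => cos (m%:~R * x + n%:~R * y)) r s ^+ 2)
    <= M%:R / (totient d)%:R.
Proof.
move=> d0 mn0 mM nM.
have t0 : 0 < (totient d)%:R :> R by rewrite ltr0n totient_gt0.
have dd : 0 < d%:R ^+ 2 :> R by rewrite exprn_gt0 // ltr0n.
rewrite /mean2 ler_pdivrMr //.
pose th (t r s : nat) := anglez d (Posz t * (m * Posz r + n * Posz s)).
pose sg (b : bool) (t u : nat) : int := (Posz t + (-1) ^+ b * Posz u)%R.
have sqE r s : orbit_avg d (fun x y => cos (m%:~R * x + n%:~R * y)) r s ^+ 2 =
    ((totient d)%:R ^+ 2)^-1 * 2^-1 * \sum_(b : bool) \sum_(t < d | coprime t d)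
      \sum_(u < d | coprime u d) cos (anglez d (sg b t u * m * Posz r + sg b t u * n * Posz s)).
  rewrite /orbit_avg expr_div_n mulrC -mulrA; congr (_ * _).
  under eq_bigr do rewrite angle_anglez.
  rewrite expr2 big_distrlr /= exchange_big /= [X in _ = _ * X]exchange_big /= mulr_sumr.
  rewrite exchange_big /=; apply: eq_bigr => t _.
  rewrite exchange_big /= mulr_sumr; apply: eq_bigr => u _.
  rewrite big_bool /= -!/(th _ _ _).
  have e1 : anglez d (sg true t u * m * Posz r + sg true t u * n * Posz s) = th t r s - th u r s.
    by rewrite /sg /th /anglez expr1 !(rmorphM, rmorphD, rmorphN) /=; ring.
  have e0 : anglez d (sg false t u * m * Posz r + sg false t u * n * Posz s) = th t r s + th u r s.
    by rewrite /sg /th /anglez expr0 !(rmorphM, rmorphD, rmorphN) /=; ring.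
  by rewrite e1 e0 cosB cosD; field.
pose c := ((totient d)%:R ^+ 2)^-1 * 2^-1 : R.
have c0 : 0 <= c by rewrite mulr_ge0 ?invr_ge0 ?exprn_ge0.
have -> : \sum_(r < d) \sum_(s < d) orbit_avg d (fun x y => cos (m%:~R * x + n%:~R * y)) r s ^+ 2 =
   c * \sum_(b : bool) \sum_(t < d | coprime t d) \sum_(u < d | coprime u d)
     \sum_(r < d) \sum_(s < d) cos (anglez d (sg b t u * m * Posz r + sg b t u * n * Posz s)).
  rewrite mulr_sumr.
  transitivity (\sum_(r < d) \sum_(s < d) \sum_(b : bool) \sum_(t < d | coprime t d)
      \sum_(u < d | coprime u d) c * cos (anglez d (sg b t u * m * Posz r + sg b t u * n * Posz s))).
    apply: eq_bigr => r _; apply: eq_bigr => s _; rewrite sqE mulr_sumr.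
    apply: eq_bigr => b _; rewrite mulr_sumr; apply: eq_bigr => t _.
    by rewrite mulr_sumr.
  under eq_bigr do rewrite exchange_big /=.
  rewrite exchange_big /=; apply: eq_bigr => b _.
  rewrite mulr_sumr; under eq_bigr do rewrite exchange_big /=.
  rewrite exchange_big /=; apply: eq_bigr => t _.
  rewrite mulr_sumr; under eq_bigr do rewrite exchange_big /=.
  rewrite exchange_big /=; apply: eq_bigr => u _.
  rewrite mulr_sumr; apply: eq_bigr => r _.
  by rewrite mulr_sumr.
have bound b (t : 'I_d) : \sum_(u < d | coprime u d) \sum_(r < d) \sum_(s < d)
    cos (anglez d (sg b t u * m * Posz r + sg b t u * n * Posz s)) <= M%:R * d%:R ^+ 2.
  apply: (@le_trans _ _ (\sum_(u < d) ((d %| sg b t u * m)%Z && (d %| sg b t u * n)%Z)%:R * d%:R ^+ 2)).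
    rewrite big_mkcond /=; apply: ler_sum => u _.
    case: ifP => _; first exact: char_sum_le.
    by rewrite mulr_ge0 // ltW.
  rewrite -mulr_suml ler_pM2r // -natr_sum ler_nat.
  case/orP: mn0 => h; [apply: leq_trans mM|apply: leq_trans nM];
    apply: leq_trans (count_dvdz_le t b d0 h); rewrite [leqRHS]big_mkcond /=;
    apply: leq_sum => u _; rewrite /sg; do 2 case: (_ %| _)%Z => //.
apply: (@le_trans _ _ (c * \sum_(b : bool) \sum_(t < d | coprime t d) M%:R * d%:R ^+ 2)).
  rewrite ler_wpM2l //; apply: ler_sum => b _; apply: ler_sum => t _; exact: bound.
rewrite big_bool /=.
have -> : \sum_(t < d | coprime t d) M%:R * d%:R ^+ 2 = (totient d)%:R * (M%:R * d%:R ^+ 2) :> R.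
  by rewrite -sum_totient mulr_suml; under [RHS]eq_bigr do rewrite mul1r.
rewrite le_eqVlt; apply/orP; left; apply/eqP; rewrite /c; field.
by rewrite gt_eqF.
Qed.

(** The difference of the squares is the variance of [|F|]. *)
Lemma mean2_cauchy_schwarz (d : nat) (F : nat -> nat -> R) : (0 < d)%N ->
  mean2 d (fun r s => `|F r s|) <= Num.sqrt (mean2 d (fun r s => F r s ^+ 2)).
Proof.
move=> d0; set m := mean2 d (fun r s => `|F r s|); set q := mean2 d _.
have dd : 0 < d%:R ^+ 2 :> R by rewrite exprn_gt0 // ltr0n.
have m0 : 0 <= m.
  by rewrite divr_ge0 ?(ltW dd) // sumr_ge0 // => r _; rewrite sumr_ge0.
rewrite -[m]ger0_norm // -sqrtr_sqr ler_wsqrtr // -subr_ge0.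
have -> : q - m ^+ 2 = mean2 d (fun r s => (`|F r s| - m) ^+ 2).
  rewrite /mean2; have -> : \sum_(r < d) \sum_(s < d) (`|F r s| - m) ^+ 2 =
     \sum_(r < d) \sum_(s < d) F r s ^+ 2 - 2 * m * (\sum_(r < d) \sum_(s < d) `|F r s|)
       + d%:R ^+ 2 * m ^+ 2.
    have -> : d%:R ^+ 2 * m ^+ 2 = \sum_(r < d) \sum_(s < d) m ^+ 2 by rewrite !sum_const_ord mulrA.
    rewrite mulr_sumr -sumrB -big_split; apply: eq_bigr => r _.
    rewrite /= mulr_sumr -sumrB -big_split; apply: eq_bigr => s _ /=.
    by rewrite sqrrB real_normK ?num_real //; ring.
  have -> : \sum_(r < d) \sum_(s < d) `|F r s| = m * d%:R ^+ 2 by rewrite /m /mean2 divfK // gt_eqF.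
  rewrite /q /mean2; field; by rewrite pnatr_eq0 -lt0n.
by rewrite divr_ge0 ?(ltW dd) // sumr_ge0 // => r _; rewrite sumr_ge0 // => s _; rewrite sqr_ge0.
Qed.

End Characters.

(** If [totient d < M], each prime power component of [d] is at most twice its own totient, hence at
    most [2 * M]. All of them divide [(2 * M)!], and so does [d]. *)
Lemma totient_unbounded (M : nat) : exists D, forall d, (D <= d)%N -> (M <= totient d)%N.
Proof.
exists ((2 * M)`!).+1 => d hd; rewrite leqNgt; apply/negP => lt.
have d0 : (0 < d)%N by apply: leq_ltn_trans hd.
suff : (d %| (2 * M)`!)%N by move/(dvdn_leq (fact_gt0 _)); rewrite leqNgt hd.
apply/dvdn_partP => // p; rewrite mem_primes => /and3P[pp _ pd].
apply: dvdn_fact; rewrite part_gt0 /=.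
have tE : totient d = (totient d`_p * totient d`_p^')%N.
  by rewrite -totient_coprime ?partnC // coprime_partC.
have tp : (d`_p <= 2 * totient d`_p)%N.
  have k0 : (0 < logn p d)%N by rewrite logn_gt0 mem_primes pp d0.
  rewrite p_part totient_pfactor // -[X in (p ^ X <= _)%N](prednK k0) expnSr.
  have := prime_gt1 pp; nia.
apply: leq_trans tp _; rewrite leq_mul2l /=; apply: leq_trans (ltnW lt).
by rewrite tE leq_pmulr // totient_gt0 part_gt0.
Qed.

(** * Trigonometric polynomials and equidistribution *)

Section TrigPolynomials.
Variable R : realType.

Definition trig_poly (g : R -> R -> R) := exists l : seq (R * (int * int)),
  forall x y, g x y = \sum_(i <- l) i.1 * cos (i.2.1%:~R * x + i.2.2%:~R * y).

Lemma trig_poly_cos (c : R) (m n : int) :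
  trig_poly (fun x y => c * cos (m%:~R * x + n%:~R * y)).
Proof. by exists [:: (c, (m, n))] => x y; rewrite big_seq1. Qed.

Lemma trig_polyD g h : trig_poly g -> trig_poly h -> trig_poly (fun x y => g x y + h x y).
Proof. by move=> [l gl] [l' hl]; exists (l ++ l') => x y; rewrite big_cat /= gl hl. Qed.

Lemma trig_poly_ext g h : (forall x y, g x y = h x y) -> trig_poly g -> trig_poly h.
Proof. by move=> e [l gl]; exists l => x y; rewrite -e. Qed.

Lemma trig_poly_const c : trig_poly (fun _ _ => c).
Proof.
apply: trig_poly_ext (trig_poly_cos c 0 0) => x y.
by rewrite !mulr0z !mul0r addr0 cos0 mulr1.
Qed.

Lemma trig_polyM g h : trig_poly g -> trig_poly h -> trig_poly (fun x y => g x y * h x y).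
Proof.
move=> [l gl] [l' hl].
suff H : trig_poly (fun x y => (\sum_(i <- l) i.1 * cos (i.2.1%:~R * x + i.2.2%:~R * y))
    * (\sum_(i <- l') i.1 * cos (i.2.1%:~R * x + i.2.2%:~R * y))).
  by apply: trig_poly_ext H => x y; rewrite gl hl.
elim: l {gl} => [|[a [m n]] l IH].
  by apply: trig_poly_ext (trig_poly_const 0) => x y; rewrite big_nil mul0r.
suff H : trig_poly (fun x y => a * cos (m%:~R * x + n%:~R * y)
    * (\sum_(i <- l') i.1 * cos (i.2.1%:~R * x + i.2.2%:~R * y))).
  by apply: trig_poly_ext (trig_polyD H IH) => x y; rewrite big_cons mulrDl.
elim: l' {hl IH} => [|[b [m' n']] l' IH].
  by apply: trig_poly_ext (trig_poly_const 0) => x y; rewrite big_nil mulr0.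
have H := trig_polyD (trig_poly_cos (a * b / 2) (m + m') (n + n'))
   (trig_poly_cos (a * b / 2) (m - m') (n - n')).
apply: trig_poly_ext (trig_polyD H IH) => x y; rewrite big_cons mulrDr; congr (_ + _).
rewrite /= !(intrD, intrN).
have -> : (m%:~R + m'%:~R) * x + (n%:~R + n'%:~R) * y =
  (m%:~R * x + n%:~R * y) + (m'%:~R * x + n'%:~R * y) by ring.
have -> : (m%:~R - m'%:~R) * x + (n%:~R - n'%:~R) * y =
  (m%:~R * x + n%:~R * y) - (m'%:~R * x + n'%:~R * y) by ring.
by rewrite cosD cosB; field.
Qed.

Lemma trig_polyX g n : trig_poly g -> trig_poly (fun x y => g x y ^+ n).
Proof.
move=> tg; elim: n => [|n IH]; first exact: trig_poly_const 1.
by apply: trig_poly_ext (trig_polyM tg IH) => x y; rewrite exprS.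
Qed.

Lemma trig_poly_horner (p : {poly R}) g : trig_poly g -> trig_poly (fun x y => p.[g x y]).
Proof.
move=> tg; elim/poly_ind: p => [|p c IH].
  by apply: trig_poly_ext (trig_poly_const 0) => x y; rewrite horner0.
apply: trig_poly_ext (trig_polyD (trig_polyM IH tg) (trig_poly_const c)) => x y.
by rewrite hornerMXaddC.
Qed.

Lemma trig_poly_chord (m n : int) :
  trig_poly (fun x y => chord2 (m%:~R * x + n%:~R * y)).
Proof.
apply: trig_poly_ext (trig_polyD (trig_poly_const 2) (trig_poly_cos (-2) m n)) => x y.
by rewrite /chord2; ring.
Qed.

Lemma ler_mean2 d (F G : nat -> nat -> R) :
  (forall r s, (r < d)%N -> (s < d)%N -> F r s <= G r s) -> mean2 d F <= mean2 d G.
Proof.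
move=> FG; rewrite ler_wpM2r ?invr_ge0 ?exprn_ge0 //.
by apply: ler_sum => r _; apply: ler_sum => s _; apply: FG.
Qed.

Lemma mean2D d (F G : nat -> nat -> R) :
  mean2 d (fun r s => F r s + G r s) = mean2 d F + mean2 d G.
Proof.
rewrite /mean2 -mulrDl -big_split; congr (_ / _); apply: eq_bigr => r _.
by rewrite /= big_split.
Qed.

Lemma mean2N d (F : nat -> nat -> R) : mean2 d (fun r s => - F r s) = - mean2 d F.
Proof.
rewrite /mean2 -mulNr -sumrN; congr (_ / _); apply: eq_bigr => r _.
by rewrite sumrN.
Qed.

Lemma mean2Z d c (F : nat -> nat -> R) : mean2 d (fun r s => c * F r s) = c * mean2 d F.
Proof.
rewrite /mean2 mulrA mulr_sumr; congr (_ / _); apply: eq_bigr => r _.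
by rewrite mulr_sumr.
Qed.

Lemma mean2_const d (c : R) : (0 < d)%N -> mean2 d (fun _ _ => c) = c.
Proof.
move=> d0; rewrite /mean2 !sum_const_ord; field; by rewrite pnatr_eq0 -lt0n.
Qed.

Lemma ler_norm_mean2 d (F : nat -> nat -> R) : `|mean2 d F| <= mean2 d (fun r s => `|F r s|).
Proof.
rewrite /mean2 normrM [ `|_^-1|]ger0_norm ?invr_ge0 ?exprn_ge0 //.
rewrite ler_wpM2r ?invr_ge0 ?exprn_ge0 //.
apply: le_trans (ler_norm_sum _ _ _) _; apply: ler_sum => r _.
exact: ler_norm_sum.
Qed.

Lemma mean2_triangle d (F G : nat -> nat -> R) :
  mean2 d (fun r s => `|F r s + G r s|) <=
  mean2 d (fun r s => `|F r s|) + mean2 d (fun r s => `|G r s|).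
Proof. by rewrite -mean2D; apply: ler_mean2 => r s _ _; apply: ler_normD. Qed.

Lemma orbit_avgD d g h r s :
  orbit_avg d (fun x y => g x y + h x y) r s = orbit_avg d g r s + orbit_avg d h r s :> R.
Proof. by rewrite /orbit_avg -mulrDl -big_split. Qed.

Lemma orbit_avgN d g r s :
  orbit_avg d (fun x y => - g x y) r s = - orbit_avg d g r s :> R.
Proof. by rewrite /orbit_avg -mulNr -sumrN. Qed.

Lemma orbit_avgZ d c g r s :
  orbit_avg d (fun x y => c * g x y) r s = c * orbit_avg d g r s :> R.
Proof. by rewrite /orbit_avg mulrA mulr_sumr. Qed.

Lemma orbit_avg_const d c r s : (0 < d)%N -> orbit_avg d (fun _ _ => c) r s = c :> R.
Proof.
move=> d0; rewrite /orbit_avg.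
have -> : \sum_(t < d | coprime t d) c = c * (totient d)%:R.
  by rewrite -sum_totient mulr_sumr; under [RHS]eq_bigr do rewrite mulr1.
by rewrite mulfK // pnatr_eq0 -lt0n totient_gt0.
Qed.

Definition equidistributed (g : R -> R -> R) (c : R) := forall eps, 0 < eps ->
  exists D, forall d, (D <= d)%N -> (0 < d)%N ->
    mean2 d (fun r s => `|orbit_avg d g r s - c|) <= eps.

Lemma equidistributed_char (m n : int) : (m != 0) || (n != 0) ->
  equidistributed (fun x y => cos (m%:~R * x + n%:~R * y)) 0.
Proof.
move=> mn0 e e0; pose M := maxn `|m| `|n|.
have [T hT] : exists T : nat, M%:R / e ^+ 2 < T%:R.
  by exists (Num.bound (M%:R / e ^+ 2)); apply: archi_boundP; rewrite divr_ge0 ?exprn_ge0 // ltW.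
have [D hD] := totient_unbounded T; exists D => d /hD Td d0.
have t0 : 0 < (totient d)%:R :> R by rewrite ltr0n totient_gt0.
apply: le_trans (_ : mean2 d (fun r s => `|orbit_avg d (fun x y => cos (m%:~R * x + n%:~R * y)) r s|) <= _).
  by apply: ler_mean2 => r s _ _; rewrite subr0.
apply: le_trans (mean2_cauchy_schwarz _ d0) _.
rewrite -[leRHS](ger0_norm (ltW e0)) -sqrtr_sqr ler_wsqrtr //.
apply: le_trans (@orbit_avg_char_sq _ _ _ _ M d0 mn0 (leq_maxl _ _) (leq_maxr _ _)) _.
rewrite ler_pdivrMr //; apply: ltW.
rewrite -ltr_pdivrMl ?exprn_gt0 // mulrC; apply: lt_le_trans hT _.
by rewrite ler_nat.
Qed.

(** The limit is the sum of the coefficients of frequency zero; all other characters average out. *)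
Lemma equidistributed_trig_poly g : trig_poly g -> exists c, equidistributed g c.
Proof.
move=> [l gl].
suff [c hc] : exists c, equidistributed
    (fun x y => \sum_(i <- l) i.1 * cos (i.2.1%:~R * x + i.2.2%:~R * y)) c.
  by exists c; have -> : g = fun x y => \sum_(i <- l) i.1 * cos (i.2.1%:~R * x + i.2.2%:~R * y);
    [apply/funext => x; apply/funext => y|].
elim: l {gl} => [|[a [m n]] l [c IH]].
  exists 0 => e e0; exists 0%N => d _ d0.
  apply: le_trans (_ : mean2 d (fun _ _ => 0 : R) <= _); last by rewrite mean2_const // ltW.
  apply: ler_mean2 => r s _ _; rewrite subr0.
  have -> : (fun x y : R => \sum_(i <- [::]) i.1 * cos (i.2.1%:~R * x + i.2.2%:~R * y)) = fun _ _ => 0 :> R.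
    by apply/funext => x; apply/funext => y; rewrite big_nil.
  by rewrite orbit_avg_const // normr0.
pose G x y := \sum_(i <- l) i.1 * cos (i.2.1%:~R * x + i.2.2%:~R * y) : R.
have consE : (fun x y : R => \sum_(i <- (a, (m, n)) :: l) i.1 * cos (i.2.1%:~R * x + i.2.2%:~R * y)) =
    fun x y => a * cos (m%:~R * x + n%:~R * y) + G x y.
  by apply/funext => x; apply/funext => y; rewrite big_cons.
have [mn0|] := boolP ((m != 0) || (n != 0)).
  exists c => e e0; have e2 : 0 < e / 2 by lra.
  have e3 : 0 < e / 2 / (`|a| + 1) by rewrite divr_gt0 // ltr_wpDl.
  have [D1 h1] := IH _ e2; have [D2 h2] := equidistributed_char mn0 e3.
  exists (maxn D1 D2) => d; rewrite geq_max => /andP[d1 d2] d0.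
  have {}h1 := h1 d d1 d0; have {}h2 := h2 d d2 d0; rewrite consE.
  apply: le_trans (_ : mean2 d (fun r s => `|a * orbit_avg d (fun x y => cos (m%:~R * x + n%:~R * y)) r s + (orbit_avg d G r s - c)|) <= _).
    by apply: ler_mean2 => r s _ _; rewrite orbit_avgD orbit_avgZ addrA.
  apply: le_trans (mean2_triangle _ _ _) _.
  rewrite [leRHS]splitr; apply: lerD => //.
  apply: le_trans (_ : (`|a| + 1) * mean2 d (fun r s => `|orbit_avg d (fun x y => cos (m%:~R * x + n%:~R * y)) r s - 0|) <= _).
    rewrite -mean2Z; apply: ler_mean2 => r s _ _; rewrite subr0 normrM.
    by rewrite ler_wpM2r // lerDl.
  by rewrite mulrC -ler_pdivlMr // ltr_wpDl.
rewrite negb_or !negbK => /andP[/eqP m0 /eqP n0].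
exists (a + c) => e e0; have [D h] := IH _ e0; exists D => d dD d0.
apply: le_trans (h d dD d0); apply: ler_mean2 => r s _ _; rewrite consE m0 n0.
have -> : (fun x y => a * cos ((0 : int)%:~R * x + (0 : int)%:~R * y) + G x y) = fun x y => a + G x y.
  by apply/funext => x; apply/funext => y; rewrite !mulr0z !mul0r addr0 cos0 mulr1.
by rewrite orbit_avgD orbit_avg_const // opprD addrACA subrr add0r.
Qed.

Definition periodic2 (h : R -> R -> R) := forall x y (k l : nat),
  h (x + 2 * pi * k%:R) (y + 2 * pi * l%:R) = h x y.

Lemma angle_mod d k : (0 < d)%N ->
  exists q : nat, angle R d k = angle R d (k %% d) + 2 * pi * q%:R.
Proof.
move=> d0; exists (k %/ d)%N; rewrite {1}(divn_eq k d) /angle natrD natrM.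
by field; rewrite pnatr_eq0 -lt0n.
Qed.

Lemma sum_coprime_mul (d t : nat) (F : nat -> R) : (0 < d)%N -> coprime t d ->
  \sum_(r < d) F ((t * r) %% d)%N = \sum_(r < d) F r.
Proof.
move=> d0 ct.
pose h (r : 'I_d) := Ordinal (ltn_pmod (t * r) d0).
have hinj : injective h.
  have inv r : ((t ^ (totient d).-1 * ((t * r) %% d)) %% d = r %% d)%N.
    rewrite modnMmr mulnA -expnSr prednK ?totient_gt0 //.
    by rewrite -modnMml (Euler_exp_totient ct) modnMml mul1n.
  move=> r r' /(congr1 val) /= e; apply/val_inj => /=.
  have := congr1 (fun v => (t ^ (totient d).-1 * v) %% d)%N e.
  by rewrite /= !inv !modn_small.
by rewrite [RHS](reindex_inj hinj).
Qed.

(** Multiplication by a unit permutes the [d]-torsion. Hence orbit averaging preserves means and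
    does not increase the mean of the absolute value. *)
Lemma mean2_orbit (d t : nat) (h : R -> R -> R) : (0 < d)%N -> coprime t d -> periodic2 h ->
  mean2 d (fun r s => h (angle R d (t * r)) (angle R d (t * s))) =
  mean2 d (fun r s => h (angle R d r) (angle R d s)).
Proof.
move=> d0 ct hp; rewrite /mean2; congr (_ / _).
pose F r s := h (angle R d r) (angle R d s).
have modE r s : h (angle R d r) (angle R d s) = F (r %% d)%N (s %% d)%N.
  by have [q ->] := angle_mod r d0; have [q' ->] := angle_mod s d0; rewrite hp.
under eq_bigr do under eq_bigr do rewrite modE.
rewrite (sum_coprime_mul (fun r => \sum_(s < d) F r ((t * s) %% d)%N)) //.
by apply: eq_bigr => r _; rewrite (sum_coprime_mul (fun s => F r s)).
Qed.

Lemma mean2_orbit_avg (d : nat) (h : R -> R -> R) : (0 < d)%N -> periodic2 h ->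
  mean2 d (orbit_avg d h) = mean2 d (fun r s => h (angle R d r) (angle R d s)).
Proof.
move=> d0 hp.
have t0 : (totient d)%:R != 0 :> R by rewrite pnatr_eq0 -lt0n totient_gt0.
have -> : mean2 d (orbit_avg d h) = (\sum_(t < d | coprime t d)
    mean2 d (fun r s => h (angle R d (t * r)) (angle R d (t * s)))) / (totient d)%:R.
  rewrite /mean2 /orbit_avg -mulr_suml mulrAC; congr (_ / _).
  under eq_bigr do rewrite -mulr_suml exchange_big /=.
  by rewrite -mulr_suml exchange_big.
apply: (mulIf t0); rewrite divfK // -sum_totient mulr_sumr.
by apply: eq_bigr => t ct; rewrite mulr1 mean2_orbit.
Qed.

Lemma mean2_norm_orbit_avg (d : nat) (h : R -> R -> R) : (0 < d)%N -> periodic2 h ->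
  mean2 d (fun r s => `|orbit_avg d h r s|) <=
  mean2 d (fun r s => `|h (angle R d r) (angle R d s)|).
Proof.
move=> d0 hp.
have hp' : periodic2 (fun x y => `|h x y|) by move=> x y k l; rewrite hp.
rewrite -[leRHS](mean2_orbit_avg d0 hp'); apply: ler_mean2 => r s _ _.
rewrite /orbit_avg normrM [ `|_^-1|]ger0_norm ?invr_ge0 // ler_wpM2r ?invr_ge0 //.
exact: ler_norm_sum.
Qed.

Lemma cosD2piz (x : R) (k : int) : cos (x + 2 * pi * k%:~R) = cos x.
Proof.
case: k => n; first exact: cosD2pin.
rewrite -(cosD2pin _ n.+1); congr cos; rewrite NegzE rmorphN /=; ring.
Qed.

Lemma trig_poly_periodic g : trig_poly g -> periodic2 g.
Proof.
move=> [l gl] x y k k'; rewrite !gl; apply: eq_bigr => -[a [m n]] _ /=; congr (_ * _).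
rewrite -(cosD2piz (m%:~R * x + n%:~R * y) (m * Posz k + n * Posz k')); congr cos.
by rewrite !(rmorphD, rmorphM) /=; ring.
Qed.

Lemma logtri_periodic : periodic2 (@logtri R).
Proof.
move=> x y k l; rewrite /logtri.
have cD t (j : nat) : chord2 (t + 2 * pi * j%:R) = chord2 t :> R by rewrite /chord2 cosD2pin.
have -> : x + 2 * pi * k%:R - (y + 2 * pi * l%:R) = (x - y) + 2 * pi * (Posz k - Posz l)%:~R.
  by rewrite rmorphB /=; ring.
by rewrite !cD /chord2 cosD2piz.
Qed.

(* [f] is approximated in mean by trigonometric polynomials, whose Galois orbit
   averages are constant up to an error that tends to [0] in mean; the constant
   is read off from the plain averages of [f] along a subsequence. *)
Lemma equidistributed_of_approx (f : R -> R -> R) (c : R) (u : nat -> nat) :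
  periodic2 f ->
  (forall eps, 0 < eps -> exists2 g, trig_poly g & exists D, forall d,
     (D <= d)%N -> (0 < d)%N ->
     mean2 d (fun r s => `|f (angle R d r) (angle R d s) - g (angle R d r) (angle R d s)|) <= eps) ->
  (forall D, exists k0, forall k, (k0 <= k)%N -> (D <= u k)%N) ->
  (forall eps, 0 < eps -> exists k0, forall k, (k0 <= k)%N ->
     `|mean2 (u k) (fun r s => f (angle R (u k) r) (angle R (u k) s)) - c| <= eps) ->
  equidistributed f c.
Proof.
move=> fp approx ub fc e e0; have e6 : 0 < e / 6 by lra.
have [g tg [D1 h1]] := approx _ e6.
have gp := trig_poly_periodic tg.
have [cg hg] := equidistributed_trig_poly tg.
have [D2 h2] := hg _ e6; have [k3 h3] := fc _ e6.
have cgc : `|cg - c| <= e / 2.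
  have [k4 h4] := ub (maxn D1 D2).+1.
  pose k := maxn k3 k4; have uk := h4 k (leq_maxr _ _).
  have u0 : (0 < u k)%N by apply: leq_ltn_trans uk.
  have a1 := h1 (u k) (leq_trans (leq_maxl _ _) (ltnW uk)) u0.
  have a2 := h2 (u k) (leq_trans (leq_maxr _ _) (ltnW uk)) u0.
  have a3 := h3 k (leq_maxl _ _).
  have b1 := le_trans (ler_norm_mean2 _ _) a1; have b2 := le_trans (ler_norm_mean2 _ _) a2.
  rewrite mean2D mean2N in b1; rewrite mean2D mean2N mean2_const // mean2_orbit_avg // in b2.
  move: b1 b2 a3; set p := mean2 _ _; set q := mean2 _ _.
  rewrite !ler_norml; lra.
exists (maxn D1 D2) => d; rewrite geq_max => /andP[/h1 {}h1 /h2 {}h2] d0.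
have {}h1 := h1 d0; have {}h2 := h2 d0.
pose fg x y := f x y - g x y.
have fgp : periodic2 fg by move=> x y k l; rewrite /fg fp gp.
apply: le_trans (_ : mean2 d (fun r s => `|orbit_avg d fg r s + ((orbit_avg d g r s - cg) + (cg - c))|) <= _).
  apply: ler_mean2 => r s _ _; rewrite /fg orbit_avgD orbit_avgN.
  by rewrite le_eqVlt; apply/orP; left; apply/eqP; congr `|_|; ring.
apply: le_trans (mean2_triangle _ _ _) _.
have b1 := le_trans (mean2_norm_orbit_avg d0 fgp) h1.
have b2 := mean2_triangle d (fun r s => orbit_avg d g r s - cg) (fun _ _ => cg - c).
rewrite mean2_const // in b2; lra.
Qed.

End TrigPolynomials.

(** * Polynomial and Fourier approximation of the logarithm *)

Section LogApproximation.
Variable R : realType.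

Lemma mvt_bound (f df : R -> R) (a b C : R) : a <= b ->
  (forall x, a <= x <= b -> is_derive x 1 f (df x)) ->
  (forall x, a <= x <= b -> `|df x| <= C) -> `|f b - f a| <= C * (b - a).
Proof.
move=> ab fd dfC.
have [||c cab ->] := @MVT_segment R f df a b ab.
- by move=> x; rewrite in_itv /= => /andP[/ltW x1 /ltW x2]; apply: fd; rewrite x1 x2.
- apply: derivable_within_continuous => x; rewrite in_itv /= => xab.
  by have := fd x xab; case.
rewrite normrM (ger0_norm (_ : 0 <= b - a)) ?subr_ge0 // ler_wpM2r ?subr_ge0 //.
by apply: dfC; rewrite in_itv /= in cab.
Qed.

Lemma exprn_small (q eps : R) : 0 <= q -> q < 1 -> 0 < eps ->
  exists M, forall n, (M <= n)%N -> q ^+ n <= eps.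
Proof.
move=> q0 q1 e0.
have q1' : `|q| < 1 by rewrite ger0_norm.
have /cvgrPdist_le/(_ eps e0) [M _ hM] := cvg_expr q1'.
exists M => n /hM /=; rewrite sub0r normrN ger0_norm ?exprn_ge0 //.
Qed.

(** [p] is a Taylor polynomial of [ln] at [b]. The derivative of the difference is
    [(1 - t / b) ^+ M / t], uniformly small on the interval, and the difference vanishes at [b]. *)
Lemma ln_poly_approx (a b eps : R) : 0 < a -> a <= b -> 0 < eps ->
  exists p : {poly R}, forall x, a <= x <= b -> `|ln x - p.[x]| <= eps.
Proof.
move=> a0 ab e0; have b0 : 0 < b by apply: lt_le_trans ab.
have k0 : 0 < eps / (b - a + 1) * a by rewrite mulr_gt0 // divr_gt0 //; lra.
have q0 : 0 <= 1 - a / b by rewrite subr_ge0 ler_pdivrMr // mul1r.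
have q1 : 1 - a / b < 1 by rewrite ltrBlDr ltrDl divr_gt0.
have [M /(_ M (leqnn M)) hM] := exprn_small q0 q1 k0.
pose y : {poly R} := 1 - b^-1 *: 'X.
pose p : {poly R} := (ln b)%:P - \sum_(k < M) k.+1%:R^-1 *: y ^+ k.+1.
have yE x : y.[x] = 1 - x / b by rewrite !hornerE mulrC.
have dp x : p^`().[x] = b^-1 * \sum_(k < M) (1 - x / b) ^+ k.
  rewrite derivB derivC sub0r hornerN raddf_sum /= horner_sum -sumrN mulr_sumr.
  apply: eq_bigr => k _; rewrite derivZ deriv_exp /= derivB derivZ derivX -polyC1 derivC sub0r.
  rewrite hornerZ hornerMn hornerM horner_exp yE hornerN hornerZ hornerC mulr1.
  by rewrite -(mulr_natl (- b^-1 * _)) mulKf ?pnatr_eq0 // mulNr opprK.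
exists p => x /andP[ax xb].
have pb : p.[b] = ln b.
  rewrite hornerD hornerN hornerC horner_sum big1 ?subr0 // => k _.
  by rewrite hornerZ horner_exp yE divff ?gt_eqF // subrr expr0n mulr0.
have dE t : x <= t <= b -> is_derive t 1 ((@ln R) - horner p) (t^-1 - p^`().[t]).
  move=> /andP[xt _]; have t0 : 0 < t by lra.
  by apply: is_deriveB; apply: is_derive1_ln.
have := @mvt_bound ((@ln R) - horner p) (fun t => t^-1 - p^`().[t]) x b (eps / (b - a + 1)) xb dE.
rewrite !fctE /= pb subrr sub0r normrN => h.
apply: le_trans (h _) _.
  move=> t /andP[xt tb]; have t0 : 0 < t by lra.
  rewrite dp; have -> : t^-1 - b^-1 * \sum_(k < M) (1 - t / b) ^+ k = (1 - t / b) ^+ M / t.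
    have := subrX1 (1 - t / b) M; set S := \sum_(k < M) _ => hS.
    have -> : (1 - t / b) ^+ M = 1 - t / b * S.
      by rewrite -[LHS](subrK 1) hS; ring.
    by field; rewrite !gt_eqF.
  rewrite normrM normfV (gtr0_norm t0) ler_pdivrMr // normrX.
  have t1 : 0 <= 1 - t / b by rewrite subr_ge0 ler_pdivrMr // mul1r.
  rewrite (ger0_norm t1); apply: le_trans (_ : (1 - a / b) ^+ M <= _).
    have ta : a / b <= t / b by rewrite ler_pM2r ?invr_gt0 //; lra.
    by apply: lerXn2r; rewrite ?nnegrE // lerB.
  apply: le_trans hM _; rewrite ler_wpM2l ?divr_ge0 //; lra.
rewrite mulrAC ler_pdivrMr; last by lra.
rewrite ler_wpM2l //; [exact: ltW|lra].
Qed.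

Lemma sum_geometric_cos (t th : R) (M : nat) :
  (1 - 2 * cos th * t + t ^+ 2) * \sum_(k < M) cos (k.+1%:R * th) * t ^+ k =
  cos th - t - t ^+ M * cos (M.+1%:R * th) + t ^+ M.+1 * cos (M%:R * th).
Proof.
elim: M => [|M IH]; first by rewrite big_ord0 mulr0 !expr0 expr1 mul0r cos0 !mul1r; ring.
rewrite big_ord_recr /= mulrDr IH.
have -> : cos (M.+2%:R * th) = 2 * cos th * cos (M.+1%:R * th) - cos (M%:R * th).
  have -> : M.+2%:R * th = M.+1%:R * th + th by rewrite -(natr1 M.+1); ring.
  have -> : M%:R * th = M.+1%:R * th - th by rewrite -(natr1 M); ring.
  by rewrite cosD cosB; ring.
rewrite !exprS; ring.
Qed.

(* The argument of the logarithm is [|1 - q e^(i th)|^2]. *)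
Lemma ln_fourier (q th : R) (M : nat) : 0 <= q -> q < 1 ->
  `|ln (1 - 2 * cos th * q + q ^+ 2)
     + 2 * \sum_(k < M) cos (k.+1%:R * th) / k.+1%:R * q ^+ k.+1|
  <= 4 * q ^+ M / (1 - q) ^+ 2.
Proof.
move=> q0 q1; pose c := cos th.
(* The sum of [ln Q] and [P] vanishes at 0. In its derivative the geometric sum of cosines cancels
   [Q' / Q] up to terms of order [M], so the mean value theorem in [q] gives the bound. *)
pose Q : {poly R} := 1 - (2 * c) *: 'X + 'X^2.
pose P : {poly R} := \sum_(k < M) (2 * cos (k.+1%:R * th) / k.+1%:R) *: 'X^(k.+1).
have QE t : Q.[t] = 1 - 2 * c * t + t ^+ 2 by rewrite !hornerE.
have Q'E t : Q^`().[t] = - (2 * c) + 2 * t.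
  by rewrite /Q derivD derivB -polyC1 derivC derivZ derivX derivXn !hornerE /= mulr2n; ring.
have P'E t : P^`().[t] = 2 * \sum_(k < M) cos (k.+1%:R * th) * t ^+ k.
  rewrite raddf_sum /= horner_sum mulr_sumr; apply: eq_bigr => k _.
  rewrite derivZ derivXn /= hornerZ hornerMn hornerXn -(mulr_natl (t ^+ k)).
  have k0 : k.+1%:R != 0 :> R by rewrite pnatr_eq0.
  by rewrite [_ * (k.+1%:R * _)]mulrA divfK // mulrA.
have PE t : P.[t] = 2 * \sum_(k < M) cos (k.+1%:R * th) / k.+1%:R * t ^+ k.+1.
  rewrite horner_sum mulr_sumr; apply: eq_bigr => k _.
  by rewrite hornerZ hornerXn; ring.
have c1 : c <= 1 := cos_le1 th.
have Qlow t : 0 <= t -> (1 - t) ^+ 2 <= Q.[t].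
  move=> t0; rewrite QE; have : 0 <= t * (1 - c) by rewrite mulr_ge0 // subr_ge0.
  by lra.
have Qpos t : 0 <= t <= q -> 0 < Q.[t].
  move=> /andP[t0 tq]; apply: lt_le_trans (Qlow t t0).
  by rewrite exprn_gt0 // subr_gt0 (le_lt_trans tq).
have dE t : 0 <= t <= q ->
    is_derive t 1 ((@ln R \o horner Q) + horner P) (Q.[t]^-1 * Q^`().[t] + P^`().[t]).
  move=> tq; apply: is_deriveD; apply: is_derive1_comp.
  exact: is_derive1_ln (Qpos t tq).
have b1 : 0 < 1 - q by rewrite subr_gt0.
have := @mvt_bound _ (fun t => Q.[t]^-1 * Q^`().[t] + P^`().[t]) 0 q
  (4 * q ^+ M / (1 - q) ^+ 2) q0 dE.
rewrite !fctE /= !QE !PE /c => h; apply: le_trans (_ : _ <= 4 * q ^+ M / (1 - q) ^+ 2 * (q - 0)) _; last first.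
  rewrite subr0 ler_piMr // ?(ltW q1) // divr_ge0 ?exprn_ge0 ?mulr_ge0 ?exprn_ge0 //.
  exact: ltW.
move: h; rewrite !mulr0 expr0n /= subr0 addr0 ln1 add0r.
rewrite [X in _ - 2 * X]big1 ?mulr0 ?subr0; last by move=> k _; rewrite exprS mul0r mulr0.
apply=> t tq; have /andP[t0 tq'] := tq; have Qt := Qpos t tq.
rewrite Q'E P'E.
have -> : Q.[t]^-1 * (- (2 * c) + 2 * t) + 2 * (\sum_(k < M) cos (k.+1%:R * th) * t ^+ k) =
   2 * (t ^+ M.+1 * cos (M%:R * th) - t ^+ M * cos (M.+1%:R * th)) / Q.[t].
  have := sum_geometric_cos t th M; rewrite -/c -QE; set S := \sum_(k < M) _ => hS.
  have -> : t ^+ M.+1 * cos (M%:R * th) - t ^+ M * cos (M.+1%:R * th) = Q.[t] * S - c + t.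
    by rewrite hS; ring.
  by field; rewrite gt_eqF.
rewrite normrM normfV (gtr0_norm Qt).
have tM : t ^+ M <= q ^+ M by apply: lerXn2r; rewrite ?nnegrE.
have tM0 : 0 <= t ^+ M by rewrite exprn_ge0.
apply: ler_pM; rewrite ?invr_ge0 ?(ltW Qt) //; last first.
  rewrite lef_pV2 ?posrE ?exprn_gt0 //; apply: le_trans (Qlow t t0).
  by apply: lerXn2r; rewrite ?nnegrE; lra.
rewrite normrM ger0_norm //.
have : `|t ^+ M.+1 * cos (M%:R * th) - t ^+ M * cos (M.+1%:R * th)| <= t ^+ M + t ^+ M.
  apply: le_trans (ler_normB _ _) _; rewrite !normrM (ger0_norm tM0) (ger0_norm (exprn_ge0 M.+1 t0)).
  apply: lerD; last by rewrite ler_piMr // cos_max.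
  rewrite exprS mulrAC -[leRHS]mul1r; apply: ler_wpM2r => //.
  rewrite -[leRHS]mulr1; apply: ler_pM => //; first by lra.
  exact: cos_max.
lra.
Qed.

End LogApproximation.

(** * The logarithmic singularity on roots of unity *)

Section LogSingularity.
Variable R : realType.

Lemma ln_prod (I : Type) (r : seq I) (P : pred I) (F : I -> R) :
  (forall i, P i -> 0 < F i) ->
  ln (\prod_(i <- r | P i) F i) = \sum_(i <- r | P i) ln (F i).
Proof.
move=> F0; suff [_ ->] : 0 < \prod_(i <- r | P i) F i /\
  ln (\prod_(i <- r | P i) F i) = \sum_(i <- r | P i) ln (F i) by [].
elim/big_ind2 : _ => [|x a y b [x0 xa] [y0 yb]|i Pi]; first by rewrite ln1.
  by rewrite mulr_gt0 // lnM ?posrE // xa yb.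
by rewrite F0.
Qed.

Lemma chord2_normc (t : R) : chord2 t = normc (1 - cis t) ^+ 2.
Proof. by rewrite normc_1Bcis sqr_sqrtr // chord2_ge0. Qed.

Lemma normc_prod (n : nat) (F : nat -> Rcomplex R) (m : nat) :
  normc (\prod_(m <= i < n) F i) =
  \prod_(m <= i < n) normc (F i).
Proof.
apply: (big_morph (fun z : Rcomplex R => normc z)).
  by move=> x y; rewrite ComplexField.Normc.normcM.
exact: ComplexField.Normc.normc1.
Qed.

Lemma normc_real (x : R) : normc (Complex x 0) = `|x|.
Proof. by rewrite /= expr0n addr0 sqrtr_sqr. Qed.

Lemma prod_chord2 (d : nat) : (0 < d)%N ->
  \prod_(1 <= r < d) chord2 (angle R d r) = d%:R ^+ 2.
Proof.
move=> d0; have := prod_1subX (unit_root_prim R d0).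
move=> /(congr1 (fun z : Rcomplex R => normc z)).
have -> : (d%:R : Rcomplex R) = Complex d%:R 0.
  elim: d {d0} => [|d IH]; first by [].
  by rewrite -natr1 IH -[in RHS]natr1; congr Complex; rewrite /= ?addr0.
rewrite normc_real ger0_norm // normc_prod => h.
rewrite -h -prodrXl; apply: eq_bigr => r _.
by rewrite chord2_normc unit_rootX.
Qed.

Lemma chord2_gt0 (d r : nat) : (0 < r < d)%N -> 0 < chord2 (angle R d r).
Proof. by move=> rd; have := cos_lt1 (angle_bounds R rd); rewrite /chord2; lra. Qed.

(** The square of [|x - e^(i t)|]. *)
Definition quad_cos (x t : R) : R := x ^+ 2 - 2 * x * cos t + 1.

Lemma prod_quad_cos (d : nat) (x : R) : (0 < d)%N ->
  \prod_(0 <= r < d) quad_cos x (angle R d r) = (x ^+ d - 1) ^+ 2.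
Proof.
move=> d0; have h := factor_Xn_sub_1 (unit_root_prim R d0).
have cE (t : R) : Complex t 0 = GRing.in_alg (Rcomplex R) t.
  by congr Complex; rewrite ?mulr1 ?mulr0.
have {h} := congr1 (fun p : {poly Rcomplex R} => p.[GRing.in_alg (Rcomplex R) x]) h.
rewrite hornerD hornerN hornerXn hornerC.
rewrite -rmorphXn /=.
rewrite horner_prod.
move=> h.
have {h} := congr1 (fun z : Rcomplex R => normc z) h.
have -> : (x ^+ d)%:A - 1 = Complex (x ^+ d - 1) 0 :> Rcomplex R.
  by congr Complex; rewrite ?mulr1 ?mulr0 ?subr0.
rewrite normc_real normc_prod => h.
rewrite -[RHS]real_normK ?num_real // -h -prodrXl; apply: eq_bigr => r _.
rewrite hornerXsubC unit_rootX -[_%:A]cE /= sqr_sqrtr ?addr_ge0 ?sqr_ge0 //.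
rewrite sub0r sqrrN sin2cos2 /quad_cos; ring.
Qed.

Lemma quad_cos_chord2 (x t : R) : x != 0 ->
  (x - 1) ^+ 2 / x + chord2 t = quad_cos x t / x.
Proof. by move=> x0; rewrite /chord2 /quad_cos; field. Qed.

(** The cost of regularizing [ln v] at [v = 0]. *)
Definition log_gap (rho v : R) : R := ln (rho + v) - ln v.

Lemma log_gap_ge0 rho v : 0 < rho -> 0 < v -> 0 <= log_gap rho v.
Proof.
move=> r0 v0; rewrite subr_ge0 ler_ln ?posrE ?addr_gt0 // lerDr; exact: ltW.
Qed.

Lemma log_gap_le rho v v' : 0 < rho -> 0 < v' -> v' <= v -> log_gap rho v <= log_gap rho v'.
Proof.
move=> r0 v'0 vv'; have v0 : 0 < v by apply: lt_le_trans vv'.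
rewrite /log_gap -!ln_div ?posrE ?addr_gt0 // ler_ln ?posrE ?divr_gt0 ?addr_gt0 //.
rewrite !mulrDl !divff ?gt_eqF // lerD2r ler_pM2l // lef_pV2 ?posrE //.
Qed.

(** With this [rho], [rho + chord2 t] is [|x - e^(i t)|^2 / x], so both logarithms sum to closed
    forms, from the products [(x ^+ d - 1) ^+ 2] and [d ^+ 2]. For [x] near 1 the total is a small
    multiple of [d], up to a constant. *)
Lemma sum_log_gap (d : nat) (x : R) : (0 < d)%N -> 1 < x ->
  \sum_(1 <= r < d) log_gap ((x - 1) ^+ 2 / x) (chord2 (angle R d r))
  <= d.+1%:R * ln x - 2 * ln (x - 1).
Proof.
move=> d0 x1; have x0 : 0 < x by lra.
have xm : 0 < x - 1 by lra.
have N0 t : 0 < quad_cos x t.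
  rewrite /quad_cos; have := cos_le1 t; have : 0 < (x - 1) ^+ 2 by rewrite exprn_gt0.
  have -> : (x - 1) ^+ 2 = x ^+ 2 - 2 * x * 1 + 1 by ring.
  move=> h c1; have : x * cos t <= x * 1 by rewrite ler_pM2l.
  lra.
have xd : 0 < x ^+ d - 1 by rewrite subr_gt0 exprn_egt1 // -lt0n.
have s1 : \sum_(1 <= r < d) ln (chord2 (angle R d r)) = ln (d%:R ^+ 2).
  by rewrite -prod_chord2 // [LHS]big_nat [in RHS]big_nat ln_prod //; apply: chord2_gt0.
have s2 : \sum_(1 <= r < d) ln (quad_cos x (angle R d r)) <= d%:R * ln x + d%:R * ln x - 2 * ln (x - 1).
  have := prod_quad_cos x d0.
  move=> /(congr1 (@ln R)); rewrite ln_prod // lnXn // big_ltn // => h.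
  have -> : \sum_(1 <= r < d) ln (quad_cos x (angle R d r)) = ln (x ^+ d - 1) *+ 2 - ln (quad_cos x (angle R d 0)).
    by rewrite -h addrC addKr.
  have -> : quad_cos x (angle R d 0) = (x - 1) ^+ 2.
    by rewrite /quad_cos /angle mulr0 mul0r cos0; ring.
  rewrite lnXn // mulr2n [ln (x - 1) *+ 2]mulr2n.
  have : ln (x ^+ d - 1) <= d%:R * ln x.
    by rewrite mulr_natl -lnXn // ler_ln ?posrE ?exprn_gt0 // gerBl.
  lra.
have -> : \sum_(1 <= r < d) log_gap ((x - 1) ^+ 2 / x) (chord2 (angle R d r)) =
    \sum_(1 <= r < d) ln (quad_cos x (angle R d r)) - (d - 1)%:R * ln x
    - \sum_(1 <= r < d) ln (chord2 (angle R d r)).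
  have -> : (d - 1)%:R * ln x = \sum_(1 <= r < d) ln x.
    by rewrite sumr_const_nat mulr_natl.
  rewrite -!sumrB; apply: eq_bigr => r _.
  by rewrite /log_gap quad_cos_chord2 ?gt_eqF // ln_div ?posrE.
rewrite s1 natrB // mulrBl mul1r -natr1 mulrDl mul1r.
have : 0 <= ln (d%:R ^+ 2) :> R by rewrite ln_ge0 // exprn_ege1 // ler1n.
lra.
Qed.

End LogSingularity.

(** * Approximation of [logtri] in mean *)

Section Approximation.
Variable R : realType.

(** The maximum of the chords is replaced by the [n]-th root of the power sum [X], which lies
    between [m ^+ n] and [4 * (rho + m) ^+ n]. The term [rho ^+ n] keeps [X] away from 0, where a
    polynomial can replace [ln]. The gap at [m] is at most the gap at the smaller [v]. *)
Lemma logtri_approx (rho eps : R) : 0 < rho -> 0 < eps ->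
  exists2 g : R -> R -> R, trig_poly g & forall a b v,
    v = chord2 a \/ v = chord2 b -> 0 < v ->
    `|logtri a b - g a b| <= eps + log_gap rho v / 2.
Proof.
move=> r0 e0.
(* [1] is the error of the polynomial approximating [ln] and [ln 4] that of the four-term power sum;
   both are divided by [2 * n]. *)
have [n hn] : exists n : nat, (1 + ln 4) / (2 * eps) < n%:R.
  exists (Num.bound ((1 + ln 4) / (2 * eps))); apply: archi_boundP.
  by rewrite divr_ge0 ?addr_ge0 ?ln_ge0 ?mulr_ge0 ?(ltW e0) // ler1n.
have n0 : 0 < n%:R :> R.
  apply: le_lt_trans hn; rewrite divr_ge0 ?addr_ge0 ?ln_ge0 ?mulr_ge0 ?(ltW e0) // ler1n //.
have rn0 : 0 < rho ^+ n by rewrite exprn_gt0.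
have B : rho ^+ n <= rho ^+ n + 3 * 4 ^+ n by rewrite lerDl mulr_ge0 ?exprn_ge0.
have [p hp] := ln_poly_approx rn0 B ltr01.
pose X (a b : R) := rho ^+ n + (chord2 (a - b) ^+ n + (chord2 b ^+ n + chord2 a ^+ n)).
have tX : trig_poly X.
  have t1 : trig_poly (fun a b : R => chord2 (a - b)).
    by apply: trig_poly_ext (trig_poly_chord R 1 (-1)) => x y; congr chord2; rewrite !mulrN1z mulr1z; ring.
  have t2 : trig_poly (fun a b : R => chord2 b).
    by apply: trig_poly_ext (trig_poly_chord R 0 1) => x y; congr chord2; rewrite mulr0z mulr1z; ring.
  have t3 : trig_poly (fun a b : R => chord2 a).
    by apply: trig_poly_ext (trig_poly_chord R 1 0) => x y; congr chord2; rewrite mulr0z mulr1z; ring.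
  apply: trig_polyD (trig_poly_const _) (trig_polyD _ (trig_polyD _ _)); exact: trig_polyX.
exists (fun a b => (2 * n%:R)^-1 * p.[X a b]).
  exact: trig_polyM (trig_poly_const _) (trig_poly_horner p tX).
move=> a b v hv v0; rewrite /logtri; set m := Num.max _ _.
have c4 t : chord2 t <= 4 :> R by rewrite /chord2; have := cos_geN1 t; lra.
have vm : v <= m by case: hv => ->; rewrite /m !le_max lexx ?orbT.
have m0 : 0 < m by apply: lt_le_trans vm.
have le_m : [/\ chord2 (a - b) <= m, chord2 b <= m & chord2 a <= m].
  by rewrite /m !le_max !lexx ?orbT.
have [u1 u2 u3] := le_m.
have ge (t : R) := chord2_ge0 t.
have pw t : chord2 t <= m -> chord2 t ^+ n <= (rho + m) ^+ n.
  move=> h; apply: lerXn2r; rewrite ?nnegrE ?ge //; first by rewrite addr_ge0 ?ltW.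
  by apply: le_trans h _; rewrite lerDr ltW.
have Xle : X a b <= 4 * (rho + m) ^+ n.
  have : rho ^+ n <= (rho + m) ^+ n.
    by apply: lerXn2r; rewrite ?nnegrE ?(addr_ge0 (ltW r0) (ltW m0)) ?(ltW r0) // lerDl ltW.
  have := pw _ u1; have := pw _ u2; have := pw _ u3; rewrite /X; lra.
have mX : m ^+ n <= X a b.
  have p1 (t : R) : 0 <= chord2 t ^+ n by rewrite exprn_ge0 ?chord2_ge0.
  have := p1 (a - b); have := p1 a; have := p1 b; rewrite /X.
  have : [\/ m = chord2 (a - b), m = chord2 b | m = chord2 a].
    rewrite /m; case: (leP (chord2 (a - b))) => _; last by constructor 1.
    by case: (leP (chord2 b)) => _; [constructor 3|constructor 2].
  by case=> -> *; lra.
have X0 : 0 < X a b by apply: lt_le_trans mX; rewrite exprn_gt0.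
have Xin : rho ^+ n <= X a b <= rho ^+ n + 3 * 4 ^+ n.
  have p1 (t : R) : 0 <= chord2 t ^+ n by rewrite exprn_ge0 ?chord2_ge0.
  have p2 t : chord2 t ^+ n <= 4 ^+ n :> R by apply: lerXn2r; rewrite ?nnegrE ?ge.
  have := p1 (a - b); have := p1 a; have := p1 b.
  have := p2 (a - b); have := p2 a; have := p2 b; rewrite /X => *.
  by apply/andP; split; lra.
have hP := hp _ Xin.
have l1 : ln (X a b) <= ln 4 + n%:R * ln (rho + m).
  rewrite mulr_natl -lnXn ?addr_gt0 // -lnM ?posrE ?exprn_gt0 ?addr_gt0 // ler_ln ?posrE //.
  by rewrite mulr_gt0 // exprn_gt0 // addr_gt0.
have l2 : n%:R * ln m <= ln (X a b).
  by rewrite mulr_natl -lnXn // ler_ln ?posrE ?exprn_gt0.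
have l3 := log_gap_le r0 v0 vm; rewrite {1}/log_gap in l3.
have main : `|n%:R * ln m - p.[X a b]| <= 1 + ln 4 + n%:R * log_gap rho v.
  have : n%:R * (ln (rho + m) - ln m) <= n%:R * log_gap rho v by rewrite ler_pM2l.
  move: hP; rewrite !ler_norml mulrBr.
  have : 0 <= ln 4 :> R by rewrite ln_ge0 // ler1n.
  have : 0 <= n%:R * log_gap rho v by rewrite mulr_ge0 // ?log_gap_ge0 // ltW.
  lra.
have -> : ln m / 2 - (2 * n%:R)^-1 * p.[X a b] = (2 * n%:R)^-1 * (n%:R * ln m - p.[X a b]).
  by field; rewrite gt_eqF.
have n20 : 0 < 2 * n%:R :> R by rewrite mulr_gt0.
rewrite normrM gtr0_norm ?invr_gt0 // ler_pdivrMl //.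
apply: le_trans main _.
rewrite ltr_pdivrMr ?mulr_gt0 // in hn.
have -> : 2 * n%:R * (eps + log_gap rho v / 2) = n%:R * (2 * eps) + n%:R * log_gap rho v by field.
lra.
Qed.

(** The gap may be taken at either coordinate: at [r] when it is nonzero, otherwise at [s]. So only
    one-dimensional sums of gaps occur, and the single pair [(0, 0)] contributes a constant. *)
Lemma logtri_mean_approx (eps : R) : 0 < eps ->
  exists2 g : R -> R -> R, trig_poly g & exists D, forall d,
     (D <= d)%N -> (0 < d)%N ->
     mean2 d (fun r s => `|logtri (angle R d r) (angle R d s) - g (angle R d r) (angle R d s)|) <= eps.
Proof.
move=> e0; have e5 : 0 < eps / 5 by lra.
(* One fifth comes from the uniform error on the rows [r > 0], one from that on the row 0, two from
   the gaps and one from the constants in [C]. *)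
pose x := expR (eps / 5).
have x1 : 1 < x by rewrite expR_gt1.
have lnx : ln x = eps / 5 by rewrite expRK.
pose rho := (x - 1) ^+ 2 / x.
have r0 : 0 < rho by rewrite divr_gt0 ?exprn_gt0 ?subr_gt0 //; lra.
have [g tg hg] := logtri_approx r0 e5.
exists g => //.
pose C := `|logtri 0 0 - g 0 0| + 2 * `|ln (x - 1)|.
have C0 : 0 <= C by rewrite addr_ge0 // mulr_ge0.
have [D hD] : exists D : nat, C / (eps / 5) < D%:R.
  by exists (Num.bound (C / (eps / 5))); apply: archi_boundP; rewrite divr_ge0 // ltW.
exists D => d Dd d0.
have d0' : 0 < d%:R :> R by rewrite ltr0n.
have d1 : 1 <= d%:R :> R by rewrite ler1n.
have Cd : C <= (eps / 5) * d%:R.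
  rewrite mulrC -ler_pdivrMr //; apply: ltW; apply: lt_le_trans hD _.
  by rewrite ler_nat.
rewrite /mean2 ler_pdivrMr ?exprn_gt0 //.
pose F r s := `|logtri (angle R d r) (angle R d s) - g (angle R d r) (angle R d s)|.
pose G r := log_gap rho (chord2 (angle R d r)).
rewrite -[X in X <= _](big_mkord xpredT (fun r => \sum_(s < d) F r s)) big_ltn //.
have F00 : F 0%N 0%N = `|logtri 0 0 - g 0 0| by rewrite /F /angle mulr0 mul0r.
have row0 : \sum_(s < d) F 0%N s <= `|logtri 0 0 - g 0 0| + d%:R * (eps / 5) + (\sum_(1 <= s < d) G s) / 2.
  rewrite -(big_mkord xpredT (fun s => F 0%N s)) big_ltn // F00 -addrA lerD2l.
  have -> : d%:R * (eps / 5) = eps / 5 + \sum_(1 <= s < d) eps / 5.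
    rewrite sumr_const_nat -(mulr_natl (eps / 5)) natrB //; ring.
  rewrite mulr_suml -addrA -big_split /=.
  apply: le_trans (_ : \sum_(1 <= s < d) (eps / 5 + G s / 2) <= _); last by rewrite lerDr ltW.
  rewrite !big_nat; apply: ler_sum => s sd; apply: hg; last exact: chord2_gt0.
  by right.
have rows : \sum_(1 <= r < d) \sum_(s < d) F r s <= d%:R * (d%:R * (eps / 5)) + d%:R * ((\sum_(1 <= r < d) G r) / 2).
  apply: le_trans (_ : \sum_(1 <= r < d) (d%:R * (eps / 5) + d%:R * (G r / 2)) <= _).
    rewrite !big_nat; apply: ler_sum => r rd.
    rewrite -mulrDr -sum_const_ord; apply: ler_sum => s _; apply: hg; last exact: chord2_gt0.
    by left.
  rewrite big_split /=; apply: lerD; last by rewrite -mulr_sumr -mulr_suml.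
  rewrite sumr_const_nat -(mulr_natl (d%:R * (eps / 5))) ler_wpM2r ?(mulr_ge0 (ltW d0') (ltW e5)) //.
  by rewrite ler_nat leq_subr.
have SG := sum_log_gap d0 x1; rewrite -/rho lnx in SG.
set S := \sum_(1 <= r < d) G r in row0 rows SG.
have ln1 : - ln (x - 1) <= `|ln (x - 1)| by rewrite -normrN ler_norm.
have S2 : S <= d.+1%:R * (eps / 5) + 2 * `|ln (x - 1)| by lra.
have dS : d.+1%:R = d%:R + 1 :> R by rewrite natr1.
rewrite dS in S2.
apply: le_trans (lerD row0 rows) _.
have S3 : (1 + d%:R) / 2 * S <= (1 + d%:R) / 2 * ((d%:R + 1) * (eps / 5) + 2 * `|ln (x - 1)|).
  by rewrite ler_wpM2l //; lra.
have q1 : (1 + d%:R) / 2 <= d%:R :> R by lra.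
have q2 : (1 + d%:R) / 2 * (2 * `|ln (x - 1)|) <= d%:R * (2 * `|ln (x - 1)|).
  by rewrite ler_wpM2r // mulr_ge0.
have q3 : (1 + d%:R) / 2 * (d%:R + 1) * (eps / 5) <= 2 * d%:R ^+ 2 * (eps / 5).
  rewrite ler_wpM2r ?(ltW e5) //.
  have : 0 <= (d%:R - 1) * (3 * d%:R + 1) :> R by apply: mulr_ge0; lra.
  by lra.
have q4 : d%:R * (2 * `|ln (x - 1)|) + `|logtri 0 0 - g 0 0| <= d%:R * C.
  rewrite /C mulrDr addrC lerD2r ler_peMl //.
have q5 : d%:R * C <= (eps / 5) * d%:R ^+ 2.
  have : d%:R * C <= d%:R * (eps / 5 * d%:R) by rewrite ler_pM2l.
  by move=> h; apply: le_trans h _; rewrite expr2; lra.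
have q6 : d%:R * (eps / 5) <= d%:R ^+ 2 * (eps / 5).
  by rewrite ler_wpM2r ?(ltW e5) // expr2 ler_peMr // (ltW d0').
rewrite mulrDr in S3.
lra.
Qed.

End Approximation.

(** * Summation by parts and the value of [zeta 2] *)

Section Basel.
Variable R : realType.

(** Double summation by parts: [- chord2 t] is the eigenvalue of the second difference on
    [cos (a + t * k)]. It is used for a parabola, whose second difference is constant, and for the
    identity, where it vanishes. *)
Lemma abel_cos (h : R -> R) (a t : R) (n : nat) :
  chord2 t * \sum_(k < n) h k%:R * cos (a + t * k%:R) =
  h n%:R * cos (a + t * (n%:R - 1)) - h (n%:R - 1) * cos (a + t * n%:R)
  - (h 0 * cos (a - t) - h (- 1) * cos a)
  + \sum_(k < n) (2 * h k%:R - h (k%:R + 1) - h (k%:R - 1)) * cos (a + t * k%:R).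
Proof.
elim: n => [|n IH].
  by rewrite !big_ord0 mulr0 sub0r mulrN1 mulr0 !addr0 subrr.
rewrite !big_ord_recr /= mulrDr IH -(natr1 n) addrK.
have -> : cos (a + t * (n%:R + 1)) = 2 * cos t * cos (a + t * n%:R) - cos (a + t * (n%:R - 1)).
  have -> : a + t * (n%:R + 1) = (a + t * n%:R) + t by ring.
  have -> : a + t * (n%:R - 1) = (a + t * n%:R) - t by ring.
  by rewrite cosD cosB; ring.
by rewrite /chord2; ring.
Qed.

Lemma angleM (d j k : nat) : angle R d j * k%:R = angle R d (j * k).
Proof. by rewrite /angle natrM; ring. Qed.

Lemma cos_angle_full (d k : nat) : (0 < d)%N -> cos (angle R d (k * d)) = 1.
Proof.
move=> d0; have -> : angle R d (k * d) = 0 + 2 * pi * k%:R.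
  by rewrite /angle natrM; field; rewrite pnatr_eq0 -lt0n.
by rewrite cosD2pin cos0.
Qed.

Lemma sum_nat_mulB (c : R) n :
  \sum_(k < n) k%:R * (c - k%:R) = c * n%:R * (n%:R - 1) / 2 - n%:R * (n%:R - 1) * (2 * n%:R - 1) / 6.
Proof.
elim: n => [|n IH]; first by rewrite big_ord0; field.
by rewrite big_ord_recr /= IH -natr1; field.
Qed.

Lemma sum_parabola_cos (d k : nat) : (0 < k < d)%N ->
  \sum_(x < d) x%:R * (d%:R - x%:R) * cos (angle R d (k * x)) =
  - (2 * d%:R) * (chord2 (angle R d k))^-1.
Proof.
move=> kd; have d0 : (0 < d)%N by lia.
have v0 := chord2_gt0 R kd.
apply: (mulfI (lt0r_neq0 v0)).
have := abel_cos (fun x => x * (d%:R - x)) 0 (angle R d k) d.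
under eq_bigr do rewrite add0r angleM.
move=> ->; rewrite !add0r angleM cos_angle_full // cos0 subrr mulr0 !mul0r.
have -> : \sum_(x < d) (2 * (x%:R * (d%:R - x%:R)) - (x%:R + 1) * (d%:R - (x%:R + 1)) -
    (x%:R - 1) * (d%:R - (x%:R - 1))) * cos (0 + angle R d k * x%:R) = 0.
  transitivity (2 * \sum_(x < d) cos (angle R d (k * x))); last first.
    by rewrite sum_cos_angle ?mulr0 //; apply/negP => /dvdn_leq; lia.
  rewrite mulr_sumr; apply: eq_bigr => x _; rewrite add0r angleM; ring.
by field; rewrite gt_eqF.
Qed.

(** Sum the transforms of the parabola [x * (d - x)] over the nonzero frequencies: for [0 < x < d]
    the cosines add up to [-1]. *)
Lemma sum_chord2_inv (d : nat) : (0 < d)%N ->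
  \sum_(1 <= k < d) (chord2 (angle R d k))^-1 = (d%:R ^+ 2 - 1) / 12.
Proof.
move=> d0; have dn : d%:R != 0 :> R by rewrite pnatr_eq0 -lt0n.
apply: (mulfI (_ : - (2 * d%:R) != 0)); first by rewrite oppr_eq0 mulf_neq0.
rewrite mulr_sumr.
under eq_big_nat => k kd do rewrite -sum_parabola_cos //.
rewrite exchange_big /=.
transitivity (\sum_(x < d) - (x%:R * (d%:R - x%:R)) : R).
  apply: eq_bigr => x _; rewrite -mulr_sumr.
  have [x0|x0] := posnP x; first by rewrite x0 !mul0r oppr0.
  rewrite -[RHS]mulrN1; congr (_ * _); apply/eqP; rewrite -addr_eq0.
  have : ~~ (d %| x)%N by apply/negP => /dvdn_leq; have := ltn_ord x; lia.
  move=> /(sum_cos_angle R d0) s0; apply/eqP; rewrite -[RHS]s0.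
  rewrite -(big_mkord xpredT (fun k => cos (angle R d (x * k)))) big_ltn //.
  rewrite muln0 {2}/angle mulr0 mul0r cos0 addrC; congr (_ + _).
  by apply: eq_bigr => k _; rewrite mulnC.
by rewrite sumrN sum_nat_mulB; field.
Qed.

Lemma chord2_sym (d k : nat) : (k <= d)%N -> (0 < d)%N ->
  chord2 (angle R d (d - k)) = chord2 (angle R d k).
Proof.
move=> kd d0; rewrite /chord2.
have -> : angle R d (d - k) = - angle R d k + 2 * pi * 1%:R.
  by rewrite /angle natrB //; field; rewrite pnatr_eq0 -lt0n.
by rewrite cosD2pin cosN.
Qed.

Lemma half_sum_chord2_inv (n : nat) :
  \sum_(k < n) (chord2 (angle R n.*2.+1 k.+1))^-1 = ((n.*2.+1)%:R ^+ 2 - 1) / 24.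
Proof.
have := sum_chord2_inv (ltn0Sn n.*2); rewrite big_add1 /= big_mkord -addnn big_split_ord /=.
rewrite [X in _ + X](reindex_inj rev_ord_inj) /=.
set S := \sum_(i < n) _; set S' := \sum_(i < n) _.
have -> : S' = S.
  apply: eq_bigr => k _; rewrite -(chord2_sym (k := k.+1)) //; last by have := ltn_ord k; lia.
  by congr (chord2 (angle R _ _))^-1; have := ltn_ord k; lia.
by move=> h; apply: (mulfI (_ : 2 != 0 :> R)); rewrite // mulr2n mulrDl mul1r h; field.
Qed.

Lemma sin_le (x : R) : 0 <= x -> sin x <= x.
Proof.
move=> x0; have := @mvt_bound R sin cos 0 x 1 x0 (fun y _ => is_derive_sin y).
rewrite sin0 !subr0 mul1r => h; apply: le_trans (ler_norm _) (h _) => y _; exact: cos_max.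
Qed.

Lemma mul_cos_le_sin (x : R) : 0 <= x <= pi -> x * cos x <= sin x.
Proof.
move=> /andP[x0 xpi].
pose f : R -> R := sin - (id * cos); pose df (y : R) := y * sin y.
have dE (y : R) : is_derive y 1 f (df y).
  apply: is_derive_eq; rewrite /df /GRing.scale /=; ring.
have [|c cx' fE] := @MVT_segment R f df 0 x x0.
  by apply: derivable_within_continuous => y _; have := dE y; case.
move: cx' fE; rewrite in_itv /= => /andP[c0 cx]; rewrite /f !fctE /= sin0 mul0r !subr0 => fE.
rewrite -subr_ge0 fE /df !mulr_ge0 // sin_ge0_pi // c0 /=; exact: le_trans xpi.
Qed.

Lemma chord2_double (x : R) : chord2 (2 * x) = 4 * sin x ^+ 2.
Proof. by rewrite /chord2 (mulr_natl x) cos_mulr2n sin2cos2 -mulr_natl; ring. Qed.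

(** As [chord2 (2 * x)] is [4 * sin x ^+ 2], this amounts to [cos x / sin x <= 1 / x <= 1 / sin x],
    together with [1 / sin^2 = cot^2 + 1]. *)
Lemma chord2_inv_bounds (x : R) : 0 < x < pi / 2 ->
  (4 * x ^+ 2)^-1 <= (chord2 (2 * x))^-1 <= (4 * x ^+ 2)^-1 + 1 / 4.
Proof.
move=> /andP[x0 xpi]; have pi0 := pi_gt0 R.
have s0 : 0 < sin x by rewrite sin_gt0_pi // x0 /=; lra.
have c0 : 0 <= cos x by rewrite cos_ge0_pihalf //; apply/andP; split; lra.
have h1 := sin_le (ltW x0).
have h2 : x * cos x <= sin x by apply: mul_cos_le_sin; apply/andP; split; lra.
rewrite chord2_double; apply/andP; split.
  by rewrite lef_pV2 ?posrE ?mulr_gt0 ?exprn_gt0 // ler_pM2l //; apply: lerXn2r;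
    rewrite ?nnegrE ?(ltW s0) ?(ltW x0).
have -> : (4 * sin x ^+ 2)^-1 = (cos x / sin x) ^+ 2 / 4 + 1 / 4.
  have := sin2cos2 x; set s := sin x; set c := cos x => e.
  have sn : s != 0 by rewrite gt_eqF.
  have -> : (c / s) ^+ 2 / 4 + 1 / 4 = (s ^+ 2 + c ^+ 2) / (4 * s ^+ 2) by field.
  by rewrite e subrK mul1r.
rewrite lerD2r invfM mulrC ler_pM2l ?invr_gt0 // -exprVn.
apply: lerXn2r; rewrite ?nnegrE ?invr_ge0 ?(ltW x0) ?divr_ge0 ?(ltW s0) //.
by rewrite ler_pdivrMr // mulrC ler_pdivlMr // mulrC.
Qed.

Definition zeta_sum (s n : nat) : R := \sum_(k < n) (k.+1%:R ^+ s)^-1.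

Lemma chord2_inv_term (d k : nat) : (0 < k)%N -> (k.*2 < d)%N ->
  d%:R ^+ 2 / (4 * pi ^+ 2) * (k%:R ^+ 2)^-1 <= (chord2 (angle R d k))^-1
  <= d%:R ^+ 2 / (4 * pi ^+ 2) * (k%:R ^+ 2)^-1 + 1 / 4.
Proof.
move=> k0 kd; have pi0 := pi_gt0 R.
have d0 : 0 < d%:R :> R by rewrite ltr0n; lia.
have k0' : 0 < k%:R :> R by rewrite ltr0n.
have := @chord2_inv_bounds (pi * k%:R / d%:R).
have -> : 2 * (pi * k%:R / d%:R) = angle R d k by rewrite /angle; field; rewrite gt_eqF.
have -> : (4 * (pi * k%:R / d%:R) ^+ 2)^-1 = d%:R ^+ 2 / (4 * pi ^+ 2) * (k%:R ^+ 2)^-1 :> R.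
  by move: (@pi R) pi0 => p p0; field; rewrite (gt_eqF p0) (gt_eqF d0) (gt_eqF k0').
apply; rewrite divr_gt0 ?mulr_gt0 //= ltr_pdivrMr // mulrAC ltr_pdivlMr //.
by rewrite -mulrA ltr_pM2l // -natrM ltr_nat muln2.
Qed.

(** Termwise comparison with the inverse squared chords for [d = 2 n + 1], whose half sum
    [(d ^+ 2 - 1) / 24] is known. The opposite bound loses at most [1 / 4] per term, against a total
    of order [d ^+ 2]. *)
Lemma zeta_sum2_le (n : nat) : zeta_sum 2 n <= pi ^+ 2 / 6.
Proof.
have pi0 := pi_gt0 R; pose d : R := n.*2.+1%:R; have d0 : 0 < d by rewrite ltr0n.
have : d ^+ 2 / (4 * pi ^+ 2) * zeta_sum 2 n <= (d ^+ 2 - 1) / 24.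
  rewrite -half_sum_chord2_inv mulr_sumr; apply: ler_sum => k _.
  by have /andP[] := @chord2_inv_term n.*2.+1 k.+1 isT ltac:(have := ltn_ord k; lia).
have c0 : 0 < d ^+ 2 / (4 * pi ^+ 2) by rewrite divr_gt0 ?mulr_gt0 ?exprn_gt0.
rewrite -ler_pdivlMl // => /le_trans; apply.
rewrite ler_pdivrMl //; have -> : d ^+ 2 / (4 * pi ^+ 2) * (pi ^+ 2 / 6) = d ^+ 2 / 24.
  by move: (@pi R) pi0 {c0} => p p0; field; rewrite (gt_eqF p0).
lra.
Qed.

Lemma zeta_sum2_ge (n : nat) : pi ^+ 2 / 6 - pi ^+ 2 / n.+1%:R <= zeta_sum 2 n.
Proof.
have pi0 := pi_gt0 R; pose d : R := n.*2.+1%:R; have d0 : 0 < d by rewrite ltr0n.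
have : (d ^+ 2 - 1) / 24 <= d ^+ 2 / (4 * pi ^+ 2) * zeta_sum 2 n + n%:R * (1 / 4).
  rewrite -half_sum_chord2_inv /zeta_sum mulr_sumr -(sum_const_ord n (1 / 4)) -big_split /=; apply: ler_sum => k _.
  by have /andP[] := @chord2_inv_term n.*2.+1 k.+1 isT ltac:(have := ltn_ord k; lia).
have c0 : 0 < d ^+ 2 / (4 * pi ^+ 2) by rewrite divr_gt0 ?mulr_gt0 ?exprn_gt0.
rewrite -lerBlDr -ler_pdivrMl //; apply: le_trans.
rewrite ler_pdivlMl //.
have -> : d ^+ 2 / (4 * pi ^+ 2) * (pi ^+ 2 / 6 - pi ^+ 2 / n.+1%:R) = d ^+ 2 / 24 - d ^+ 2 / (4 * n.+1%:R).
  by move: (@pi R) pi0 {c0} => p p0; field; rewrite (gt_eqF p0) nat1r pnatr_eq0.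
have -> : d ^+ 2 / (4 * n.+1%:R) = n%:R + 1 / (4 * n.+1%:R).
  have -> : d = 2 * n%:R + 1 by rewrite /d -natr1 -mul2n natrM.
  by rewrite -natr1; field; rewrite nat1r pnatr_eq0.
have p0 : 0 <= 1 / (4 * n.+1%:R) :> R by rewrite divr_ge0 // mulr_ge0.
have : n = 0%N \/ 1 <= n%:R :> R by case: (posnP n) => [->|n1]; [left|right; rewrite ler1n].
case=> [n0|n1]; first by rewrite n0; lra.
by move: p0; set p := 1 / _ => p0; lra.
Qed.

Lemma zeta_series (s : nat) :
  series (fun n : nat => n.+1%:R `^ (- s%:R)) = zeta_sum s :> (nat -> R).
Proof.
apply/funext => n; rewrite /series /= big_mkord; apply: eq_bigr => k _.
by rewrite powRN powR_mulrn.
Qed.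

Lemma zeta2 : zeta (2 : R) = pi ^+ 2 / 6.
Proof.
rewrite /zeta zeta_series; apply: cvg_lim => //; apply/cvgrPdist_le => e e0.
exists (Num.bound (pi ^+ 2 / e)) => // n /= hn.
have l1 := zeta_sum2_le n; have l2 := zeta_sum2_ge n.
rewrite ger0_norm ?subr_ge0 //; apply: le_trans (_ : pi ^+ 2 / n.+1%:R <= _).
  by rewrite lerBlDl -lerBlDr.
rewrite ler_pdivrMr ?ltr0n // mulrC -ler_pdivrMr //.
apply: ltW; apply: lt_le_trans (archi_boundP _) _; first by rewrite divr_ge0 ?sqr_ge0 // ltW.
by rewrite ler_nat; apply: leq_trans hn _.
Qed.

Lemma zeta_sum3_cvg : zeta_sum 3 @ \oo --> (zeta (3 : R)).
Proof.
rewrite /zeta zeta_series; apply: nondecreasing_is_cvgn.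
  move=> m n mn; rewrite /zeta_sum -(subnKC mn) big_split_ord /= lerDl.
  by apply: sumr_ge0 => k _; rewrite invr_ge0 exprn_ge0.
exists (pi ^+ 2 / 6) => _ [n _ <-]; apply: le_trans (zeta_sum2_le n).
apply: ler_sum => k _; rewrite lef_pV2 ?posrE ?exprn_gt0 ?ltr0n //.
by rewrite ler_weXn2l // ler1n.
Qed.

Lemma eta_pi : eta R = 4 * zeta 3 / pi ^+ 2.
Proof. by rewrite /eta zeta2; have := pi_gt0 R; move: (@pi R) => p p0; field; rewrite gt_eqF. Qed.

End Basel.

(** * Triples of arcs with a given sum *)

Section TriangleSums.
Variable R : realType.
Implicit Types (d : nat).

Lemma sum_symmetric d (f : nat -> nat -> R) : (forall r s, f r s = f s r) ->
  \sum_(r < d) \sum_(s < d) f r s =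
  \sum_(s < d) f s s + 2 * \sum_(s < d) \sum_(1 <= y < d - s) f (s + y)%N s.
Proof.
move=> fC; elim: d => [|d IH]; first by rewrite !big_ord0 mulr0 addr0.
rewrite big_ord_recr /=.
under eq_bigr do rewrite big_ord_recr /=.
rewrite big_split /= IH !big_ord_recr /= subSnn [\sum_(1 <= y < 1) _]big_geq // addr0.
have -> : \sum_(s < d) \sum_(1 <= y < d.+1 - s) f (s + y)%N s =
    \sum_(s < d) \sum_(1 <= y < d - s) f (s + y)%N s + \sum_(s < d) f d s.
  rewrite -big_split; apply: eq_bigr => s _ /=; have sd := ltn_ord s.
  by rewrite subSn 1?ltnW // big_nat_recr ?subn_gt0 //= subnKC // ltnW.
under [X in _ + X + _]eq_bigr do rewrite fC.
ring.
Qed.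

Definition tri_sum d (G : nat -> nat -> nat -> R) : R :=
  \sum_(1 <= x < d) \sum_(1 <= y < d - x) G x y (d - x - y)%N.

Lemma tri_sum_swap12 d G : tri_sum d (fun x y z => G y x z) = tri_sum d G.
Proof.
have E H : tri_sum d H =
    \sum_(1 <= x < d) \sum_(1 <= y < d | (x + y < d)%N) H x y (d - x - y)%N.
  apply: eq_big_nat => x xd; rewrite (@big_nat_widen _ _ _ _ _ d) ?leq_subr //.
  by apply: eq_bigl => y; rewrite /=; lia.
rewrite !E (exchange_big_dep_nat xpredT) //=.
apply: eq_bigr => y _; apply: eq_big => x; first by rewrite addnC.
by move=> _; congr G; lia.
Qed.

Lemma tri_sum_swap23 d G : tri_sum d (fun x y z => G x z y) = tri_sum d G.
Proof.
apply: eq_big_nat => x xd; rewrite big_nat_rev /=; apply: eq_big_nat => y yd.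
by congr G; lia.
Qed.

Lemma tri_sum_rot d G : tri_sum d (fun x y z => G y z x) = tri_sum d G.
Proof. by rewrite -tri_sum_swap12 tri_sum_swap23. Qed.

Lemma tri_sumD d G H :
  tri_sum d (fun x y z => G x y z + H x y z) = tri_sum d G + tri_sum d H.
Proof. by rewrite -big_split; apply: eq_bigr => x _; rewrite -big_split. Qed.

Lemma eq_tri_sum d G H :
  (forall x y z, (0 < x)%N -> (0 < y)%N -> (0 < z)%N -> (x + y + z = d)%N -> G x y z = H x y z) ->
  tri_sum d G = tri_sum d H.
Proof.
move=> GH; apply: eq_big_nat => x xd; apply: eq_big_nat => y yd.
by apply: GH; lia.
Qed.

(* Breaks ties cyclically, so that exactly one entry of a non constant triple
   is its maximum. *)
Definition cyc_max (x y z : nat) : bool := (y <= x)%N && (z < x)%N.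

(** Exactly one rotation of a triple satisfies [cyc_max], unless its entries are equal; invariance
    of [tri_sum] under rotation merges the three cases. *)
Lemma tri_sum_max d (W : nat -> nat -> nat -> R) (l : nat -> R) :
  (forall x y z, (0 < x)%N -> (0 < y)%N -> (0 < z)%N -> (x + y + z = d)%N ->
     W x y z = l (maxn x (maxn y z))) ->
  tri_sum d W = 3 * tri_sum d (fun x y z => (cyc_max x y z)%:R * l x)
    + tri_sum d (fun x y z => ((x == y) && (y == z))%:R * l x).
Proof.
move=> Wl; pose A x y z : R := (cyc_max x y z)%:R * l x.
transitivity (tri_sum d (fun x y z => A x y z + (A y z x + (A z x y
    + ((x == y) && (y == z))%:R * l x)))).
  apply: eq_tri_sum => x y z x0 y0 z0 xyz; rewrite (Wl x y z) // /A /cyc_max.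
  have : (((y <= x) && (z < x) && (maxn x (maxn y z) == x)
      && ~~ ((z <= y) && (x < y)) && ~~ ((x <= z) && (y < z)) && ~~ ((x == y) && (y == z)))
    || ((z <= y) && (x < y) && (maxn x (maxn y z) == y)
      && ~~ ((y <= x) && (z < x)) && ~~ ((x <= z) && (y < z)) && ~~ ((x == y) && (y == z)))
    || ((x <= z) && (y < z) && (maxn x (maxn y z) == z)
      && ~~ ((y <= x) && (z < x)) && ~~ ((z <= y) && (x < y)) && ~~ ((x == y) && (y == z)))
    || ((x == y) && (y == z) && (maxn x (maxn y z) == x)
      && ~~ ((y <= x) && (z < x)) && ~~ ((z <= y) && (x < y)) && ~~ ((x <= z) && (y < z))))%N.
    by lia.
  by case/orP => [/orP[/orP[]|]|] /andP[/andP[/andP[/andP[b1 /eqP ->] /negbTE b2] /negbTE b3] /negbTE b4];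
    rewrite b1 b2 b3 b4 !mul0r mul1r ?addr0 ?add0r.
rewrite !tri_sumD (tri_sum_rot d A) -(tri_sum_rot d (fun x y z => A z x y)).
set T := tri_sum d A; set E := tri_sum d _.
change (T + (T + (T + E)) = 3 * T + E); ring.
Qed.

Lemma sum_itv_count n lo hi :
  (\sum_(1 <= y < n) (lo <= y < hi)%N = minn hi n - maxn lo 1)%N.
Proof.
elim: n => [|n IH]; first by rewrite big_geq // minn0.
have [->|n0] := posnP n; first by rewrite big_geq //; lia.
by rewrite big_nat_recr //= IH; case: (boolP (lo <= n < hi)%N); lia.
Qed.

(* Up to an error at most [1], the number of [y] such that [x] is the longest of
   the arcs [x], [y], [6 * e - x - y]. *)
Definition arc_weight (e x : nat) : R := 3 * (x - 2 * e)%:R - 4 * (x - 3 * e)%:R.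

(** The admissible [y] form an interval, empty up to [x = d / 3]. Its length grows with slope 3 up
    to [d / 2], beyond which the constraint [y < d - x] gives slope [-1]. Truncated subtraction in
    [arc_weight] encodes these two corners. *)
Lemma arc_count (e x : nat) (d := (6 * e)%N) : (0 < x < d)%N ->
  `|(\sum_(1 <= y < d - x) (cyc_max x y (d - x - y))%:R) - arc_weight e x| <= 1.
Proof.
move=> xd; rewrite -natr_sum.
have -> : (\sum_(1 <= y < d - x) cyc_max x y (d - x - y) =
    minn x.+1 (d - x) - maxn (d.+1 - x.*2) 1)%N.
  rewrite -sum_itv_count; apply: eq_big_nat => y yd; congr nat_of_bool.
  by rewrite /cyc_max; lia.
set a := (_ - maxn _ _)%N.
have [h1 h2] : (a + 4 * (x - 3 * e) <= 3 * (x - 2 * e) /\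
  3 * (x - 2 * e) <= a + 4 * (x - 3 * e) + 1)%N by rewrite /a /d in xd *; lia.
rewrite /arc_weight; 
have h1' : a%:R + 4 * (x - 3 * e)%:R <= 3 * (x - 2 * e)%:R :> R.
  by rewrite -!natrM -natrD ler_nat.
have h2' : 3 * (x - 2 * e)%:R <= a%:R + 4 * (x - 3 * e)%:R + 1 :> R.
  by rewrite addn1 in h2; rewrite -!natrM -natrD natr1 ler_nat.
by rewrite ler_norml; apply/andP; split; lra.
Qed.

Lemma arc_weight_bounds (e x : nat) : (x <= 6 * e)%N ->
  0 <= arc_weight e x <= (6 * e)%:R / 2.
Proof.
move=> xe; rewrite /arc_weight.
have h1 : (4 * (x - 3 * e) <= 3 * (x - 2 * e))%N by lia.
have h2 : (3 * (x - 2 * e) <= 4 * (x - 3 * e) + 3 * e)%N by lia.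

have h1' : 4 * (x - 3 * e)%:R <= 3 * (x - 2 * e)%:R :> R by rewrite -!natrM ler_nat.
have h2' : 3 * (x - 2 * e)%:R <= 4 * (x - 3 * e)%:R + 3 * e%:R :> R.
  by rewrite -!natrM -natrD ler_nat.
rewrite natrM.
by apply/andP; split; lra.
Qed.

End TriangleSums.

(** * Reduction of the mean to a weighted sum of chords *)

Section MeanOfLogtri.
Variable R : realType.
Implicit Types (d : nat).

Definition log_chord d k : R := ln (chord2 (angle R d k)) / 2.

Lemma chord2_mono d x y : (y <= x)%N -> (x + y <= d)%N -> (0 < d)%N ->
  chord2 (angle R d y) <= chord2 (angle R d x).
Proof.
move=> yx xyd d0; rewrite /chord2 lerD2l lerN2 ler_pM2l //.
pose a := pi * (x + y)%:R / d%:R : R; pose b := pi * (x - y)%:R / d%:R : R.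
have dn : d%:R != 0 :> R by rewrite pnatr_eq0 -lt0n.
have -> : angle R d x = a + b.
  by rewrite /angle /a /b natrD natrB //; move: (@pi R) => p; field.
have -> : angle R d y = a - b.
  by rewrite /angle /a /b natrD natrB //; move: (@pi R) => p; field.
rewrite cosD cosB -subr_ge0.
have bd k : (k <= d)%N -> 0 <= sin (pi * k%:R / d%:R : R).
  move=> kd; apply: sin_ge0_pi; rewrite divr_ge0 ?mulr_ge0 ?pi_ge0 //=.
  by rewrite ler_pdivrMr ?ltr0n // ler_wpM2l ?pi_ge0 // ler_nat.
have h1 := bd _ xyd; have h2 := bd (x - y)%N ltac:(lia).
have := mulr_ge0 h1 h2; rewrite -/a -/b; lra.
Qed.

(** The longest arc has the longest chord even when it exceeds half the circle, because two of the
    arcs never add up to more than [d]. *)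
Lemma logtri_arcs d x y z : (0 < x)%N -> (0 < y)%N -> (0 < z)%N -> (x + y + z = d)%N ->
  logtri (angle R d (x + y)) (angle R d x) = log_chord d (maxn x (maxn y z)).
Proof.
move=> x0 y0 z0 xyz; have d0 : (0 < d)%N by lia.
rewrite /logtri /log_chord; congr (ln _ / 2).
have -> : angle R d (x + y) - angle R d x = angle R d y.
  by rewrite /angle natrD; ring.
have -> : chord2 (angle R d (x + y)) = chord2 (angle R d z).
  by rewrite -(chord2_sym R (k := z)) //; [congr (chord2 (angle _ _ _)); lia|lia].
apply/le_anti/andP; split.
  have le_m k : k = x \/ k = y \/ k = z ->
      chord2 (angle R d k) <= chord2 (angle R d (maxn x (maxn y z))).
    have [-> //|km] := eqVneq k (maxn x (maxn y z)).
    by move=> h; apply: chord2_mono => //; lia.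
  by rewrite !ge_max !le_m //; lia.
rewrite !le_max; have [xm|[ym|zm]] : maxn x (maxn y z) = x \/ maxn x (maxn y z) = y
    \/ maxn x (maxn y z) = z by lia.
- by rewrite xm lexx !orbT.
- by rewrite ym lexx.
- by rewrite zm lexx !orbT.
Qed.

Lemma log_chord0 d : log_chord d 0 = 0.
Proof. by rewrite /log_chord /angle mulr0 mul0r /chord2 cos0 mulr1 subrr ln0 // mul0r. Qed.

Lemma logtri0r d y : logtri (angle R d y) 0 = log_chord d y.
Proof.
rewrite /logtri subr0 /log_chord /chord2 cos0 mulr1 subrr; congr (ln _ / 2).
by rewrite (max_r (chord2_ge0 _)) maxxx.
Qed.

Lemma logtri_diag d s : logtri (angle R d s) (angle R d s) = log_chord d s.
Proof.
rewrite /logtri subrr /log_chord {1}/chord2 cos0 mulr1 subrr; congr (ln _ / 2).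
by rewrite maxxx (max_r (chord2_ge0 _)).
Qed.

Lemma logtriC (a b : R) : logtri a b = logtri b a.
Proof.
rewrite /logtri; have -> : chord2 (b - a) = chord2 (a - b) by rewrite -opprB /chord2 cosN.
by rewrite (maxC (chord2 a)).
Qed.

Lemma sum_log_chord d : (0 < d)%N -> \sum_(1 <= k < d) log_chord d k = ln d%:R.
Proof.
move=> d0; rewrite -mulr_suml.
have -> : \sum_(1 <= k < d) ln (chord2 (angle R d k)) = ln (d%:R ^+ 2).
  by rewrite -prod_chord2 // [LHS]big_nat [in RHS]big_nat ln_prod //; apply: chord2_gt0.
by rewrite lnXn ?ltr0n // mulr2n -mulr2n -(mulr_natr (ln _)) mulfK.
Qed.

(** Since [log_chord d k <= ln 4 / 2], its absolute value is at most [ln 4 - log_chord d k], and the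
    sum of the [log_chord d k] is [ln d >= 0]. *)
Lemma sum_abs_log_chord d : (0 < d)%N ->
  \sum_(1 <= k < d) `|log_chord d k| <= d%:R * ln 4.
Proof.
move=> d0; have l4 : 0 <= ln 4 :> R by rewrite ln_ge0 // ler1n.
apply: le_trans (_ : \sum_(1 <= k < d) (ln 4 - log_chord d k) <= _).
  apply: ler_sum_nat => k kd.
  have : log_chord d k <= ln 4 / 2.
    rewrite ler_pM2r ?invr_gt0 // ler_ln ?posrE ?chord2_gt0 //.
    by rewrite /chord2; have := cos_geN1 (angle R d k); lra.
  by rewrite ler_norml => h; apply/andP; split; lra.
rewrite sumrB sum_log_chord // sumr_const_nat -(mulr_natl (ln 4)) natrB // mulrBl mul1r.
have : 0 <= ln d%:R :> R by rewrite ln_ge0 // ler1n.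
lra.
Qed.

Lemma sum_logtri (e : nat) (d := (6 * e)%N) : (0 < e)%N ->
  `|\sum_(r < d) \sum_(s < d) logtri (angle R d r) (angle R d s)
    - 6 * \sum_(1 <= x < d) arc_weight R e x * log_chord d x| <= 11 * (d%:R * ln 4).
Proof.
move=> e0; have d0 : (0 < d)%N by rewrite /d; lia.
rewrite (@sum_symmetric R d (fun r s => logtri (angle R d r) (angle R d s))); last by move=> r s; apply: logtriC.
under eq_bigr do rewrite logtri_diag.
rewrite -(big_mkord xpredT (log_chord d)) big_ltn // log_chord0 add0r.
rewrite -(big_mkord xpredT (fun s => \sum_(1 <= y < d - s) logtri (angle R d (s + y)) (angle R d s))).
rewrite [\sum_(0 <= s < d) _](big_ltn d0) subn0.
under [X in 2 * (X + _)]eq_bigr => y _ do rewrite add0n {2}/angle mulr0 mul0r logtri0r.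
pose W (x y z : nat) := logtri (angle R d (x + y)) (angle R d x).
rewrite -[X in 2 * (_ + X)]/(tri_sum d W) (@tri_sum_max R d W (log_chord d)); last exact: logtri_arcs.
set S := \sum_(1 <= k < d) log_chord d k.
set Eq := tri_sum d (fun x y z => ((x == y) && (y == z))%:R * _).
have L := sum_abs_log_chord d0; set N := \sum_(1 <= k < d) `|_| in L.
have SN : `|S| <= N by apply: ler_norm_sum.
have EN : `|Eq| <= N.
  apply: le_trans (ler_norm_sum _ _ _) _; apply: ler_sum_nat => x xd.
  rewrite -mulr_suml normrM ler_piMl // -natr_sum ger0_norm // (_ : 1 = 1%:R) // ler_nat.
  apply: leq_trans (_ : \sum_(1 <= y < d - x) (x <= y < x.+1) <= 1)%N; last by rewrite sum_itv_count; lia.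
  by apply: leq_sum => y _; case: eqP => [->|_] //=; rewrite leqnn ltnSn; case: (_ == _).
set Tm := tri_sum d _; set P := \sum_(1 <= x < d) arc_weight R e x * _.
have TN : `|Tm - P| <= N.
  rewrite /Tm /tri_sum /P -sumrB; apply: le_trans (ler_norm_sum _ _ _) _.
  apply: ler_sum_nat => x xd.
  by rewrite -mulr_suml -mulrBl normrM ler_piMl // arc_count.
(* The constant is [11 = 3 + 2 + 6]: degenerate pairs, equal arcs, and the rounding in [arc_count],
   each bounded by [N]. *)
have -> : S + 2 * (S + (3 * Tm + Eq)) - 6 * P = 3 * S + 2 * Eq + 6 * (Tm - P) by ring.
apply: le_trans (ler_normD _ _) _; apply: le_trans (lerD (ler_normD _ _) (lexx _)) _.
rewrite !normrM !normr_nat; lra.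
Qed.

End MeanOfLogtri.

(** * Evaluation of the limit mean *)

Section MeanLimit.
Variable R : realType.

(* The numerator of the Fourier coefficients of [arc_weight]. *)
Definition arc_coef (k : nat) : R := 1 - 4 * cos (angle R 2 k) + 3 * cos (angle R 3 k).

Lemma sum_hinge_cos (d a k : nat) : (0 < d)%N -> (a <= d)%N ->
  chord2 (angle R d k) * \sum_(x < d) (x - a)%:R * cos (angle R d (k * x)) =
  1 - cos (angle R d (k * a)) - (d - a)%:R * chord2 (angle R d k) / 2.
Proof.
move=> d0 ad; set t := angle R d k.
have -> : \sum_(x < d) (x - a)%:R * cos (angle R d (k * x)) =
    \sum_(y < d - a) y%:R * cos (t * a%:R + t * y%:R).
  rewrite -(big_mkord xpredT (fun x => (x - a)%:R * cos (angle R d (k * x)))).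
  rewrite (big_cat_nat (leq0n a) ad) /= big_nat_cond big1 ?add0r; last first.
    by move=> x /andP[/andP[_ xa] _]; rewrite (eqP (ltnW xa : (x - a == 0)%N)) mul0r.
  rewrite -{1}(add0n a) big_addn big_mkord; apply: eq_bigr => y _.
  by rewrite addnK /t -mulrDr -natrD angleM addnC.
have := abel_cos id (t * a%:R) t (d - a) => /= ->.
rewrite [X in _ + X]big1 => [|y _]; last by rewrite (_ : _ - _ - _ = 0) ?mul0r //; ring.
have -> : t * a%:R + t * ((d - a)%:R - 1) = t * d%:R - t by rewrite natrB //; ring.
have -> : t * a%:R + t * (d - a)%:R = t * d%:R by rewrite natrB //; ring.
have c1 : cos (t * d%:R) = 1 by rewrite angleM cos_angle_full.
have s0 : sin (t * d%:R) = 0.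
  by apply/eqP; rewrite -sqrf_eq0 sin2cos2 c1 expr1n subrr.
by rewrite (cosB (t * d%:R)) c1 s0 /t !angleM /chord2; field.
Qed.

(** The contributions of the end [x = d] cancel between the two hinges, as
    [3 * (d - 2 * e) = 4 * (d - 3 * e)]; only the corners remain, at one third and one half of the
    period. *)
Lemma sum_arc_weight_cos (e k : nat) (d := (6 * e)%N) : (0 < k < d)%N ->
  \sum_(x < d) arc_weight R e x * cos (angle R d (k * x)) =
  - arc_coef k / chord2 (angle R d k).
Proof.
move=> kd; have d0 : (0 < d)%N by lia.
have e0 : (0 < e)%N by rewrite /d in kd; lia.
have v0 := chord2_gt0 R kd.
have en : e%:R != 0 :> R by rewrite pnatr_eq0 -lt0n.
have h2 := @sum_hinge_cos d (2 * e) k d0 ltac:(rewrite /d; lia).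
have h3 := @sum_hinge_cos d (3 * e) k d0 ltac:(rewrite /d; lia).
have E3 : angle R d (k * (2 * e)) = angle R 3 k.
  by rewrite /angle /d !natrM; move: (@pi R) => p; field.
have E2 : angle R d (k * (3 * e)) = angle R 2 k.
  by rewrite /angle /d !natrM; move: (@pi R) => p; field.
have d3 : (d - 2 * e)%:R = 4 * e%:R :> R by rewrite -natrM; congr _%:R; rewrite /d; lia.
have d2 : (d - 3 * e)%:R = 3 * e%:R :> R by rewrite -natrM; congr _%:R; rewrite /d; lia.
rewrite E3 d3 in h2; rewrite E2 d2 in h3.
have -> : \sum_(x < d) arc_weight R e x * cos (angle R d (k * x)) =
    3 * \sum_(x < d) (x - 2 * e)%:R * cos (angle R d (k * x))
    - 4 * \sum_(x < d) (x - 3 * e)%:R * cos (angle R d (k * x)).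
  rewrite !mulr_sumr -sumrB; apply: eq_bigr => x _; rewrite /arc_weight; ring.
apply: (mulfI (lt0r_neq0 v0)); rewrite mulrBr !(mulrCA (chord2 _)) h2 h3 /arc_coef.
by field; rewrite gt_eqF.
Qed.

Lemma arc_coef_norm k : `|arc_coef k| <= 8.
Proof.
have h2 := cos_max (angle R 2 k); have h3 := cos_max (angle R 3 k).
by move: h2 h3; rewrite !ler_norml /arc_coef => /andP[? ?] /andP[? ?]; apply/andP; split; lra.
Qed.

Lemma cos_angle2 k : cos (angle R 2 k) = 2 * (2 %| k)%:R - 1.
Proof.
case: (boolP (2 %| k)%N) => [/dvdnP[j ->]|].
  by rewrite cos_angle_full //= mulr1n; ring.
move=> /(sum_cos_angle R (ltn0Sn 1)); rewrite !big_ord_recl big_ord0 /= muln0 muln1.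
by rewrite {1}/angle mulr0 mul0r cos0 /= mulr0n; lra.
Qed.

Lemma cos_angle3 k : cos (angle R 3 k) = (3 * (3 %| k)%:R - 1) / 2.
Proof.
case: (boolP (3 %| k)%N) => [/dvdnP[j ->]|].
  by rewrite cos_angle_full //= mulr1n; field.
move=> /(sum_cos_angle R (ltn0Sn 2)); rewrite !big_ord_recl big_ord0 /= muln0 muln1.
have -> : cos (angle R 3 (k * 2)) = cos (angle R 3 k).
  have -> : angle R 3 (k * 2) = - angle R 3 k + 2 * pi * k%:R.
    by rewrite /angle natrM; field.
  by rewrite cosD2pin cosN.
by rewrite {1}/angle mulr0 mul0r cos0 /= mulr0n; lra.
Qed.

Lemma sum_dvd2 (F : nat -> R) n :
  \sum_(k < 2 * n) (2 %| k.+1)%:R * F k.+1 = \sum_(j < n) F (2 * j.+1)%N.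
Proof.
elim: n => [|n IH]; first by rewrite muln0 !big_ord0.
have -> : (2 * n.+1 = (2 * n).+2)%N by lia.
rewrite !big_ord_recr /= IH.
have -> : (2 %| (2 * n).+1)%N = false by lia.
have -> : (2 %| (2 * n).+2)%N by lia.
by rewrite mul0r mul1r addr0; congr (_ + F _); lia.
Qed.

Lemma sum_dvd3 (F : nat -> R) n :
  \sum_(k < 3 * n) (3 %| k.+1)%:R * F k.+1 = \sum_(j < n) F (3 * j.+1)%N.
Proof.
elim: n => [|n IH]; first by rewrite muln0 !big_ord0.
have -> : (3 * n.+1 = (3 * n).+3)%N by lia.
rewrite !big_ord_recr /= IH.
have -> : (3 %| (3 * n).+1)%N = false by lia.
have -> : (3 %| (3 * n).+2)%N = false by lia.
have -> : (3 %| (3 * n).+3)%N by lia.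
by rewrite !mul0r mul1r !addr0; congr (_ + F _); lia.
Qed.

(** Stopping at [6 * n] leaves exactly [3 * n] multiples of 2 and [2 * n] multiples of 3. The
    factors come from [8 / 2 ^ 3 = 1] and [(9 / 2) / 3 ^ 3 = 1 / 6]. *)
Lemma sum_arc_coef (n : nat) :
  \sum_(k < 6 * n) arc_coef k.+1 / k.+1%:R ^+ 3 =
  7 / 2 * zeta_sum R 3 (6 * n) - zeta_sum R 3 (3 * n) + zeta_sum R 3 (2 * n) / 6.
Proof.
pose F k : R := (k%:R ^+ 3)^-1.
have -> : zeta_sum R 3 (3 * n) = 8 * \sum_(k < 6 * n) (2 %| k.+1)%:R * F k.+1.
  have -> : (6 * n = 2 * (3 * n))%N by lia.
  rewrite sum_dvd2 mulr_sumr; apply: eq_bigr => k _.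
  by rewrite /F natrM; field; rewrite nat1r pnatr_eq0.
have -> : zeta_sum R 3 (2 * n) = 27 * \sum_(k < 6 * n) (3 %| k.+1)%:R * F k.+1.
  have -> : (6 * n = 3 * (2 * n))%N by lia.
  rewrite sum_dvd3 mulr_sumr; apply: eq_bigr => k _.
  by rewrite /F natrM; field; rewrite nat1r pnatr_eq0.
rewrite /zeta_sum -[LHS]addr0 -[in RHS]addrA !mulr_sumr mulr_suml -sumrN -!big_split /= addr0.
apply: eq_bigr => k _; rewrite /arc_coef cos_angle2 cos_angle3 /F; field.
by rewrite nat1r pnatr_eq0.
Qed.

(** Up to a [log_gap], the squared chord is replaced by [x * |1 - x^-1 e^(i t)|^2], whose logarithm
    has a geometrically convergent Fourier series. *)
Lemma fourier_log_chord (x : R) (d k M : nat) : 1 < x -> (0 < k < d)%N ->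
  `|log_chord R d k - ln x / 2
    + \sum_(j < M) cos (angle R d (j.+1 * k)) / j.+1%:R * x^-1 ^+ j.+1|
  <= 2 * x^-1 ^+ M / (1 - x^-1) ^+ 2 + log_gap ((x - 1) ^+ 2 / x) (chord2 (angle R d k)) / 2.
Proof.
move=> x1 kd; have x0 : 0 < x by lra.
have v0 := chord2_gt0 R kd; set t := angle R d k in v0 *.
have q0 : 0 <= x^-1 by rewrite invr_ge0 ltW.
have q1 : x^-1 < 1 by rewrite invf_lt1.
have r0 : 0 < (x - 1) ^+ 2 / x by rewrite divr_gt0 // exprn_gt0 // subr_gt0.
have := ln_fourier t M q0 q1.
have -> : \sum_(j < M) cos (angle R d (j.+1 * k)) / j.+1%:R * x^-1 ^+ j.+1 =
    \sum_(j < M) cos (j.+1%:R * t) / j.+1%:R * x^-1 ^+ j.+1.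
  by apply: eq_bigr => j _; rewrite /t (mulrC j.+1%:R) angleM mulnC.
set S := \sum_(j < M) _.
have g0 := log_gap_ge0 r0 v0; move: g0; rewrite {1 2}/log_gap.
have -> : (x - 1) ^+ 2 / x + chord2 t = x * (1 - 2 * cos t * x^-1 + x^-1 ^+ 2).
  by rewrite /chord2; field; rewrite gt_eqF.
have p0 : 0 < 1 - 2 * cos t * x^-1 + x^-1 ^+ 2.
  rewrite -(pmulr_rgt0 _ x0).
  have -> : x * (1 - 2 * cos t * x^-1 + x^-1 ^+ 2) = (x - 1) ^+ 2 / x + chord2 t.
    by rewrite /chord2; field; rewrite gt_eqF.
  exact: addr_gt0.
rewrite lnM ?posrE // /log_chord -/t; set Q := ln (1 - _ + _).
set e := 4 * _ / _; have -> : 2 * x^-1 ^+ M / (1 - x^-1) ^+ 2 = e / 2.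
  by rewrite /e; move: (x^-1 ^+ M) ((1 - x^-1) ^+ 2)^-1 => a b; field.
move=> g0; rewrite !ler_norml => /andP[h1 h2]; apply/andP; split; lra.
Qed.

(** The weights are at most [d / 2], so the errors of [fourier_log_chord] simply add up. The
    condition [M < d] keeps every frequency nonzero modulo [d], where the transform of [arc_weight]
    is known. *)
Lemma weighted_log_chord (x : R) (e M : nat) (d := (6 * e)%N) : 1 < x -> (0 < e)%N -> (M < d)%N ->
  `|\sum_(1 <= k < d) arc_weight R e k * log_chord R d k
    - \sum_(j < M) arc_coef j.+1 / (j.+1%:R * chord2 (angle R d j.+1)) * x^-1 ^+ j.+1|
  <= d%:R ^+ 2 / 4 * ln x + d%:R ^+ 2 * (x^-1 ^+ M / (1 - x^-1) ^+ 2)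
     + d%:R / 4 * (d.+1%:R * ln x - 2 * ln (x - 1)).
Proof.
move=> x1 e0 Md; have d0 : (0 < d)%N by lia.
have q0 : 0 <= x^-1 by rewrite invr_ge0; lra.
have l0 : 0 <= ln x by rewrite ln_ge0 // ltW.
have r0 : 0 < (x - 1) ^+ 2 / x by rewrite divr_gt0 ?exprn_gt0 ?subr_gt0 //; lra.
pose w k := arc_weight R e k.
have wb k : (1 <= k < d)%N -> 0 <= w k <= d%:R / 2 by move=> kd; apply: arc_weight_bounds; lia.
pose F k := \sum_(j < M) cos (angle R d (j.+1 * k)) / j.+1%:R * x^-1 ^+ j.+1.
have FE : \sum_(1 <= k < d) w k * F k =
    - \sum_(j < M) arc_coef j.+1 / (j.+1%:R * chord2 (angle R d j.+1)) * x^-1 ^+ j.+1.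
  under eq_bigr do rewrite mulr_sumr.
  rewrite exchange_big -sumrN; apply: eq_bigr => j _ /=.
  have jd : (0 < j.+1 < d)%N by have := ltn_ord j; lia.
  have := sum_arc_weight_cos (e := e) jd.
  rewrite -(big_mkord xpredT (fun x => arc_weight R e x * cos (angle R d (j.+1 * x)))) big_ltn //.
  rewrite {1}/arc_weight !sub0n !mulr0 subrr mul0r add0r => h.
  transitivity ((\sum_(1 <= k < d) w k * cos (angle R d (j.+1 * k))) * (x^-1 ^+ j.+1 / j.+1%:R)).
    by rewrite mulr_suml; apply: eq_bigr => k _; ring.
  by rewrite h invfM; ring.
set A := \sum_(1 <= k < d) _; set B := \sum_(j < M) _ in FE *.
pose C := 2 * x^-1 ^+ M / (1 - x^-1) ^+ 2.
pose G k := log_gap ((x - 1) ^+ 2 / x) (chord2 (angle R d k)).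
have C0 : 0 <= C by apply: divr_ge0 (sqr_ge0 _); apply: mulr_ge0 (exprn_ge0 M q0).
have AB : A - B = \sum_(1 <= k < d) w k * (log_chord R d k - ln x / 2 + F k) + \sum_(1 <= k < d) w k * (ln x / 2).
  by rewrite -FE -!big_split; apply: eq_bigr => k _; rewrite /w /=; ring.
rewrite AB; apply: le_trans (ler_normD _ _) _.
have h1 : `|\sum_(1 <= k < d) w k * (log_chord R d k - ln x / 2 + F k)| <=
    d%:R / 2 * (\sum_(1 <= k < d) C + (\sum_(1 <= k < d) G k) / 2).
  rewrite mulr_suml -big_split mulr_sumr /=.
  apply: le_trans (ler_norm_sum _ _ _) _; apply: ler_sum_nat => k kd.
  have /andP[w0 w1] := wb k kd.
  by rewrite normrM (ger0_norm w0); apply: ler_pM => //; apply: fourier_log_chord.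
have h2 : `|\sum_(1 <= k < d) w k * (ln x / 2)| <= d%:R / 2 * \sum_(1 <= k < d) (ln x / 2).
  rewrite mulr_sumr; apply: le_trans (ler_norm_sum _ _ _) _; apply: ler_sum_nat => k kd.
  have /andP[w0 w1] := wb k kd.
  by rewrite ger0_norm ?mulr_ge0 ?divr_ge0 // ler_wpM2r ?divr_ge0.
apply: le_trans (lerD h1 h2) _.
have cst (c : R) : 0 <= c -> \sum_(1 <= k < d) c <= d%:R * c.
  by move=> c0; rewrite sumr_const_nat -(mulr_natl c) ler_wpM2r // ler_nat leq_subr.
have c1 := cst C C0; have c2 := cst (ln x / 2) ltac:(by rewrite divr_ge0).
have SG := sum_log_gap d0 x1; rewrite -/G in SG.
have dh : 0 <= d%:R / 2 :> R by rewrite divr_ge0.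
rewrite -mulrDr; apply: le_trans (ler_wpM2l dh (lerD (lerD c1 (ler_wpM2r _ SG)) c2)) _.
  by rewrite invr_ge0.
rewrite le_eqVlt; apply/orP; left; apply/eqP; rewrite /C.
by move: (x^-1 ^+ M) ((1 - x^-1) ^+ 2)^-1 => a b; field.
Qed.

(** Replacing each inverse squared chord by [d ^+ 2 / (4 pi ^+ 2 j ^+ 2)] costs at most [1 / 4], so
    each of the [M] terms changes by at most [(6 / d ^+ 2) * 8 / 4 <= 12 / d]. *)
Lemma fourier_sum_limit (q : R) (d M : nat) : 0 <= q <= 1 -> (M.*2 < d)%N ->
  `|6 / d%:R ^+ 2 * (\sum_(j < M) arc_coef j.+1 / (j.+1%:R * chord2 (angle R d j.+1)) * q ^+ j.+1)
    - 6 / (4 * pi ^+ 2) * \sum_(j < M) arc_coef j.+1 / j.+1%:R ^+ 3 * q ^+ j.+1|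
  <= (12 * M)%:R / d%:R.
Proof.
move=> /andP[q0 q1] Md; have d0 : 0 < d%:R :> R by rewrite ltr0n; lia.
have d1 : 1 <= d%:R :> R by rewrite ler1n; lia.
rewrite !mulr_sumr -sumrB; apply: le_trans (ler_norm_sum _ _ _) _.
have -> : (12 * M)%:R / d%:R = M%:R * (12 / d%:R) :> R by rewrite natrM; ring.
rewrite -(sum_const_ord M (12 / d%:R)); apply: ler_sum => j _.
have jd : (j.+1.*2 < d)%N by have := ltn_ord j; lia.
have /andP[b1 b2] := @chord2_inv_term R d j.+1 isT jd.
set v := (chord2 _)^-1 in b1 b2; set u := _ / _ * _ in b1 b2.
have j0 : 0 < j.+1%:R :> R by rewrite ltr0n.
have -> : 6 / d%:R ^+ 2 * (arc_coef j.+1 / (j.+1%:R * chord2 (angle R d j.+1)) * q ^+ j.+1)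
   - 6 / (4 * pi ^+ 2) * (arc_coef j.+1 / j.+1%:R ^+ 3 * q ^+ j.+1) =
   6 / d%:R ^+ 2 * (arc_coef j.+1 * (q ^+ j.+1 * j.+1%:R^-1)) * (v - u).
  rewrite (invfM j.+1%:R) -/v /u; clearbody v; clear b1 b2 u; have := pi_gt0 R; move: (@pi R) v (arc_coef _) (q ^+ _) => p v a b p0.
  move: (j.+1%:R) j0 (d%:R) d0 => {}y y0 {}z z0.
  by field; rewrite !gt_eqF.
have qb : `|q ^+ j.+1 * j.+1%:R^-1| <= 1.
  rewrite ger0_norm ?mulr_ge0 ?exprn_ge0 ?invr_ge0 // ?(ltW j0) //.
  by rewrite ler_pdivrMr // mul1r; apply: le_trans (exprn_ile1 j.+1 q0 q1) _; rewrite ler1n.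
have ab := arc_coef_norm j.+1.
have vb : `|v - u| <= 1 / 4 by rewrite ger0_norm ?subr_ge0 // lerBlDl.
have s0 : 0 <= 6 / d%:R ^+ 2 :> R by rewrite divr_ge0 // exprn_ge0.
rewrite normrM (normrM (6 / _)) (normrM (arc_coef _)) (ger0_norm s0).
apply: le_trans (_ : 6 / d%:R ^+ 2 * (8 * 1) * (1 / 4) <= _).
  apply: ler_pM (mulr_ge0 s0 (mulr_ge0 _ _)) _ _ vb => //.
  by rewrite ler_wpM2l //; apply: ler_pM.
have -> : 6 / d%:R ^+ 2 * (8 * 1) * (1 / 4) = 12 / d%:R * d%:R^-1 :> R by field; rewrite gt_eqF.
by rewrite ler_piMr ?divr_ge0 ?(ltW d0) // invf_le1.
Qed.

(** Since [1 - q ^+ j <= j * (1 - q)], one power of [j] is lost and a partial sum of [zeta 2]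
    remains; the constant is [6 / (4 pi ^+ 2) * 8 * pi ^+ 2 / 6 = 2], uniformly in [M]. *)
Lemma fourier_sum_abel (q : R) (M : nat) : 0 <= q <= 1 ->
  `|6 / (4 * pi ^+ 2) * (\sum_(j < M) arc_coef j.+1 / j.+1%:R ^+ 3 * q ^+ j.+1)
    - 6 / (4 * pi ^+ 2) * \sum_(j < M) arc_coef j.+1 / j.+1%:R ^+ 3| <= 2 * (1 - q).
Proof.
move=> /andP[q0 q1]; have pi0 := pi_gt0 R.
have c0 : 0 <= 6 / (4 * pi ^+ 2) :> R by rewrite divr_ge0 // mulr_ge0 // sqr_ge0.
rewrite -mulrBr -sumrB normrM (ger0_norm c0).
apply: le_trans (_ : 6 / (4 * pi ^+ 2) * (8 * (1 - q) * zeta_sum R 2 M) <= _).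
  apply: ler_wpM2l => //; apply: le_trans (ler_norm_sum _ _ _) _.
  rewrite mulr_sumr; apply: ler_sum => j _.
  have j0 : 0 < j.+1%:R :> R by rewrite ltr0n.
  have qn : `|q ^+ j.+1 - 1| <= j.+1%:R * (1 - q).
    rewrite ler0_norm ?subr_le0 ?exprn_ile1 // opprB.
    elim: (nat_of_ord j) => [|n IH]; first by rewrite expr1 mul1r.
    have -> : 1 - q ^+ n.+2 = (1 - q) + q * (1 - q ^+ n.+1) by rewrite exprS; ring.
    rewrite -(nat1r n.+1) mulrDl mul1r lerD2l; apply: le_trans IH.
    by rewrite ler_piMl // subr_ge0 exprn_ile1.
  have -> : arc_coef j.+1 / j.+1%:R ^+ 3 * q ^+ j.+1 - arc_coef j.+1 / j.+1%:R ^+ 3 =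
     arc_coef j.+1 * (q ^+ j.+1 - 1) / j.+1%:R ^+ 3 by ring.
  rewrite !normrM normfV (gtr0_norm (exprn_gt0 3 j0)).
  rewrite ler_pdivrMr ?exprn_gt0 //.
  have -> : 8 * (1 - q) / j.+1%:R ^+ 2 * j.+1%:R ^+ 3 = 8 * (j.+1%:R * (1 - q)) :> R.
    by move: (j.+1%:R) j0 => y y0; field; rewrite gt_eqF.
  by apply: ler_pM => //; apply: arc_coef_norm.
apply: le_trans (_ : 6 / (4 * pi ^+ 2) * (8 * (1 - q) * (pi ^+ 2 / 6)) <= _).
  apply: ler_wpM2l => //; apply: ler_wpM2l; first by rewrite mulr_ge0 // subr_ge0.
  exact: zeta_sum2_le.
rewrite le_eqVlt; apply/orP; left; apply/eqP.
by move: (@pi R) pi0 {c0} => p p0; field; rewrite gt_eqF.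
Qed.

Lemma fourier_sum_eta (eps : R) : 0 < eps -> exists m0, forall m, (m0 <= m)%N ->
  `|6 / (4 * pi ^+ 2) * (\sum_(j < 6 * m) arc_coef j.+1 / j.+1%:R ^+ 3) - eta R| <= eps.
Proof.
move=> eps0; have pi0 := pi_gt0 R.
pose c : R := 6 / (4 * pi ^+ 2); have c0 : 0 < c by rewrite divr_gt0 // mulr_gt0 // exprn_gt0.
(* The coefficients of the three partial sums satisfy [7 / 2 + 1 + 1 / 6 < 5]. *)
have e0 : 0 < eps / (5 * c) by rewrite divr_gt0 // mulr_gt0.
have /cvgrPdist_le/(_ _ e0) [m0 _ hm] := @zeta_sum3_cvg R.
exists m0 => m m0m; rewrite sum_arc_coef eta_pi.
have h6 := hm (6 * m)%N ltac:(by rewrite /=; lia).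
have h3 := hm (3 * m)%N ltac:(by rewrite /=; lia).
have h2 := hm (2 * m)%N ltac:(by rewrite /=; lia).
move: h6 h3 h2; rewrite /=; set z := zeta _; set z6 := zeta_sum _ _ _; set z3 := zeta_sum _ _ _.
set z2 := zeta_sum _ _ _ => h6 h3 h2.
have -> : 6 / (4 * pi ^+ 2) * (7 / 2 * z6 - z3 + z2 / 6) - 4 * z / pi ^+ 2 =
    c * ((z - z3) - (7 / 2 * (z - z6) + (z - z2) / 6)).
  by rewrite /c; move: (@pi R) pi0 {c c0 e0 hm h6 h3 h2} => p p0; field; rewrite gt_eqF.
rewrite normrM (gtr0_norm c0) -ler_pdivlMl //.
have -> : c^-1 * eps = 5 * (eps / (5 * c)) by field; rewrite gt_eqF.
move: h6 h3 h2; set t := eps / _; rewrite !ler_norml => /andP[? ?] /andP[? ?] /andP[? ?].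
by apply/andP; split; lra.
Qed.

(** The parameters are fixed in the order [x], [M], [k]: [x] near 1 makes the regularization and the
    damping harmless, [M] kills the Fourier tail, and a large [d = 6 * k] absorbs the errors of
    order [1 / d], collected in [K]. *)
Lemma mean_logtri_limit (eps : R) : 0 < eps -> exists k0, forall k, (k0 <= k)%N ->
  `|mean2 (6 * k) (fun r s => logtri (angle R (6 * k) r) (angle R (6 * k) s)) - eta R| <= eps.
Proof.
have aux (a b k : nat) : (a + b < k)%N -> (0 < k)%N /\ (b < 6 * k)%N /\ (a <= 6 * k)%N.
  by lia.
move=> eps0; pose dl := eps / 28; have dl0 : 0 < dl by rewrite divr_gt0.
pose x := expR dl; have x1 : 1 < x by rewrite expR_gt1.
have lnx : ln x = dl by rewrite expRK.
have x0 : 0 < x by rewrite expR_gt0.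
have q0 : 0 <= x^-1 by rewrite invr_ge0 ltW.
have q1 : x^-1 < 1 by rewrite invf_lt1.
have qd : 1 - x^-1 <= dl.
  have := expR_ge1Dx (- dl); rewrite expRN -/x; lra.
have b0 : 0 < (1 - x^-1) ^+ 2 by rewrite exprn_gt0 // subr_gt0.
have [m1 hm1] := @exprn_small R x^-1 (eps / 48 * (1 - x^-1) ^+ 2) q0 q1 ltac:(by rewrite mulr_gt0 // divr_gt0).
have [m2 hm2] := fourier_sum_eta (divr_gt0 eps0 (ltr0n R 8)).
pose m := maxn m1 m2; pose M := (6 * m)%N.
pose K := 11 * ln 4 + 3 * `|ln (x - 1)| + (12 * M)%:R + 2 * dl.
have l4 : 0 <= ln 4 :> R by rewrite ln_ge0 // ler1n.
have K0 : 0 <= K by have := normr_ge0 (ln (x - 1)); have : 0 <= (12 * M)%:R :> R by []; rewrite /K; lra.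
pose nb := Num.bound (K / (eps / 4)); pose k0 := (nb + M.*2).+1.
exists k0 => k kk0; pose d := (6 * k)%N.
have [k1 [Md nbd]] : (0 < k)%N /\ (M.*2 < d)%N /\ (nb <= d)%N.
  exact: aux kk0.
have Md' : (M < d)%N by apply: leq_ltn_trans Md; rewrite -addnn leq_addl.
have d0' : (0 < d)%N by apply: leq_ltn_trans Md.
have d0 : 0 < d%:R :> R by rewrite ltr0n.
have d1 : 1 <= d%:R :> R by rewrite ler1n.
have d2 : 0 < d%:R ^+ 2 :> R by rewrite exprn_gt0.
have Kd : K / d%:R <= eps / 4.
  rewrite ler_pdivrMr // mulrC -ler_pdivrMr ?divr_gt0 //.
  apply: ltW; apply: lt_le_trans (archi_boundP _) _; first by rewrite divr_ge0 // divr_ge0 // ltW.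
  by rewrite ler_nat.
have E1 := @sum_logtri R k k1.
have E2 := @weighted_log_chord x k M x1 k1 Md'.
have qq : 0 <= x^-1 <= 1 by rewrite q0 ltW.
have E3 := fourier_sum_limit qq Md.
have E4 := fourier_sum_abel M qq.
have E5 := hm2 m (leq_maxr _ _).
have E6 : x^-1 ^+ M / (1 - x^-1) ^+ 2 <= eps / 48.
  by rewrite ler_pdivrMr // hm1 // /M; apply: leq_trans (leq_maxl m1 m2) _; exact: leq_pmull.
rewrite -/d in E1 E2 *; rewrite /mean2; rewrite -/M in E5.
set S := \sum_(r < d) _ in E1 *; set P := \sum_(1 <= j < d) _ in E1 E2.
set Q := \sum_(j < M) _ in E2 E3; set U := 6 / _ * _ in E3; set V := 6 / _ * _ in E3 E4; set W := 6 / _ * _ in E4 E5.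
have F1 : `|S / d%:R ^+ 2 - 6 / d%:R ^+ 2 * P| <= 11 * ln 4 / d%:R.
  have -> : S / d%:R ^+ 2 - 6 / d%:R ^+ 2 * P = (S - 6 * P) / d%:R ^+ 2 by ring.
  rewrite normrM (gtr0_norm (_ : 0 < (d%:R ^+ 2)^-1)) ?invr_gt0 // ler_pdivrMr //.
  have -> : 11 * ln 4 / d%:R * d%:R ^+ 2 = 11 * (d%:R * ln 4) :> R by field; rewrite gt_eqF.
  exact: E1.
have F2 : `|6 / d%:R ^+ 2 * P - 6 / d%:R ^+ 2 * Q| <= 3 * dl + eps / 8 + (3 * `|ln (x - 1)| + 2 * dl) / d%:R.
  rewrite -mulrBr normrM (gtr0_norm (_ : 0 < 6 / d%:R ^+ 2)) ?divr_gt0 // mulrC -ler_pdivlMr ?divr_gt0 //.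
  apply: le_trans E2 _; rewrite lnx.
  have -> : (3 * dl + eps / 8 + (3 * `|ln (x - 1)| + 2 * dl) / d%:R) / (6 / d%:R ^+ 2) =
     d%:R ^+ 2 / 2 * dl + d%:R ^+ 2 * (eps / 48) + d%:R / 2 * `|ln (x - 1)| + d%:R / 3 * dl.
    by move: `|_| => y; field; rewrite gt_eqF.
  have h1 := ler_wpM2l (ltW d2) E6.
  have h2 : d%:R / 2 * - ln (x - 1) <= d%:R / 2 * `|ln (x - 1)|.
    by rewrite ler_wpM2l ?divr_ge0 // -normrN ler_norm.
  have h3 : 0 <= d%:R * dl by rewrite mulr_ge0 // ltW.
  by rewrite -(natr1 d); lra.
have Kd' : 11 * ln 4 / d%:R + (3 * `|ln (x - 1)| + 2 * dl) / d%:R + (12 * M)%:R / d%:R <= eps / 4.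
  by apply: le_trans Kd; rewrite -!mulrDl ler_pM2r ?invr_gt0 // /K; lra.
have -> : S / d%:R ^+ 2 - eta R = (S / d%:R ^+ 2 - 6 / d%:R ^+ 2 * P)
   + (6 / d%:R ^+ 2 * P - 6 / d%:R ^+ 2 * Q) + (U - V) + (V - W) + (W - eta R).
  by rewrite /U; ring.
apply: le_trans (ler_normD _ _) _; apply: le_trans (lerD (ler_normD _ _) E5) _.
apply: le_trans (lerD (lerD (ler_normD _ _) E4) (lexx _)) _.
apply: le_trans (lerD (lerD (lerD (ler_normD _ _) E3) (lexx _)) (lexx _)) _.
apply: le_trans (lerD (lerD (lerD (lerD F1 F2) (lexx _)) (lexx _)) (lexx _)) _.
move: Kd' qd; rewrite /dl; set a := 11 * _ / _; set b := (3 * _ + _) / _; set c := (12 * M)%:R / _.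
lra.
Qed.

End MeanLimit.

(** * From equidistribution to the heights *)

Section Conclusion.
Variable R : realType.

Lemma equidistributed_logtri : equidistributed (@logtri R) (eta R).
Proof.
apply: (@equidistributed_of_approx R _ _ (fun k => 6 * k)%N (@logtri_periodic R)).
- exact: logtri_mean_approx.
- by move=> D; exists D => k Dk; apply: leq_trans Dk _; apply: leq_pmull.
- exact: mean_logtri_limit.
Qed.

Definition torsion_point (z : algC) (p : nat * nat) : algC * algC :=
  ((z ^+ p.1)^-1, (z ^+ p.2)^-1).

(** The comparison of heights with orbit averages requires order above 2; the points left over form
    a finite list independent of [d]. *)
Lemma torsion_order2 (d r s : nat) (z : algC) : d.-primitive_root z ->
  (d %/ gcdn (gcdn r s) d <= 2)%N ->
  torsion_point z (r, s) \in [:: (1, 1); (1, -1); (-1, 1); (-1, -1)].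
Proof.
move=> zP; set g := gcdn _ d => N2; have d0 := prim_order_gt0 zP.
have gd : (g %| d)%N by rewrite dvdn_gcdr.
have g0 : (0 < g)%N by rewrite gcdn_gt0 d0 orbT.
have N0 : (0 < d %/ g)%N by rewrite divn_gt0 // dvdn_leq.
have sign k : (g %| k)%N -> (z ^+ k)^-1 = 1 \/ (z ^+ k)^-1 = -1.
  move=> gk; have : (z ^+ k) ^+ 2 == 1.
    rewrite -exprM -(prim_order_dvd zP) mulnC -[X in (X %| _)%N](divnK gd) dvdn_mul //.
    by case: (d %/ g)%N N0 N2 => [//|[|[|//]]].
  by rewrite sqrf_eq1 => /orP[/eqP->|/eqP->]; rewrite ?invrN invr1; [left|right].
have gr : (g %| r)%N by rewrite (dvdn_trans (dvdn_gcdl _ _)) ?dvdn_gcdl.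
have gs : (g %| s)%N by rewrite (dvdn_trans (dvdn_gcdl _ _)) ?dvdn_gcdr.
by rewrite /torsion_point /=; case: (sign _ gr) => ->; case: (sign _ gs) => ->;
  rewrite !inE eqxx ?orbT.
Qed.

(** A pair of order [n] consists of multiples of [d / n], at most [n] for each coordinate, and [n]
    takes at most [M.+1] values. *)
Lemma card_small_order (d M : nat) : (0 < d)%N ->
  (\sum_(r < d) \sum_(s < d) (d %/ gcdn (gcdn r s) d <= M) <= M.+1 ^ 3)%N.
Proof.
move=> d0; pose c n r := (r == 0 %[mod d %/ n])%N.
apply: leq_trans (_ : \sum_(r < d) \sum_(s < d)
    \sum_(n < M.+1 | (n %| d)%N) c n r * c n s <= _)%N.
  apply: leq_sum => r _; apply: leq_sum => s _.
  case: (leqP (d %/ gcdn (gcdn r s) d) M) => //= NM; set g := gcdn _ d in NM *.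
  have [gr gs gd] := gcdn3_dvd r s d; rewrite -/g in gr gs gd.
  have Nd : (d %/ g %| d)%N by rewrite -{2}(divnK gd) dvdn_mulr.
  have NE : (d %/ (d %/ g) = g)%N by rewrite divnA // mulKn.
  rewrite (bigD1 (Ordinal (NM : d %/ g < M.+1)%N)) //=.
  by rewrite /c NE !mod0n -!/(dvdn _ _) gr gs.
have -> : (\sum_(r < d) \sum_(s < d) \sum_(n < M.+1 | (n %| d)%N) c n r * c n s =
    \sum_(n < M.+1 | (n %| d)%N) (\sum_(r < d) c n r) ^ 2)%N.
  under eq_bigr do rewrite exchange_big /=.
  rewrite exchange_big /=; apply: eq_bigr => n _.
  by rewrite expnS expn1 big_distrlr.
apply: leq_trans (_ : \sum_(n < M.+1) M.+1 ^ 2 <= _)%N; last first.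
  by rewrite sum_nat_const card_ord -expnS.
rewrite [leqRHS](bigID (fun n : 'I_M.+1 => (n %| d)%N)) /=; apply: leq_trans (leq_addr _ _).
apply: leq_sum => n nd; rewrite leq_exp2r //.
have n0 := dvdn_gt0 d0 nd; have e0 : (d %/ n %| d)%N by rewrite -{2}(divnK nd) dvdn_mulr.
rewrite -big_mkcond /=.
apply: leq_trans (card_mod_le 0 d0 e0) _.
by rewrite divnA // mulKn // ltnW.
Qed.

Lemma mean_height (eps : R) : 0 < eps -> exists D, forall d z, (D <= d)%N ->
  d.-primitive_root z ->
  mean2 d (fun r s => `|heightCap R (torsion_point z (r, s)) - eta R|) <= eps.
Proof.
move=> e0; have e3 : 0 < eps / 3 by rewrite divr_gt0.
have [D1 h1] := equidistributed_logtri e3.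
pose L : seq (algC * algC) := [:: (1, 1); (1, -1); (-1, 1); (-1, -1)].
(* A single bound for all pairs of order at most [M]: the sum and [|eta R|] cover orders 1 and 2,
   and 4 covers [4 / sqrt N] for the others. *)
pose B : R := 4 + \sum_(w <- L) `|heightCap R w| + `|eta R|.
have S0 (X : seq (algC * algC)) : 0 <= \sum_(w <- X) `|heightCap R w| by apply: sumr_ge0.
have B4 : 4 <= B by rewrite /B; have := S0 L; have := normr_ge0 (eta R); lra.
have B0 : 0 <= B by lra.
(* Beyond [M], [sqrt N] is at least [12 / eps], so the comparison error [4 / sqrt N] is at most
   [eps / 3]. *)
pose M := maxn 2 (Num.bound ((12 / eps) ^+ 2)).
have M2 : (2 <= M)%N by rewrite leq_maxl.
have sM N : (M < N)%N -> 4 / Num.sqrt N%:R <= eps / 3.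
  move=> MN; have N0 : 0 < Num.sqrt N%:R :> R by rewrite sqrtr_gt0 ltr0n; lia.
  rewrite ler_pdivrMr // mulrC -ler_pdivrMr //.
  have -> : 4 / (eps / 3) = 12 / eps by field; rewrite gt_eqF.
  have q0 : 0 <= 12 / eps by rewrite divr_ge0 // ltW.
  rewrite -[leLHS]ger0_norm // -sqrtr_sqr ler_wsqrtr //.
  apply: ltW; apply: lt_le_trans (archi_boundP (sqr_ge0 _)) _.
  by rewrite ler_nat; apply: leq_trans (ltnW MN); apply: leq_maxr.
pose C : R := B * (M.+1 ^ 3)%:R; have C0 : 0 <= C by rewrite mulr_ge0.
exists (maxn D1 (Num.bound (C / (eps / 3)))).+1 => d z Dd zP.
have d0 := prim_order_gt0 zP.
have d0' : 0 < d%:R :> R by rewrite ltr0n.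
have D1d : (D1 <= d)%N by apply: leq_trans (ltnW Dd); apply: leq_maxl.
have Cd : C / d%:R <= eps / 3.
  rewrite ler_pdivrMr // mulrC -ler_pdivrMr //.
  apply: ltW; apply: lt_le_trans (archi_boundP _) _; first by rewrite divr_ge0 // ltW.
  by rewrite ler_nat; apply: leq_trans (ltnW Dd); apply: leq_maxr.
pose N r s := (d %/ gcdn (gcdn r s) d)%N.
apply: le_trans (_ : mean2 d (fun r s => `|orbit_avg d (@logtri R) r s - eta R|
    + (eps / 3 + B * (N r s <= M)%N%:R)) <= _).
  apply: ler_mean2 => r s _ _; set H := heightCap R _.
  have near_avg : (2 < N r s)%N -> `|H - orbit_avg d (@logtri R) r s| <= 4 / Num.sqrt (N r s)%:R.
    exact: heightCap_approx.
  have [Ms|Ml] := leqP (N r s) M; last first.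
    rewrite mulr0 addr0 -(subrK (orbit_avg d (@logtri R) r s) H) -addrA addrC.
    apply: le_trans (ler_normD _ _) _; rewrite addrC; apply: lerD.
      by [].
    apply: le_trans (near_avg _) (sM _ Ml).
    by apply: leq_ltn_trans Ml.
  rewrite mulr1; have [N2|N2] := leqP (N r s) 2.
    have := torsion_order2 zP N2 => hin.
    have : `|H - eta R| <= B.
      apply: le_trans (ler_normB _ _) _; rewrite lerD2r.
      rewrite (big_rem _ hin) /=; have := S0 (rem (torsion_point z (r, s)) L).
      rewrite -/H; lra.
    by move=> h; apply: le_trans h _; rewrite addrA lerDr addr_ge0 // ltW.
  rewrite -(subrK (orbit_avg d (@logtri R) r s) H) -addrA addrC.
  apply: le_trans (ler_normD _ _) _; rewrite addrC; apply: lerD; first by [].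
  apply: le_trans (near_avg N2) _.
  apply: le_trans (_ : 4 <= _); last by apply: le_trans B4 _; rewrite lerDr ltW.
  rewrite ler_piMr // invf_le1; last by rewrite sqrtr_gt0 ltr0n (ltn_trans _ N2).
  by rewrite -[leLHS]sqrtr1 ler_wsqrtr // ler1n (ltn_trans _ N2).
rewrite mean2D mean2D mean2_const // mean2Z.
have h1d := h1 d D1d d0.
have : B * mean2 d (fun r s => (N r s <= M)%N%:R) <= C / d%:R.
  rewrite /mean2 mulrA ler_pdivrMr ?exprn_gt0 //.
  have -> : C / d%:R * d%:R ^+ 2 = C * d%:R by rewrite expr2 mulrA divfK ?gt_eqF.
  rewrite /C -mulrA ler_wpM2l //.
  apply: le_trans (_ : (M.+1 ^ 3)%:R <= _); last by rewrite ler_peMr // ler1n.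
  under eq_bigr do rewrite -natr_sum.
  by rewrite -natr_sum ler_nat card_small_order.
move=> hB; have e33 : eps = eps / 3 + (eps / 3 + eps / 3) by field.
rewrite [leRHS]e33; apply: lerD h1d _; apply: lerD => //; exact: le_trans hB Cd.
Qed.

Lemma torsion_seq (d : nat) (z : algC) (zP : d.-primitive_root z)
  (s := [seq torsion_point z (val p.1, val p.2)
        | p <- enum [pred p : 'I_d * 'I_d | (0 < p.1 + p.2)%N]]) :
  uniq s /\ torsion d = [set` s].
Proof.
have d0 := prim_order_gt0 zP; split.
  rewrite map_inj_uniq ?enum_uniq // => -[r t] [r' t'] [] /invr_inj /eqP + /invr_inj /eqP.
  by rewrite !(eq_prim_root_expr zP) /= !modn_small // => /eqP/val_inj -> /eqP/val_inj ->.
apply/seteqP; split=> w /=.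
  move=> [/unity_rootP w1 /unity_rootP w2 wn].
  have w1' : w.1^-1 ^+ d = 1 by rewrite exprVn w1 invr1.
  have w2' : w.2^-1 ^+ d = 1 by rewrite exprVn w2 invr1.
  have [r er] := prim_rootP zP w1'; have [t et] := prim_rootP zP w2'.
  apply/mapP; exists (r, t); last first.
    by rewrite /torsion_point /= -er -et !invrK -surjective_pairing.
  rewrite mem_enum inE /= lt0n; apply: contra wn; rewrite addn_eq0 => /andP[/eqP r0 /eqP t0].
  by rewrite [w]surjective_pairing -[w.1]invrK -[w.2]invrK er et r0 t0 expr0 invr1.
move=> /mapP[p pp ->]; move: pp; rewrite mem_enum inE => pp; split=> /=.
- by apply/unity_rootP; rewrite exprVn exprAC (prim_expr_order zP) expr1n invr1.
- by apply/unity_rootP; rewrite exprVn exprAC (prim_expr_order zP) expr1n invr1.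
apply: contraTneq pp => -[/eqP + /eqP]; rewrite !invr_eq1 -!(prim_order_dvd zP).
by rewrite /dvdn !modn_small // => /eqP -> /eqP ->.
Qed.

Lemma fsbig_torsion (d : nat) (z : algC) (F : algC * algC -> R) :
  d.-primitive_root z ->
  \sum_(w \in torsion d) F w =
  \sum_(p : 'I_d * 'I_d | (0 < p.1 + p.2)%N) F (torsion_point z (val p.1, val p.2)).
Proof.
move=> zP; have [us ->] := torsion_seq zP.
set s := map _ _ in us *.
rewrite (@fsbigE _ _ _ _ _ s) //=; last by move=> w -> .
rewrite big_mkcond /=; transitivity (\sum_(w <- s) F w).
  by apply: eq_big_seq => w ws; rewrite mem_set.
by rewrite /s big_map big_enum.
Qed.

Lemma card_torsion_filter (d : nat) (z : algC) (P : algC * algC -> bool) :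
  d.-primitive_root z ->
  (#|` fset_set [set w | torsion d w /\ P w] |%fset)%:R =
  \sum_(p : 'I_d * 'I_d | (0 < p.1 + p.2)%N) (P (torsion_point z (val p.1, val p.2)))%:R :> R.
Proof.
move=> zP; rewrite -(fsbig_torsion (fun w => (P w)%:R) zP).
rewrite card_fset_sum1 natr_sum.
transitivity (\sum_(w \in torsion d `&` [set w | P w]) (1 : R)).
  rewrite fsbig_finite //; apply: finite_setIl.
  by have [_ ->] := torsion_seq zP; apply: finite_seq.
rewrite fsbig_mkcondr; apply: eq_fsbigr => w _.
by case: (boolP (P w)) => Pw; [rewrite mem_set|rewrite memNset // => /=; apply/negP].
Qed.

Lemma card_nonzero_pairs (d : nat) : (0 < d)%N ->
  \sum_(p : 'I_d * 'I_d | (0 < p.1 + p.2)%N) 1 = d%:R ^+ 2 - 1 :> R.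
Proof.
move=> d0; apply/eqP; rewrite eq_sym subr_eq; apply/eqP.
transitivity (\sum_(p : 'I_d * 'I_d) (1 : R)).
  by rewrite big_const iter_addr_0 card_prod card_ord -natrX expnS expn1.
rewrite (bigID (fun p : 'I_d * 'I_d => (0 < p.1 + p.2)%N)) /=; congr (_ + _).
rewrite (big_pred1 (Ordinal d0, Ordinal d0)) // => -[r s] /=.
by rewrite -leqNgt leqn0 addn_eq0 xpair_eqE -!val_eqE.
Qed.

Lemma torsion_height_deviation (eps : R) : 0 < eps -> exists D, forall d z, (D <= d)%N ->
  d.-primitive_root z ->
  (d%:R ^+ 2 - 1)^-1 * (\sum_(p : 'I_d * 'I_d | (0 < p.1 + p.2)%N)
     `|heightCap R (torsion_point z (val p.1, val p.2)) - eta R|) <= eps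
  /\ 0 < d%:R ^+ 2 - 1 :> R.
Proof.
move=> e0; have [D hD] := mean_height (divr_gt0 e0 (ltr0n R 2)).
exists (maxn D 2) => d z Dd zP; have d0 := prim_order_gt0 zP.
have := hD d z (leq_trans (leq_maxl _ _) Dd) zP.
have d2 : 2 <= d%:R :> R by rewrite ler_nat; apply: leq_trans Dd; apply: leq_maxr.
have d2' : 4 <= d%:R ^+ 2 :> R.
  have -> : 4 = 2 ^+ 2 :> R by rewrite -natrX.
  by apply: lerXn2r; rewrite ?nnegrE.
have dd0 : 0 < d%:R ^+ 2 :> R by lra.
have p0 : 0 < d%:R ^+ 2 - 1 :> R by lra.
rewrite /mean2 ler_pdivrMr // => h; split=> //.
rewrite ler_pdivrMl //.
(* The normalizations differ by a factor at most 2, as [d ^+ 2 <= 2 * (d ^+ 2 - 1)] for [d >= 2]. *)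
apply: le_trans (_ : eps / 2 * d%:R ^+ 2 <= _); last first.
  have d2s : d%:R ^+ 2 <= 2 * (d%:R ^+ 2 - 1) :> R by lra.
  have := ler_wpM2l (ltW e0) d2s; lra.
apply: le_trans h; rewrite pair_bigA /=.
rewrite [leRHS](bigID (fun p : 'I_d * 'I_d => (0 < p.1 + p.2)%N)) /= lerDl.
by apply: sumr_ge0.
Qed.

End Conclusion.

Theorem corollary6p8 (R : realType) :
  (forall eps : R, 0 < eps ->
     (fun d : nat =>
        (d%:R ^+ 2 - 1)^-1 *
        (#|` fset_set [set w | torsion d w /\ `|heightCap R w - eta R| < eps] |%fset)%:R)
       @ \oo --> (1 : R)) /\
  (fun d : nat =>
     (d%:R ^+ 2 - 1)^-1 * \sum_(w \in torsion d) heightCap R w)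
    @ \oo --> eta R.
Proof.
split=> [eps eps0|]; apply/cvgrPdist_le => e e0.
  (* Markov's inequality: each point whose height is off by at least [eps] contributes at least
     [eps] to the sum of deviations. *)
  have [D hD] := torsion_height_deviation (mulr_gt0 e0 eps0).
  exists D.+1 => // d /= Dd; have [z zP] := C_prim_root_exists (leq_ltn_trans (leq0n _) Dd).
  have [h p0] := hD d z (ltnW Dd) zP.
  rewrite (card_torsion_filter _ (fun w => `|heightCap R w - eta R| < eps) zP).
  rewrite -(ler_pM2r eps0); apply: le_trans h.
  set S := \sum_(p | _) _; set T := \sum_(p | _) _.
  have -> : 1 - (d%:R ^+ 2 - 1)^-1 * S = (d%:R ^+ 2 - 1)^-1 * (d%:R ^+ 2 - 1 - S).
    by rewrite mulrBr mulVf ?gt_eqF.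
  rewrite normrM gtr0_norm ?invr_gt0 // -mulrA ler_wpM2l ?invr_ge0 ?(ltW p0) //.
  rewrite -(card_nonzero_pairs R (prim_order_gt0 zP)) -sumrB.
  apply: le_trans (ler_wpM2r (ltW eps0) (ler_norm_sum _ _ _)) _.
  rewrite mulr_suml; apply: ler_sum => p _.
  by case: ltP => h; rewrite ?subrr ?normr0 ?mul0r ?subr0 ?normr1 ?mul1r.
have [D hD] := torsion_height_deviation e0.
exists D.+1 => // d /= Dd; have [z zP] := C_prim_root_exists (leq_ltn_trans (leq0n _) Dd).
have [h p0] := hD d z (ltnW Dd) zP; apply: le_trans h.
rewrite (fsbig_torsion _ zP).
set S := \sum_(p | _) _.
have -> : eta R - (d%:R ^+ 2 - 1)^-1 * S = (d%:R ^+ 2 - 1)^-1 * (eta R * (d%:R ^+ 2 - 1) - S).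
  by rewrite mulrBr mulrCA mulVf ?mulr1 // gt_eqF.
rewrite normrM gtr0_norm ?invr_gt0 // ler_wpM2l ?invr_ge0 ?(ltW p0) //.
rewrite -(card_nonzero_pairs R (prim_order_gt0 zP)) mulr_sumr -sumrB.
apply: le_trans (ler_norm_sum _ _ _) _; apply: ler_sum => p _.
by rewrite mulr1 distrC.
Qed.
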